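(* Let $\widehat\beta,\widehat\pi,\beta,\pi$ be as in the context, let $\kappa,\tau,\gamma,l\in(0,+\infty)$, $f\in L^2(Q)$, $\vartheta_0\in V$, $w_0\in W$, $\varphi_0\in V$, $\widehat\beta(\varphi_0)\in L^1(\Omega)$, and let $\varphi^*\in W$ with $\beta^\circ(\varphi^* )\in H$. Then there exists $\rho^*>0$ such that the following holds: for every $\rho>\rho^*$ and for every solution $(w,\varphi,\xi,\sigma)$ of Problem (B) there exists a time $T^*\in[0,T)$ such that $$\varphi(t)=\varphi^*\quad\text{a.e. in }\Omega,\ \text{for a.a. }t\in(T^*,T).$$
   Context: $\Omega\subset\mathbb R^N$ is open, bounded and smooth, with boundary $\Gamma$ and outward normal derivative $\partial_n$; $T>0$, $Q=\Omega\times(0,T)$. $H=L^2(\Omega)$, $V=H^1(\Omega)$, $W=\{v\in H^2(\Omega):\partial_n v=0 \text{ on }\Gamma\}$; $H,V$ have their standard norms and $\|u\|_W^2=\|u\|_H^2+\|\Delta u\|_H^2$. $\widehat\beta:\mathbb R\to[0,+\infty]$ is convex, proper, lower semicontinuous with $\widehat\beta(0)=0$; $\widehat\pi:\mathbb R\to\mathbb R$ is $C^1$ with Lipschitz-continuous derivative; $\beta=\partial\widehat\beta$ (subdifferential, a maximal monotone graph) and $\pi=\widehat\pi'$. $\beta^\circ(r)$ denotes the element of $\beta(r)$ of minimum modulus. $\operatorname{Sign}$ is the subdifferential of $\|\cdot\|_H$ on $H$: $\operatorname{Sign}(v)=\{v/\|v\|_H\}$ if $v\ne0$, and $\operatorname{Sign}(0)$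 is the closed unit ball of $H$. A solution of Problem (B) (with parameter $\rho>0$ and target $\varphi^*$) is a quadruplet $(w,\varphi,\xi,\sigma)$ with $w\in H^2(0,T;H)\cap W^{1,\infty}(0,T;V)\cap H^1(0,T;W)$, $\varphi\in H^1(0,T;H)\cap L^\infty(0,T;V)\cap L^2(0,T;W)$, $\xi\in L^2(0,T;H)$, $\sigma\in L^\infty(0,T;H)$, such that - $(w_t+l\varphi)_t-\kappa\Delta w_t-\tau\Delta w=f$ a.e. in $Q$, - $\varphi_t-\Delta\varphi+\xi+\pi(\varphi)+\rho\sigma=\gamma w_t$ a.e. in $Q$, - $\sigma(t)\in\operatorname{Sign}(\varphi(t)-\varphi^* )$ in $H$ for a.e. $t\in(0,T)$, - $\xi\in\beta(\varphi)$ a.e. in $Q$, - $w_t(0)=\vartheta_0$, $w(0)=w_0$, $\varphi(0)=\varphi_0$ a.e. in $\Omega$. *)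

(* Defs.v *)
From HB Require Import structures.
From mathcomp Require Import all_boot all_order all_algebra.
From mathcomp Require Import all_classical all_reals all_analysis.
Set Implicit Arguments. Unset Strict Implicit. Unset Printing Implicit Defensive.
Import Order.TTheory GRing.Theory Num.Theory.
Import numFieldNormedType.Exports.
Local Open Scope classical_set_scope.
Local Open Scope ring_scope.

(* The Borel sigma-algebra of R^n, generated by the coordinates. *)
Section measurable_rV.
Context {d} {T : sigmaRingType d} {n : nat}.

Let coors : 'I_n -> 'rV[T]_n -> T := fun i x => x ord0 i.

Let rV_set0 : g_sigma_preimage coors set0.
Proof. exact: sigma_algebra0. Qed.

Let rV_setC A : g_sigma_preimage coors A -> g_sigma_preimage coors (~` A).
Proof. exact: sigma_algebraC. Qed.

Let rV_bigcup (F : _^nat) : (forall i, g_sigma_preimage coors (F i)) ->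
  g_sigma_preimage coors (\bigcup_i (F i)).
Proof. exact: sigma_algebra_bigcup. Qed.

HB.instance Definition _ := @isMeasurable.Build (measure_tuple_display d)
  'rV[T]_n (g_sigma_preimage coors) rV_set0 rV_setC rV_bigcup.

Lemma measurable_coor (i : 'I_n) :
  measurable_fun [set: 'rV[T]_n] (fun x : 'rV[T]_n => x ord0 i).
Proof.
move=> _ Y mY; rewrite setTI; apply: sub_sigma_algebra => /=.
rewrite -bigcup_seq/=; exists i => /=; first by rewrite mem_index_enum.
by exists Y => //; rewrite setTI.
Qed.

Lemma measurable_fun_coorP d' (T' : measurableType d') (f : T' -> 'rV[T]_n) :
  (forall i, measurable_fun [set: T'] (fun x => f x ord0 i)) ->
  measurable_fun [set: T'] f.
Proof.
move=> mf; move=> _ Y mY; rewrite setTI.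
apply: (@smallest_sub _ (sigma_algebra setT)
  (\big[setU/set0]_(i < n) preimage_set_system setT (coors i) measurable)
  [set Y | measurable (f @^-1` Y)]) => //.
- split.
  + by rewrite /= preimage_set0.
  + by move=> A mA; rewrite setTD; exact: measurableC mA.
  + move=> F mF; rewrite /mkset preimage_bigcup; apply: bigcup_measurable => k _; exact: mF.
- rewrite -bigcup_seq/=; apply: bigcup_sub => i _ A [B mB <-] /=.
  by rewrite setTI -[X in measurable X]setTI; exact: mf.
Qed.

End measurable_rV.

Section lebesgue_rV.
Context (R : realType).

Definition rV_cons n (p : measurableTypeR R * 'rV[R]_n) : 'rV[R]_n.+1 :=
  \row_j (if unlift ord0 j is Some i then p.2 ord0 i else p.1).

Lemma measurable_rV_cons n : measurable_fun setT (@rV_cons n).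
Proof.
apply: measurable_fun_coorP => j.
under eq_fun do rewrite mxE.
case: (unlift ord0 j) => [i|]; last exact: measurable_fst.
exact: measurableT_comp (measurable_coor i) measurable_snd.
Qed.


Section step.
Context (n : nat) (mu : {sigma_finite_measure set 'rV[R]_n -> \bar R}).
Local Open Scope ereal_scope.

Definition lebesgue_rV_step : set 'rV[R]_n.+1 -> \bar R :=
  pushforward (@lebesgue_measure R \x mu) (@rV_cons n).

Let step0 : lebesgue_rV_step set0 = 0.
Proof. by rewrite /lebesgue_rV_step /pushforward preimage_set0 measure0. Qed.

Let step_ge0 A : 0 <= lebesgue_rV_step A.
Proof.
rewrite /lebesgue_rV_step /pushforward.
exact: (@measure_ge0 _ _ _ (lebesgue_measure \x mu)).
Qed.

Let step_sigma_additive : semi_sigma_additive lebesgue_rV_step.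
Proof.
move=> F mF tF mUF; rewrite /lebesgue_rV_step /pushforward preimage_bigcup.
have mpre A : measurable A -> measurable (@rV_cons n @^-1` A).
  by move=> mA; rewrite -[X in measurable X]setTI; exact: measurable_rV_cons.
apply: measure_semi_sigma_additive.
- by move=> i; exact: mpre.
- apply/trivIsetP => /= i j _ _ ij; rewrite -preimage_setI.
  by move/trivIsetP : tF => /(_ _ _ _ _ ij) ->//; rewrite preimage_set0.
- by rewrite -preimage_bigcup; exact: mpre.
Qed.

HB.instance Definition _ := isMeasure.Build _ _ _ lebesgue_rV_step
  step0 step_ge0 step_sigma_additive.

Let step_sigma_finite : sigma_finite setT lebesgue_rV_step.
Proof.
pose g (x : 'rV[R]_n.+1) : R * 'rV[R]_n :=
  (x ord0 ord0, \row_i x ord0 (lift ord0 i)).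
have gK p : g (rV_cons p) = p.
  case: p => a y; rewrite /g /rV_cons; congr pair.
    by rewrite mxE unlift_none.
  by apply/rowP => i; rewrite !mxE liftK.
have mg : measurable_fun setT g.
  apply: measurable_fun_pair; first exact: measurable_coor.
  apply: measurable_fun_coorP => i; under eq_fun do rewrite mxE.
  exact: measurable_coor.
have /sigma_finiteP[F [FT ndF Foo]] := sigma_finiteT (@lebesgue_measure R).
have /sigma_finiteP[G [GT ndG Goo]] := sigma_finiteT mu.
exists (fun k => g @^-1` (F k `*` G k)).
  apply/seteqP; split => // x _.
  have [i _ Fi] : (\bigcup_k F k) (g x).1 by rewrite -FT.
  have [j _ Gj] : (\bigcup_k G k) (g x).2 by rewrite -GT.
  exists (maxn i j) => //; split.
    by move: Fi; exact/subsetPset/ndF/leq_maxl.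
  by move: Gj; exact/subsetPset/ndG/leq_maxr.
move=> k; have [mF Fk] := Foo k; have [mG Gk] := Goo k; split.
  by rewrite -[X in measurable X]setTI; apply: mg => //; exact: measurableX.
rewrite /lebesgue_rV_step /pushforward.
rewrite (_ : @rV_cons n @^-1` (g @^-1` (F k `*` G k)) = F k `*` G k).
  by rewrite product_measure1E// lte_mul_pinfty// ge0_fin_numE.
by apply/seteqP; split => p; rewrite /preimage /mkset gK.
Qed.

HB.instance Definition _ := Measure_isSigmaFinite.Build _ _ _ lebesgue_rV_step
  step_sigma_finite.

End step.

(* Lebesgue measure on R^n: n-fold product of the one on R. *)
Fixpoint lebesgue_rV (n : nat) : {sigma_finite_measure set 'rV[R]_n -> \bar R} :=
  match n with
  | 0 => [the {sigma_finite_measure set 'rV[R]_0 -> \bar R} of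
           \d_ (0 : 'rV[R]_0)]
  | m.+1 => [the {sigma_finite_measure set 'rV[R]_m.+1 -> \bar R} of
              lebesgue_rV_step (lebesgue_rV m)]
  end.

Lemma open_measurable_rV n (U : set 'rV[R]_n) : open U -> measurable U.
Proof.
move=> oU.
pose box (q : 'rV[rat]_n) (k : nat) : set 'rV[R]_n :=
  [set x | forall j, `|x ord0 j - ratr (q ord0 j)| < k.+1%:R^-1].
pose B (p : 'rV[rat]_n * nat) : set 'rV[R]_n :=
  if `[< box p.1 p.2 `<=` U >] then box p.1 p.2 else set0.
have mbox q k : measurable (box q k).
  rewrite (_ : box q k = \bigcap_(j in [set: 'I_n])
      (fun x : 'rV[R]_n => x ord0 j) @^-1`
        `](ratr (q ord0 j) - k.+1%:R^-1), (ratr (q ord0 j) + k.+1%:R^-1)[).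
    apply: fin_bigcap_measurable; first exact: finite_finset.
    move=> j _; rewrite -[X in measurable X]setTI.
    exact: measurable_coor.
  apply/seteqP; split => x /= h j.
    by move=> _ /=; have := h j; rewrite ltr_distl in_itv.
  by have := h j I; rewrite /= in_itv /= ltr_distl.
have -> : U = \bigcup_p B p.
  apply/seteqP; split => [x Ux|x [p _]]; last first.
    by rewrite /B; case: asboolP => // + xB => /(_ _ xB).
  have /nbhs_ballP[e /= e0 eU] : nbhs x U by exact: open_nbhs_nbhs.
  have [k ke] : exists k : nat, k.+1%:R^-1 < e / 2.
    have e20 : 0 < e / 2 by rewrite divr_gt0.
    near \oo => k; exists k; near: k.
    exact: (near_infty_natSinv_lt (PosNum e20)).
  have k0 : (0 : R) < k.+1%:R^-1 by rewrite invr_gt0 ltr0n.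
  have /choice[q qP] : forall j : 'I_n, exists q : rat,
      `|x ord0 j - ratr q| < k.+1%:R^-1.
    move=> j; have [|q] := @rat_in_itvoo R (x ord0 j - k.+1%:R^-1)
                                           (x ord0 j + k.+1%:R^-1).
      by rewrite ltrD2l gtrN.
    rewrite in_itv /= => /andP[h1 h2]; exists q.
    by rewrite distrC ltr_distl h1 h2.
  exists (\row_j q j, k) => //; rewrite /B /=; case: asboolP.
    by move=> _ j; rewrite mxE.
  case; move=> y yb; apply: eU; split=> // i j; rewrite (ord1 i).
  rewrite /ball /=; have := yb j; have := qP j; rewrite mxE => h1 h2.
  rewrite (le_lt_trans (ler_distD (ratr (q j)) _ _))//.
  rewrite (splitr e) ltrD//; first exact: lt_trans h1 ke.
  by rewrite distrC; exact: lt_trans h2 ke.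
apply: countable_bigcupT_measurable => [|p]; first exact: countableP.
by rewrite /B; case: asboolP.
Unshelve. all: by end_near.
Qed.

End lebesgue_rV.

Section domain.
Context (R : realType) (N : nat).
Implicit Types (f u v g z psi : 'rV[R]_N -> R) (i : 'I_N).

Definition partial i f : 'rV[R]_N -> R := fun x => 'D_(delta_mx ord0 i) f x.

Fixpoint Ck (k : nat) f : Prop :=
  if k is m.+1 then
    forall i, (forall x, derivable f x (delta_mx ord0 i)) /\ Ck m (partial i f)
  else continuous f.

Definition smooth f : Prop := forall k, Ck k f.

(* Near each boundary point, O is the sublevel set of a smooth function with
   nonvanishing gradient: the boundary is a smooth hypersurface and O lies
   locally on one side of it. *)
Definition smooth_boundary (O : set 'rV[R]_N) : Prop :=
  forall x, closure O x -> ~ O x ->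
  exists U g, [/\ nbhs x U, smooth g, exists i, partial i g x != 0 &
                  forall y, U y -> (O y <-> g y < 0)].

Record smooth_domain := SmoothDomain {
  dom :> set 'rV[R]_N;
  dom_open : open dom;
  dom_bounded : bounded_set dom;
  dom_smooth : smooth_boundary dom }.

Arguments dom_open O : clear implicits, rename.

Variable O : smooth_domain.

(* Elements of function spaces over O are represented by functions on the whole
   of R^N; only their values almost everywhere in O matter, since all integrals
   and "almost everywhere" statements are relative to the following measure. *)
Definition dom_measure : {measure set 'rV[R]_N -> \bar R} :=
  mrestr (lebesgue_rV R N) (open_measurable_rV (dom_open O)).

Definition test_function psi : Prop :=
  smooth psi /\
  exists2 K, compact K /\ K `<=` O & forall x, ~ K x -> psi x = 0.

Definition inL2 u : Prop := u \in Lfun dom_measure 2%:E.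

Definition normL2 u : R := fine (Lnorm dom_measure 2%:E (EFin \o u)).

Definition dotL2 u v : R := \int[dom_measure]_x (u x * v x).

Definition is_weak_partial i u g : Prop :=
  forall psi, test_function psi ->
  \int[dom_measure]_x (u x * partial i psi x) =
  - \int[dom_measure]_x (g x * psi x).

Definition has_weak_partial i u : Prop :=
  exists2 g, inL2 g & is_weak_partial i u g.

(* Unique up to equality almost everywhere; 0 is a junk value. *)
Definition wpartial i u : 'rV[R]_N -> R :=
  xget (fun=> 0) [set g | inL2 g /\ is_weak_partial i u g].

Definition inH1 u : Prop := inL2 u /\ forall i, has_weak_partial i u.

Definition normH1 u : R :=
  Num.sqrt (normL2 u ^+ 2 + \sum_(i < N) normL2 (wpartial i u) ^+ 2).

Definition inH2 u : Prop := inH1 u /\ forall i, inH1 (wpartial i u).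

Definition laplacian u : 'rV[R]_N -> R :=
  fun x => \sum_(i < N) wpartial i (wpartial i u) x.

(* The outward normal derivative of v in H^2, as an element of the dual of H^1
   (a distribution on the boundary): Green's formula equates this number with
   the boundary integral of the product of the normal derivative of v and the
   trace of z. *)
Definition normal_derivative v z : R :=
  dotL2 (laplacian v) z + \sum_(i < N) dotL2 (wpartial i v) (wpartial i z).

Definition inW v : Prop :=
  inH2 v /\ forall z, inH1 z -> normal_derivative v z = 0.

Definition normW u : R :=
  Num.sqrt (normL2 u ^+ 2 + normL2 (laplacian u) ^+ 2).

(* A normed space of (classes of) functions on O. *)
Record fspace := Fspace {
  fcarrier : ('rV[R]_N -> R) -> Prop;
  fnorm : ('rV[R]_N -> R) -> R }.

Definition spH := Fspace inL2 normL2.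
Definition spV := Fspace inH1 normH1.
Definition spW := Fspace inW normW.

Definition Sign v s : Prop :=
  [/\ inL2 s, normL2 v = 0 -> normL2 s <= 1 &
      normL2 v != 0 -> \forall x \ae dom_measure, s x = v x / normL2 v].

End domain.

Arguments dom_open {R N} O : rename.

Section evolution.
Context (R : realType) (N : nat) (O : smooth_domain R N) (T : R).
Implicit Types (u v : R -> 'rV[R]_N -> R) (X : fspace R N).

Definition time_measure : {measure set (measurableTypeR R) -> \bar R} :=
  mrestr (@lebesgue_measure R) (measurable_itv `]0, T[).

Definition cylinder_measure :
    {measure set (measurableTypeR R * 'rV[R]_N)%type -> \bar R} :=
  mrestr (@lebesgue_measure R \x lebesgue_rV R N)%E
    (measurableX (measurable_itv `]0, T[) (open_measurable_rV (dom_open O))).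

Definition simple_in X u : Prop :=
  exists m (A : 'I_m -> set (measurableTypeR R)) (g : 'I_m -> 'rV[R]_N -> R),
    (forall k, measurable (A k) /\ fcarrier X (g k)) /\
    forall t x, u t x = \sum_(k < m) \1_(A k) t * g k x.

Definition strongly_measurable X u : Prop :=
  (\forall t \ae time_measure, fcarrier X (u t)) /\
  exists2 s : nat -> R -> 'rV[R]_N -> R, (forall n, simple_in X (s n)) &
    \forall t \ae time_measure,
      (fun n => fnorm X (fun x => u t x - s n t x)) @ \oo --> (0 : R).

(* The Bochner space L^p(0,T;X). A function u of this kind need not be jointly
   measurable on the cylinder, so "almost everywhere in the cylinder" is rendered
   below as "for almost every t, for almost every x". *)
Definition inLp (p : \bar R) X u : Prop :=
  strongly_measurable X u /\
  (Lnorm time_measure p (fun t => (fnorm X (u t))%:E) < +oo)%E.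

Definition time_test_function (psi : R -> R) : Prop :=
  (forall n t, derivable (derive1n n psi) t 1) /\
  exists a b, [/\ 0 < a, b < T & forall t, ~ (a <= t <= b) -> psi t = 0].

(* v is the derivative of u in the sense of H-valued distributions on (0,T);
   the equality of the two integrals in H is tested against elements h of H. *)
Definition is_time_derivative u v : Prop :=
  forall psi h, time_test_function psi -> inL2 O h ->
  \int[time_measure]_t (derive1 psi t * dotL2 O (u t) h) =
  - \int[time_measure]_t (psi t * dotL2 O (v t) h).

Definition has_dt u : Prop :=
  exists2 v, inLp 1%:E (spH O) v & is_time_derivative u v.

(* Unique up to equality almost everywhere; 0 is a junk value. *)
Definition dt u : R -> 'rV[R]_N -> R :=
  xget (fun=> fun=> 0) [set v | inLp 1%:E (spH O) v /\ is_time_derivative u v].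

(* The Bochner-Sobolev space W^{1,p}(0,T;X); H^1(0,T;X) is the case p = 2. *)
Definition inW1p (p : \bar R) X u : Prop :=
  [/\ inLp p X u, has_dt u & inLp p X (dt u)].

(* The continuous representative of u in C([0,T];H) takes the value u0 at 0. *)
Definition initial_value u (u0 : 'rV[R]_N -> R) : Prop :=
  exists uc : R -> 'rV[R]_N -> R,
    [/\ forall t, 0 <= t <= T -> inL2 O (uc t),
        forall t, 0 <= t <= T ->
          normL2 O (fun x => uc s x - uc t x) @[s --> within `[0, T] (nbhs t)]
            --> (0 : R),
        \forall t \ae time_measure,
          \forall x \ae dom_measure O, u t x = uc t x &
        \forall x \ae dom_measure O, uc 0 x = u0 x].

End evolution.

Section convex_analysis.
Context (R : realType).
Implicit Types (bh : R -> \bar R).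
Local Open Scope ereal_scope.

Definition convex_ereal bh : Prop :=
  forall (x y t : R), (0 < t < 1)%R ->
  bh (t * x + (1 - t) * y)%R <= t%:E * bh x + (1 - t)%:E * bh y.

Definition proper_ereal bh : Prop := exists x, bh x < +oo.

Definition subdiff bh (r s : R) : Prop :=
  bh r < +oo /\ forall r', bh r + (s * (r' - r))%:E <= bh r'.

(* s is the element of minimum modulus of the subdifferential of bh at r. *)
Definition min_subdiff bh (r s : R) : Prop :=
  subdiff bh r s /\ forall s', subdiff bh r s' -> (`|s| <= `|s'|)%R.

End convex_analysis.

Section problemB.
Context (R : realType) (N : nat) (O : smooth_domain R N) (T : R).
Variables (bh : R -> \bar R) (pih : R -> R) (kappa tau gamma l rho : R).
Variable f : measurableTypeR R * 'rV[R]_N -> R.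
Variables theta0 w0 phi0 phistar : 'rV[R]_N -> R.
Variables w phi xi sigma : R -> 'rV[R]_N -> R.

Local Notation dt := (dt O T).
Local Notation inLp := (inLp T).
Local Notation inW1p := (inW1p O T).
Local Notation H := (spH O).
Local Notation V := (spV O).
Local Notation W := (spW O).

Record solutionB : Prop := SolutionB {
  w_H2_H : inW1p 2%:E H w /\ inW1p 2%:E H (dt w);
  w_W1oo_V : inW1p +oo%E V w;
  w_H1_W : inW1p 2%:E W w;
  phi_H1_H : inW1p 2%:E H phi;
  phi_Loo_V : inLp +oo%E V phi;
  phi_L2_W : inLp 2%:E W phi;
  xi_L2_H : inLp 2%:E H xi;
  sigma_Loo_H : inLp +oo%E H sigma;
  w_equation :
    \forall t \ae time_measure T, \forall x \ae dom_measure O,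
      dt (fun s y => dt w s y + l * phi s y) t x
        - kappa * laplacian O (dt w t) x - tau * laplacian O (w t) x
      = f (t, x);
  phi_equation :
    \forall t \ae time_measure T, \forall x \ae dom_measure O,
      dt phi t x - laplacian O (phi t) x + xi t x + derive1 pih (phi t x)
        + rho * sigma t x
      = gamma * dt w t x;
  sigma_Sign :
    \forall t \ae time_measure T,
      Sign O (fun x => phi t x - phistar x) (sigma t);
  xi_beta :
    \forall t \ae time_measure T, \forall x \ae dom_measure O,
      subdiff bh (phi t x) (xi t x);
  wt_initial : initial_value O T (dt w) theta0;
  w_initial : initial_value O T w w0;
  phi_initial : initial_value O T phi phi0 }.

End problemB.

(* Main.v *)
Require Import Defs.
From HB Require Import structures.
From mathcomp Require Import all_boot all_order all_algebra.
From mathcomp Require Import all_classical all_reals all_analysis.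
From mathcomp Require Import measurable_realfun ess_sup_inf ring lra.
Import Order.TTheory GRing.Theory Num.Theory.
Import numFieldNormedType.Exports.
Local Open Scope classical_set_scope.
Local Open Scope ring_scope.

(** Write chi = phi - phi_star, theta = w_t + l phi, let (.,.) and |.| be the
inner product and norm of H, and let P and G be the squared norms in H of the
gradients of w_t and w.

Sliding.  Testing the phase equation by chi, the monotonicity of the
subdifferential, the Lipschitz bound on pi and (sigma, chi) = |chi| give
  (phi_t, chi) <= (c + L |chi| + gamma |w_t| - rho) |chi|,
with c depending only on phi_star ([phase_test], [laplacian_dissipates],
combined in [one_time_energy]).  If |chi| and |w_t| are bounded for almost
every time by constants that depend neither on rho nor on the solution, a
large rho makes the bracket smaller than a negative constant, as negative as
desired.  Then |chi| decreases at a definite rate and reaches 0 before time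
T / 2, after which it stays there ([extinction_L2]).  Everything thus rests on
a bound uniform in rho.

The uniform bound.  Testing the first equation by theta, instead of by w_t,
avoids the product of phi_t and w_t: the quantity E = |theta|^2 + M |chi|^2
satisfies, at almost every time and for a suitable M,
  E' / 2 + kappa P / 2 <= C (1 + E + G) + |f|^2 / 2,
because the contribution of sigma to the phase equation is -rho |chi| <= 0 and
the gradient of phi coming from theta is absorbed by the dissipation of the
phase equation ([heat_test], [energy_young]).  The term G is nonlocal in time:
the gradient of w is the time integral of the gradient of w_t.  It is controlled
by [dirichlet_history]: if P <= Maj almost everywhere for an integrable Maj,
then G(t) <= 2 G(0) + 2 T * (integral of Maj over (0,t)).  The energy
inequality provides such a majorant as soon as G + alpha E is bounded by
m exp(lambda t), and taking for m the best such constant gives m <= A0 + m / 2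
for lambda large ([gronwall_sup], [a_priori_bound]).  Arguing with integrable
majorants of P is what makes the time integrals legitimate: the weak gradient
of w_t is only a choice made separately at each time, and P may fail to be
measurable in t.

The functional analysis behind the time integrals.  Distributional
derivatives in time become integral identities by testing with smooth
plateaus approximating the indicator of an interval ([weak_primitive],
[time_derivative_primitive]); the chain rule for |u|^2 then follows by an
interval induction from the continuity of u in H ([energy_identity]).  The
functions of time are strongly measurable only up to null sets, so they are
first replaced by pointwise limits of simple functions
([strongly_measurable_regular]), and integrals of functions that agree almost
everywhere are compared with no measurability at hand
([ae_eq_integral_raw]). *)

Set Implicit Arguments. Unset Strict Implicit. Unset Printing Implicit Defensive.

(** * Smooth functions of one variable *)

Section smooth_step.
Context (R : realType).
Implicit Types (f g : R -> R) (x : R) (k n : nat).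

(** Recursion on the derivative, rather than a condition on all iterated
derivatives, lets each closure property below be proved by induction on [k] from
the corresponding differentiation rule. *)
Fixpoint diffn k f : Prop :=
  if k is k'.+1 then (forall x, derivable f x 1) /\ diffn k' (derive1 f) else True.

Lemma diffnW k f : diffn k.+1 f -> diffn k f.
Proof. by elim: k f => // k IH f [df /IH]. Qed.

Lemma diffn_derivable1n f : (forall k, diffn k f) ->
  forall n t, derivable (derive1n n f) t 1.
Proof.
move=> df n t; have := df n.+1; elim: n f {df} => [|n IH] f.
  by case=> df _; rewrite derive1n0.
by move=> [_ /IH]; rewrite derive1Sn.
Qed.

Lemma diffn_is_derive k f g : (forall x, is_derive x 1 f (g x)) ->
  diffn k g -> diffn k.+1 f.
Proof.
move=> fg dg; split=> [x|]; first exact: (@ex_derive _ _ _ _ _ _ _ (fg x)).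
suff -> : (derive1 f) = g by [].
by apply/funext => x; rewrite derive1E; exact: (@derive_val _ _ _ _ _ _ _ (fg x)).
Qed.

Lemma derivable_is_derive1 f x : derivable f x 1 -> is_derive x 1 f ((derive1 f) x).
Proof. by move=> fx; rewrite derive1E; exact: DeriveDef. Qed.

Lemma diffn_cst k (c : R) : diffn k (fun=> c).
Proof.
elim: k c => // k IH c; apply: (@diffn_is_derive k _ (fun=> 0)) => //.
Qed.

Lemma diffnD k f g : diffn k f -> diffn k g -> diffn k (fun x => f x + g x).
Proof.
elim: k f g => // k IH f g [df df'] [dg dg'].
apply: (@diffn_is_derive k _ (fun x => (derive1 f) x + (derive1 g) x)); last exact: IH.
by move=> x; apply: is_deriveD; exact: derivable_is_derive1.
Qed.

Lemma diffnM k f g : diffn k f -> diffn k g -> diffn k (fun x => f x * g x).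
Proof.
elim: k f g => // k IH f g Df Dg; have [df df'] := Df; have [dg dg'] := Dg.
apply: (@diffn_is_derive k _ (fun x => f x * (derive1 g) x + g x * (derive1 f) x)).
  by move=> x; apply: is_deriveM; exact: derivable_is_derive1.
by apply: diffnD; apply: IH => //; exact: diffnW.
Qed.

Lemma diffnV k f : (forall x, f x != 0) -> diffn k f ->
  diffn k (fun x => (f x)^-1).
Proof.
move=> f0; elim: k => // k IH Df; have [df df'] := Df.
apply: (@diffn_is_derive k _
    (fun x => (-1) * ((f x)^-1 * ((f x)^-1 * (derive1 f) x)))).
  move=> x; have := is_deriveV (f0 x) (derivable_is_derive1 (df x)).
  congr is_derive; rewrite /GRing.scale /=; field; exact: f0.
apply: diffnM; first exact: diffn_cst.
by do 2! (apply: diffnM; first exact/IH/diffnW).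
Qed.

Lemma diffn_affine k (a b : R) f : diffn k f -> diffn k (fun x => f (a * x + b)).
Proof.
elim: k f => // k IH f [df df'].
apply: (@diffn_is_derive k _ (fun x => (derive1 f) (a * x + b) * a)); last first.
  by apply: diffnM; [exact: IH|exact: diffn_cst].
move=> x; apply: is_derive1_comp; first exact: derivable_is_derive1.
have := is_deriveD (is_deriveM (is_derive_cst a x 1) (is_derive_id x 1))
  (is_derive_cst b x 1).
by congr is_derive; rewrite /GRing.scale /= !(mulr1, mulr0, addr0).
Qed.

(** The family is closed under differentiation up to linear combinations, which
makes every member smooth; [flat 0] is the classical smooth function vanishing
exactly on the negative half-line. *)
Definition flat n x : R := if 0 < x then x^-1 ^+ n * expR (- x^-1) else 0.

Lemma flat_ge0 n x : 0 <= flat n x.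
Proof.
by rewrite /flat; case: ltrP => // x0; rewrite mulr_ge0 ?expR_ge0// exprn_ge0// invr_ge0 ltW.
Qed.

Lemma flat_gt0 n x : 0 < x -> 0 < flat n x.
Proof. by move=> x0; rewrite /flat x0 mulr_gt0 ?expR_gt0// exprn_gt0// invr_gt0. Qed.

(** The exponential series dominates the power [x^-1 ^+ n.+1]; this bound yields
the differentiability at 0. *)
Lemma flat_le n x : 0 < x -> flat n x <= n.+1`!%:R * x.
Proof.
move=> x0; rewrite /flat x0.
have y0 : 0 < x^-1 by rewrite invr_gt0.
have := @expR_ge1Dxn R x^-1 n (ltW y0).
move: (x^-1) y0 (invrK x) => y y0 xE H; rewrite -{}xE expRN.
rewrite ler_pdivrMr ?expR_gt0// mulrAC ler_pdivlMr//.
have F0 : 0 < n.+1`!%:R :> R by rewrite ltr0n fact_gt0.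
rewrite -exprSr -ler_pdivrMl// mulrC.
by apply: le_trans H; rewrite ler_wpDl.
Qed.

Lemma is_derive_flat n x : is_derive x 1 (flat n) (flat n.+2 x - n%:R * flat n.+1 x).
Proof.
have [x0|x0|x0] := ltgtP x 0.
- rewrite {2 3}/flat ltNge (ltW x0)/= mulr0 subr0.
  apply: (@near_eq_is_derive _ _ _ (fun=> 0)) => //.
  near=> y; rewrite /flat ifN// -leNgt ltW//; near: y.
  exact: lt_nbhsl.
- rewrite {2 3}/flat x0.
  apply: (@near_eq_is_derive _ _ _ ((fun y => y^-1) ^+ n * (expR \o (fun y => - y^-1)))) => //.
    near=> y; rewrite /flat ifT//; last by near: y; exact: lt_nbhsr.
    by rewrite mulrfctE/= exprfctE.
  have x00 : x != 0 by rewrite gt_eqF.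
  have dV : is_derive x 1 (fun y : R => y^-1) (- x^-1 ^+ 2).
    have := is_deriveV (x00 : id x != 0) (is_derive_id x (1:R)).
    by congr is_derive; rewrite /GRing.scale /= mulr1 exprVn.
  (* away from 0, differentiate the formula [x ^- n * expR (- x^-1)] *)
  have dN := is_deriveN dV.
  have de := is_derive1_comp (is_derive_expR _) dN.
  have := is_deriveM (is_deriveX n dV) de.
  congr is_derive; rewrite /GRing.scale /= exprfctE /=.
  by case: n => [|n]; rewrite ?expr0 ?mul0r /= ?exprS; ring.
- rewrite x0 /flat ltxx mulr0 subr0.
  suff H : (h^-1 *: (flat n (h *: 1 + 0) - flat n 0)) @[h --> 0^'] --> (0 : R).
    apply: DeriveDef; first by apply/cvg_ex; exists 0.
    exact/cvg_lim.
  apply/norm_cvg0P.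
  (* the difference quotient at 0 is [flat n.+1], of order [h] *)
  apply: (@squeeze_cvgr _ _ _ _ (fun=> 0) (fun h : R => n.+2`!%:R * `|h|)).
  + near=> h; rewrite normr_ge0/=; have h0 : h != 0 by near: h; exact: nbhs_dnbhs_neq.
    rewrite /GRing.scale /= mulr1 addr0 {2}/flat ltxx subr0.
    have [hp|hn] := ltrP 0 h; last first.
      by rewrite /flat ltNge hn /= mulr0 normr0 mulr_ge0.
    rewrite !gtr0_norm// ?mulr_gt0// ?invr_gt0// ?flat_gt0//.
    have -> : h^-1 * flat n h = flat n.+1 h by rewrite /flat hp exprS mulrA.
    exact: flat_le.
  + exact: cvg_cst.
  + have : {for 0, continuous (fun h : R => n.+2`!%:R * `|h|)}.
      by apply: cvgMr; apply: cvg_norm; exact: cvg_id.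
    by move=> /(continuous_withinNx _ _).1; rewrite normr0 mulr0.
Unshelve. all: by end_near. Qed.

Lemma diffn_flat k n : diffn k (flat n).
Proof.
elim: k n => // k IH n; apply: diffn_is_derive (is_derive_flat n) _.
apply: diffnD => //.
have -> : (fun x => - (n%:R * flat n.+1 x)) = (fun x => (- n%:R) * flat n.+1 x).
  by apply/funext => x; rewrite mulNr.
by apply: diffnM => //; exact: diffn_cst.
Qed.

End smooth_step.

Section step.
Context (R : realType).
Implicit Types (x a b : R).

Let e : R -> R := flat 0.

(** The denominator never vanishes, since [x] and [1 - x] are not both
nonpositive. *)
Definition step x : R := e x / (e x + e (1 - x)).

Let den_gt0 x : 0 < e x + e (1 - x).
Proof.
have [x0|x0] := ltrP 0 x.
  by rewrite ltr_wpDr ?flat_ge0// flat_gt0.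
by rewrite ltr_wpDl ?flat_ge0// flat_gt0// subr_gt0 (le_lt_trans x0).
Qed.

Definition step' x : R :=
  (flat 2 x * e (1 - x) + e x * flat 2 (1 - x)) / (e x + e (1 - x)) ^+ 2.

Lemma is_derive_step x : is_derive x 1 step (step' x).
Proof.
have d1 : is_derive x 1 e (flat 2 x).
  by have := @is_derive_flat R 0 x; rewrite mul0r subr0.
have d2 : is_derive x 1 (fun y => e (1 - y)) (- flat 2 (1 - x)).
  have h : is_derive x 1 (fun y : R => 1 - y) (-1).
    have := is_deriveB (is_derive_cst (1:R) x (1:R)) (is_derive_id x (1 : R)).
    by rewrite sub0r.
  have h2 : is_derive (1 - x) 1 e (flat 2 (1 - x)).
    by have := @is_derive_flat R 0 (1 - x); rewrite mul0r subr0.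
  by have := @is_derive1_comp R e (fun y => 1 - y) x _ _ h2 h; rewrite mulrN1.
have n0 : e x + e (1 - x) != 0 by rewrite gt_eqF.
have dV := @is_deriveV R (fun y => e y + e (1 - y)) x _ 1 n0 (is_deriveD d1 d2).
have := is_deriveM d1 dV.
by congr is_derive; rewrite /step' /GRing.scale /=; field.
Qed.

Lemma diffn_step k : diffn k step.
Proof.
apply: diffnM; first exact: diffn_flat.
apply: diffnV => [x|]; first by rewrite gt_eqF.
apply: diffnD; first exact: diffn_flat.
rewrite (_ : (fun x => e (1 - x)) = (fun x => e (-1 * x + 1))).
  exact/diffn_affine/diffn_flat.
by apply/funext => x; rewrite mulN1r addrC.
Qed.

Lemma step'_ge0 x : 0 <= step' x.
Proof.
by rewrite /step' divr_ge0 ?exprn_ge0 ?(ltW (den_gt0 x))// addr_ge0// mulr_ge0// flat_ge0.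
Qed.

Lemma flat_le0 n x : x <= 0 -> flat n x = 0.
Proof. by move=> x0; rewrite /flat ltNge x0. Qed.

Lemma step'_out x : x <= 0 \/ 1 <= x -> step' x = 0.
Proof.
rewrite /step' /e => -[x0|x0].
  by rewrite !(flat_le0 _ x0) ?(mul0r, mulr0, addr0).
have h n : flat n (1 - x) = 0 by apply: flat_le0; rewrite subr_le0.
by rewrite !h ?(mul0r, mulr0, addr0).
Qed.

Lemma step_le0 x : x <= 0 -> step x = 0.
Proof. by move=> x0; rewrite /step /e flat_le0// mul0r. Qed.

Lemma step_ge1 x : 1 <= x -> step x = 1.
Proof.
move=> x1; rewrite /step /e (@flat_le0 _ (1 - x)) ?subr_le0// addr0 divff//.
by rewrite gt_eqF// flat_gt0// (lt_le_trans _ x1).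
Qed.

Lemma step_itv x : 0 <= step x <= 1.
Proof.
rewrite /step divr_ge0 ?flat_ge0 ?(ltW (den_gt0 x))//=.
by rewrite ler_pdivrMr// mul1r lerDl flat_ge0.
Qed.

Definition ramp a b x := step ((b - a)^-1 * x + - (a / (b - a))).

Definition ramp' a b x := step' ((b - a)^-1 * x + - (a / (b - a))) * (b - a)^-1.

Lemma is_derive_ramp a b x : is_derive x 1 (ramp a b) (ramp' a b x).
Proof.
apply: is_derive1_comp; first exact: is_derive_step.
have := is_deriveD (is_deriveM (is_derive_cst (b - a)^-1 x (1:R)) (is_derive_id x (1:R)))
  (is_derive_cst (- (a / (b - a))) x (1:R)).
by congr is_derive; rewrite /GRing.scale /= !(mulr1, mulr0, addr0).
Qed.

Lemma diffn_ramp k a b : diffn k (ramp a b).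
Proof. exact/diffn_affine/diffn_step. Qed.

Lemma derive1_ramp a b : derive1 (ramp a b) = ramp' a b.
Proof.
apply/funext => x; rewrite derive1E.
exact: (@derive_val _ _ _ _ _ _ _ (is_derive_ramp a b x)).
Qed.

Lemma continuous_ramp a b : continuous (ramp a b).
Proof.
move=> x; apply: differentiable_continuous; apply/derivable1_diffP.
exact: (@ex_derive _ _ _ _ _ _ _ (is_derive_ramp a b x)).
Qed.

Lemma continuous_ramp' a b : continuous (ramp' a b).
Proof.
rewrite -derive1_ramp => x; apply: differentiable_continuous.
by apply/derivable1_diffP; have [_ []] := diffn_ramp 2 a b.
Qed.

Lemma ramp_itv a b x : 0 <= ramp a b x <= 1.
Proof. exact: step_itv. Qed.

Section lt.
Variables (a b : R).
Hypothesis ab : a < b.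

Let rampE x : (b - a)^-1 * x + - (a / (b - a)) = (x - a) / (b - a).
Proof. by rewrite mulrBl mulrC. Qed.

Let ba0 : 0 < b - a. Proof. by rewrite subr_gt0. Qed.

Lemma ramp_le x : x <= a -> ramp a b x = 0.
Proof.
by move=> xa; rewrite /ramp rampE step_le0// pmulr_lle0 ?invr_gt0// subr_le0.
Qed.

Lemma ramp_ge x : b <= x -> ramp a b x = 1.
Proof.
by move=> xb; rewrite /ramp rampE step_ge1// ler_pdivlMr// mul1r lerB.
Qed.

Lemma ramp'_ge0 x : 0 <= ramp' a b x.
Proof. by rewrite /ramp' mulr_ge0 ?step'_ge0// invr_ge0 ltW. Qed.

Lemma ramp'_out x : ~ (a <= x <= b) -> ramp' a b x = 0.
Proof.
rewrite /ramp' rampE => h; rewrite step'_out ?mul0r//.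
have [xa|ax] := lerP x a; first by left; rewrite pmulr_lle0 ?invr_gt0// subr_le0.
right; rewrite ler_pdivlMr// mul1r lerB// leNgt; apply/negP => xb.
by apply: h; rewrite (ltW ax) (ltW xb).
Qed.

End lt.

End step.

(** * Integration over the time interval *)

#[local] Instance time_measure_ae_filter (R : realType) (T : R) :
  Filter (almost_everywhere (time_measure T)).
Proof. exact: ae_filter_ringOfSetsType. Qed.

Section time_measure.
Context (R : realType) (T : R).
Implicit Types (f g h k : R -> R).
Local Notation tm := (time_measure T).

Lemma time_measureE (A : set R) :
  tm A = (@lebesgue_measure R) (A `&` `]0, T[).
Proof. by []. Qed.

Lemma time_measure_setT_lty : (tm setT < +oo)%E.
Proof.
by rewrite time_measureE setTI lebesgue_measure_itv; case: ifP => _; rewrite ?ltry.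
Qed.

Lemma time_measure_le (A : set R) : measurable A ->
  (tm A <= (@lebesgue_measure R) A)%E.
Proof.
move=> mA; rewrite time_measureE le_measure ?inE//.
exact: measurableI.
Qed.

Lemma time_measure_itvC : tm (~` `]0, T[) = 0%E.
Proof. by rewrite time_measureE setICl measure0. Qed.

Lemma time_measure_set1 x : tm [set x] = 0%E.
Proof.
by apply/eqP; rewrite eq_le measure_ge0 andbT -(@lebesgue_measure_set1 R x) time_measure_le.
Qed.

Lemma time_measure_itv (b0 b1 : bool) (s t : R) : 0 <= s -> s <= t -> t <= T ->
  tm [set` Interval (BSide b0 s) (BSide b1 t)] = (t - s)%:E.
Proof.
move=> s0 st tT; apply/eqP; rewrite eq_le; apply/andP; split.
  rewrite (le_trans (time_measure_le _))// lebesgue_measure_itv /=.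
  by case: ifP => // _; rewrite lee_fin subr_ge0.
have [->|sNt] := eqVneq s t; first by rewrite subrr measure_ge0.
have stt : s < t by rewrite lt_neqAle sNt.
have -> : (t - s)%:E = (@lebesgue_measure R) `]s, t[.
  by rewrite lebesgue_measure_itv /= lte_fin stt.
rewrite time_measureE le_measure ?inE//; first exact: measurableI.
move=> x /=; rewrite !in_itv /= => /andP[sx xt]; split.
  by apply/andP; case: b0; case: b1; rewrite ?bnd_simp /= ?ltW.
by rewrite (le_lt_trans s0 sx) (lt_le_trans xt tT).
Qed.

Lemma integral_time_measure (D : set R) (f : R -> \bar R) : D `<=` `]0, T[ ->
  (\int[tm]_(x in D) f x = \int[lebesgue_measure]_(x in D) f x)%E.
Proof.
move=> DT; apply: eq_measure_integral => A mA AD.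
by rewrite time_measureE setIidl//; exact: subset_trans DT.
Qed.

(** The time measure does not charge the complement of the open interval. *)
Lemma integral_time_measureT (f : R -> \bar R) : tm.-integrable setT f ->
  (\int[tm]_x f x = \int[lebesgue_measure]_(x in `]0%R, T[) f x)%E.
Proof.
move=> fi; have mC : measurable (~` (`]0, T[%classic : set (measurableTypeR R))).
  exact: measurableC.
rewrite (negligible_integral mC measurableT fi time_measure_itvC).
by rewrite setDE setCK setTI integral_time_measure.
Qed.

Lemma bounded_time_integrable f (M : R) : measurable_fun setT f ->
  (forall x, `|f x| <= M) -> tm.-integrable setT (EFin \o f).
Proof.
move=> mf fM; apply: measurable_bounded_integrable => //.
  exact: time_measure_setT_lty.
exists M; split; first by rewrite num_real.
by move=> y My x _; exact: le_trans (fM x) (ltW My).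
Qed.

Lemma time_integrableM f g (M : R) : measurable_fun setT f ->
  (forall x, `|f x| <= M) -> tm.-integrable setT (EFin \o g) ->
  tm.-integrable setT (fun x => (f x * g x)%:E).
Proof.
move=> mf fM gi.
have := @integrableMr _ _ _ tm setT measurableT f (EFin \o g) mf.
apply=> //; exists M; split; first by rewrite num_real.
by move=> y My x _; exact: le_trans (fM x) (ltW My).
Qed.

Lemma Rintegral_ramp' a b : 0 <= a -> a < b -> b <= T -> 0 < T ->
  tm.-integrable setT (EFin \o ramp' a b) /\ \int[tm]_x (ramp' a b x) = 1.
Proof.
move=> a0 ab bT T0.
have mr : measurable_fun setT (ramp' a b).
  exact: (continuous_measurable_fun (@continuous_ramp' R a b)).
have ir : tm.-integrable setT (EFin \o ramp' a b).
  have [|c _ cM] := @EVT_max R (ramp' a b) a b (ltW ab).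
    exact/continuous_subspaceT/continuous_ramp'.
  apply: (@bounded_time_integrable _ (ramp' a b c)) => // x.
  rewrite ger0_norm ?ramp'_ge0//.
  have [/cM//|xab] := boolP (x \in `[a, b]).
  rewrite ramp'_out ?ramp'_ge0//; first by move: xab; rewrite in_itv/= => /negP.
split=> //.
rewrite /Rintegral integral_time_measureT//.
rewrite integral_itv_obnd_cbnd; last first.
  by apply/measurable_EFinP; exact: measurable_funTS.
rewrite integral_itv_bndo_bndc; last first.
  by apply/measurable_EFinP; exact: measurable_funTS.
rewrite (@continuous_FTC2 _ _ (ramp a b))//.
- by rewrite (ramp_ge ab bT) (ramp_le ab a0) /= subr0.
- exact/continuous_subspaceT/continuous_ramp'.
- split.
  + move=> x _; exact: (@ex_derive _ _ _ _ _ _ _ (is_derive_ramp a b x)).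
  + exact/cvg_at_right_filter/continuous_ramp.
  + exact/cvg_at_left_filter/continuous_ramp.
- by move=> x _; rewrite derive1_ramp.
Qed.

End time_measure.

(** * Primitives from distributional derivatives *)

Section weak_primitive.
Context (R : realType) (T : R).
Hypothesis T0 : 0 < T.
Implicit Types (f g h k : R -> R).
Local Notation tm := (time_measure T).

(** The derivative of a ramp is a probability density supported in [[a, b]]:
averaging [g] against it gives nearly [c] when [g] is nearly [c] there. *)
Lemma ramp'_mean g (c eta M a b : R) : 0 <= a -> a < b -> b <= T ->
  measurable_fun setT g -> (forall x, `|g x| <= M) ->
  (forall x, a <= x <= b -> `|g x - c| <= eta) ->
  tm.-integrable setT (fun x => (ramp' a b x * g x)%:E) /\
  `|\int[tm]_x (ramp' a b x * g x) - c| <= eta.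
Proof.
move=> a0 ab bT mg gM gc.
have [ir r1] := Rintegral_ramp' a0 ab bT T0.
have irg : tm.-integrable setT (fun x => (ramp' a b x * g x)%:E).
  have := time_integrableM mg gM ir.
  by congr (_.-integrable _ _); apply/funext => x; rewrite mulrC.
split=> //.
have irc : tm.-integrable setT (fun x => (ramp' a b x * c)%:E).
  by have := @integrableZr _ _ _ _ _ measurableT c _ ir.
have ire : tm.-integrable setT (fun x => (ramp' a b x * eta)%:E).
  by have := @integrableZr _ _ _ _ _ measurableT eta _ ir.
have -> : c = \int[tm]_x (ramp' a b x * c) by rewrite RintegralZr// r1 mul1r.
rewrite -RintegralB//.
have ib : tm.-integrable setT (EFin \o (fun x => ramp' a b x * g x - ramp' a b x * c)).
  by have := integrableB measurableT irg irc.
rewrite (le_trans (le_normr_Rintegral _ ib))//.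
have -> : eta = \int[tm]_x (ramp' a b x * eta) by rewrite RintegralZr// r1 mul1r.
apply: le_Rintegral => //.
  exact: integrable_norm ib.
move=> x _; rewrite -mulrBr normrM ger0_norm ?ramp'_ge0//.
have [xab|xab] := boolP (a <= x <= b).
  by rewrite ler_wpM2l ?ramp'_ge0// gc.
by rewrite ramp'_out ?mul0r//; exact/negP.
Qed.

(** A difference of two ramps, so that its derivative is the difference of two
approximate unit masses, near [s] and near [t]. *)
Definition plateau s t e x : R := ramp (s + e) (s + 2 * e) x - ramp (t - 2 * e) (t - e) x.

Lemma time_test_plateau s t e : 0 <= s -> t <= T -> 0 < e -> 4 * e <= t - s ->
  time_test_function T (plateau s t e).
Proof.
move=> s0 tT e0 est; split.
  apply: diffn_derivable1n => k; apply: diffnD; first exact: diffn_ramp.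
  have -> : (fun x => - ramp (t - 2 * e) (t - e) x) =
      (fun x => -1 * ramp (t - 2 * e) (t - e) x).
    by apply/funext => x; rewrite mulN1r.
  by apply: diffnM; [exact: diffn_cst|exact: diffn_ramp].
exists (s + e), (t - e); split; [lra|lra|].
move=> x /negP; rewrite negb_and -!ltNge => /orP[xs|xt]; rewrite /plateau.
  by rewrite !ramp_le ?subrr//; lra.
by rewrite !ramp_ge ?subrr//; lra.
Qed.

Lemma derive1_plateau s t e : derive1 (plateau s t e) =
  (fun x => ramp' (s + e) (s + 2 * e) x - ramp' (t - 2 * e) (t - e) x).
Proof.
apply/funext => x; rewrite derive1E.
exact: (@derive_val _ _ _ _ _ _ _ (is_deriveB (is_derive_ramp _ _ x) (is_derive_ramp _ _ x))).
Qed.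

Lemma plateau_cvg s t (e : nat -> R) x :
  (forall n, 0 < e n) -> (forall n, 4 * e n <= t - s) ->
  e @ \oo --> 0 -> plateau s t (e n) x @[n --> \oo] --> (\1_(`]s, t[) x : R).
Proof.
move=> e0 est ecvg; apply: cvg_near_cst.
have [sxt|sxt] := boolP (x \in `]s, t[).
  have /andP[sx xt] : s < x < t by move: sxt; rewrite in_itv.
  have m0 : 0 < Num.min (x - s) (t - x) / 2 by rewrite divr_gt0// lt_min !subr_gt0 sx.
  near=> n.
  have : e n < Num.min (x - s) (t - x) / 2 by near: n; move/cvgr_lt: ecvg; apply.
  rewrite ltr_pdivlMr// lt_min => /andP[h1 h2]; have := e0 n => h3.
  rewrite indicE mem_set// /plateau ramp_ge ?ramp_le ?subr0//; lra.
near=> n; rewrite indicE memNset; last by move=> /=; apply/negP.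
have := e0 n; have := est n; move: sxt; rewrite in_itv/= negb_and -!leNgt /plateau.
move: (e n) => en /orP[xs|xt] h1 h2.
  by rewrite !ramp_le ?subrr//; lra.
by rewrite !ramp_ge ?subrr//; lra.
Unshelve. all: by end_near. Qed.

(** Test with plateaus tending to the indicator of the interval: by continuity
of [g] the left-hand sides tend to [g s - g t], and the right-hand sides
converge by dominated convergence. The margin [e] keeps the supports inside the
open interval even if [s] is 0 or [t] is [T]. *)
Lemma weak_primitive g k (M : R) :
  measurable_fun setT g -> (forall x, `|g x| <= M) ->
  (forall x : R, 0 <= x <= T -> forall eta : R, 0 < eta -> exists2 delta : R, 0 < delta &
     forall y : R, 0 <= y <= T -> `|y - x| < delta -> `|g y - g x| <= eta) ->
  tm.-integrable setT (EFin \o k) ->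
  (forall psi, time_test_function T psi ->
    \int[tm]_x (derive1 psi x * g x) = - \int[tm]_x (psi x * k x)) ->
  forall s t : R, 0 <= s -> s <= t -> t <= T ->
  g t - g s = \int[tm]_(x in `]s, t]) k x.
Proof.
move=> mg gM gc ik gk s t s0; rewrite le_eqVlt => /predU1P[->|st] tT.
  by rewrite set_itvoc0 Rintegral_set0 subrr.
(* the factor 4 keeps the two ramps disjoint *)
pose e n : R := (t - s) / 4 / n.+1%:R.
have ts0 : 0 < t - s by rewrite subr_gt0.
have e0 n : 0 < e n by rewrite /e !divr_gt0// ltr0n.
have e4 n : 4 * e n <= t - s.
  rewrite /e mulrA mulrCA divff ?mulr1 ?pnatr_eq0//.
  by rewrite ler_pdivrMr ?ltr0n// ler_peMr ?(ltW ts0)// ler1n.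
have ecvg : e @ \oo --> 0.
  rewrite -(mulr0 ((t - s) / 4)); apply: cvgMr; exact: cvg_harmonic.
have test n := @time_test_plateau s t (e n) s0 tT (e0 n) (e4 n).
have mp n : measurable_fun setT (plateau s t (e n)).
  by apply: measurable_funB; exact: (continuous_measurable_fun (@continuous_ramp R _ _)).
have pM n x : `|plateau s t (e n) x| <= 1.
  rewrite /plateau ler_norml; have /andP[] := ramp_itv (s + e n) (s + 2 * e n) x.
  by have /andP[] := ramp_itv (t - 2 * e n) (t - e n) x; lra.
have H1 : \int[tm]_x (plateau s t (e n) x * k x) @[n --> \oo] --> g t - g s.
  apply/cvgrPdist_le => eta eta0.
  have eta20 : 0 < eta / 2 by rewrite divr_gt0.
  have [|d1 d10 h1] := gc s _ _ eta20; first by rewrite s0; lra.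
  have [|d2 d20 h2] := gc t _ _ eta20; first by lra.
  near=> n.
  have en1 : 2 * e n < d1.
    by rewrite -ltr_pdivlMl// mulrC; near: n; move/cvgr_lt: ecvg; apply; rewrite divr_gt0.
  have en2 : 2 * e n < d2.
    by rewrite -ltr_pdivlMl// mulrC; near: n; move/cvgr_lt: ecvg; apply; rewrite divr_gt0.
  rewrite -[X in _ - X]opprK -gk// derive1_plateau.
  have := e0 n; have := e4 n; move: (e n) en1 en2 => en en1 en2 en4 en0.
  have [|||x xs|i1 m1] := @ramp'_mean g (g s) (eta / 2) M (s + en) (s + 2 * en) _ _ _ mg gM; [lra|lra|lra| |].
    by apply: h1; rewrite ?ltr_norml; lra.
  have [|||x xs|i2 m2] := @ramp'_mean g (g t) (eta / 2) M (t - 2 * en) (t - en) _ _ _ mg gM; [lra|lra|lra| |].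
    by apply: h2; rewrite ?ltr_norml; lra.
  under eq_Rintegral do rewrite mulrBl.
  rewrite RintegralB//; move: m1 m2; rewrite !ler_norml; lra.
have H2 : \int[tm]_x (plateau s t (e n) x * k x) @[n --> \oo] --> \int[tm]_(x in `]s, t]) k x.
  have iktst : tm.-integrable `]s, t] (EFin \o k) by exact: integrableS ik.
  have ink : tm.-integrable setT (fun x => (\1_(`]s, t[%classic : set R) x * k x)%:E).
    apply: (@time_integrableM R T _ k 1) => // x.
    by rewrite indicE; case: (_ \in _); rewrite ?normr1 ?normr0.
  have -> : \int[tm]_(x in `]s, t]) k x = \int[tm]_x (\1_(`]s, t[%classic : set R) x * k x).
    rewrite /Rintegral; congr fine.
    have mt : measurable ([set t] : set (measurableTypeR R)) by exact: measurable_set1.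
    have mst : measurable (`]s, t]%classic : set (measurableTypeR R)) by exact: measurable_itv.
    rewrite (negligible_integral mt mst iktst (time_measure_set1 T t)).
    rewrite (_ : _ `\` _ = `]s, t[%classic); last exact: setDitv1r.
    rewrite integral_mkcond; apply: eq_integral => x _.
    by rewrite /patch indicE; case: ifPn => _ /=; rewrite ?mul1r ?mul0r.
  apply: fine_cvg; rewrite /Rintegral fineK; last by apply: integrable_fin_num.
  apply: (@dominated_cvg _ _ _ tm setT measurableT _ _ (fun x => `|k x|%:E)) => //.
  - move=> n; apply/measurable_EFinP/measurable_funM; first exact: mp.
    by apply/measurable_EFinP; case/integrableP: ik.
  - move=> x _; apply: cvg_EFin; first exact: nearW.
    by apply: cvgMl; exact: plateau_cvg.
  - exact: integrable_norm ik.
  - by move=> n x _; rewrite /= lee_fin normrM ler_piMl.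
by apply: cvg_unique H1 H2.
Unshelve. all: by end_near. Qed.

End weak_primitive.

(** * Integrals of functions measurable up to null sets, and the space H *)

Section raw_integral.
Context d (X : measurableType d) (R : realType).
Variable mu : {measure set X -> \bar R}.
Local Open Scope ereal_scope.
Implicit Types f g : X -> \bar R.

Import HBNNSimple.

(** The integral of a nonnegative function is a supremum over simple functions
below it, measurable or not, and multiplying a simple function by the indicator
of the complement of a null set leaves its integral unchanged. *)
Lemma ge0_ae_le_integral_raw f g : (forall x, 0 <= f x) -> (forall x, 0 <= g x) ->
  (\forall x \ae mu, f x <= g x) -> \int[mu]_x f x <= \int[mu]_x g x.
Proof.
move=> f0 g0 [N [mN N0 fgN]]; rewrite !ge0_integralTE//.
apply: ge_ereal_sup => _ /= [h hf <-].
have mNC : measurable (~` N) by exact: measurableC.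
(* [h] killed on the exceptional null set is below [g] everywhere *)
pose h' : {nnsfun X >-> R} := mul_nnsfun h (indic_nnsfun R mNC).
have sintE (k : {nnsfun X >-> R}) : sintegral mu k = \int[mu]_x (k x)%:E.
  by rewrite integral_nnsfun// patch_setT.
apply: (@le_trans _ _ (sintegral mu h')).
  rewrite le_eqVlt; apply/orP; left; apply/eqP.
  rewrite !sintE; apply: ge0_ae_eq_integral => //.
  - by apply/measurable_EFinP.
  - by apply/measurable_EFinP.
  - by move=> x _; rewrite lee_fin.
  - by move=> x _; rewrite lee_fin.
  - exists N; split => // x; apply: contra_notP => Nx _ /=.
    by rewrite mindicE mem_set// mulr1.
apply: ereal_sup_ubound; exists h' => //= x.
rewrite mindicE; case: (boolP (x \in _)) => /= xN; last by rewrite mulr0.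
rewrite mulr1 (le_trans (hf x))//.
by move: xN; rewrite inE => /=; apply: contra_notP; exact: fgN.
Qed.

Lemma ae_eq_integral_raw f g :
  (\forall x \ae mu, f x = g x) -> \int[mu]_x f x = \int[mu]_x g x.
Proof.
move=> fg; rewrite integralE [RHS]integralE; congr (_ - _); apply/eqP;
  rewrite eq_le; apply/andP; split; apply: ge0_ae_le_integral_raw => //;
  by apply: filterS fg => x fgx; rewrite ?funeposE ?funenegE fgx.
Qed.

End raw_integral.

Lemma ae_eq_Rintegral_raw d (X : measurableType d) (R : realType)
    (mu : {measure set X -> \bar R}) (f g : X -> R) :
  (\forall x \ae mu, f x = g x) -> \int[mu]_x f x = \int[mu]_x g x.
Proof.
move=> fg; congr fine; apply: ae_eq_integral_raw.
by apply: filterS fg => x ->.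
Qed.

Lemma ae_le_integrable d (X : measurableType d) (R : realType)
    (mu : {measure set X -> \bar R}) (f g : X -> R) :
  measurable_fun setT f -> mu.-integrable setT (EFin \o g) ->
  (\forall x \ae mu, `|f x| <= g x) -> mu.-integrable setT (EFin \o f).
Proof.
move=> mf /integrableP[mg goo] fg; apply/integrableP; split.
  exact/measurable_EFinP.
apply: le_lt_trans goo; apply: ge0_ae_le_integral_raw => //.
apply: filterS fg => x fg; rewrite /= lee_fin (le_trans fg)//.
exact: ler_norm.
Qed.

Section L2.
Context (R : realType) (N : nat) (O : smooth_domain R N).
Local Notation mu := (dom_measure O).
Local Notation L2 := (inL2 O).
Local Notation dot := (dotL2 O).
Local Notation nrm := (normL2 O).
Implicit Types (u v g h : 'rV[R]_N -> R) (a : R).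

Lemma inL2_measurable u : L2 u -> measurable_fun setT u.
Proof. by rewrite /inL2 inE => /andP[/[!inE]]. Qed.

Lemma inL2P u : L2 u <-> measurable_fun setT u /\
  (\int[mu]_x (u x ^+ 2)%:E < +oo)%E.
Proof.
split=> [uL|[mu' ufin]].
  split; first exact: inL2_measurable.
  have /integrableP[_] := Lfun2_integrable_sqr uL.
  by under eq_integral do rewrite /= ger0_norm ?sqr_ge0//.
rewrite /inL2 inE; apply/andP; split; rewrite inE//= /finite_norm.
rewrite unlock poweR_lty//.
under eq_integral do rewrite /= powR_mulrn// -normrX ger0_norm ?sqr_ge0//.
exact: ufin.
Qed.

Lemma inL2D u v : L2 u -> L2 v -> L2 (fun x => u x + v x).
Proof. exact: (Lfun_addr_closed mu (lee1n 2)).2. Qed.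

Lemma inL2Z a u : L2 u -> L2 (fun x => a * u x).
Proof.
move=> uL; have -> : (fun x => a * u x) = a \o* u.
  by apply/funext => x /=; rewrite mulrC.
by apply: Lfun_scale => //; rewrite ler1n.
Qed.

Lemma inL2N u : L2 u -> L2 (fun x => - u x).
Proof. exact: Lfun_oppr_closed. Qed.

Lemma inL2B u v : L2 u -> L2 v -> L2 (fun x => u x - v x).
Proof. by move=> uL vL; apply: inL2D => //; exact: inL2N. Qed.

Lemma ae_inL2 u v : L2 u -> measurable_fun setT v ->
  (\forall x \ae mu, u x = v x) -> L2 v.
Proof.
move=> /inL2P[_ uoo] mv uv; apply/inL2P; split => //.
apply: le_lt_trans uoo; rewrite le_eqVlt; apply/orP; left; apply/eqP.
by apply: ae_eq_integral_raw; apply: filterS uv => x ->.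
Qed.

Lemma inL2_mul u v : L2 u -> L2 v -> mu.-integrable setT (EFin \o (fun x => u x * v x)).
Proof. by move=> uL vL; apply/Lfun1_integrable; exact: Lfun2_mul_Lfun1. Qed.

Lemma dotC u v : dot u v = dot v u.
Proof. by apply: eq_Rintegral => x _; rewrite mulrC. Qed.

Lemma eq_dot u v u' v' : (\forall x \ae mu, u x = u' x) -> (\forall x \ae mu, v x = v' x) ->
  dot u v = dot u' v'.
Proof.
by move=> uu' vv'; apply: ae_eq_Rintegral_raw; apply: filterS2 uu' vv' => x -> ->.
Qed.

Lemma dotDl u v h : L2 u -> L2 v -> L2 h -> dot (fun x => u x + v x) h = dot u h + dot v h.
Proof.
move=> uL vL hL; rewrite -RintegralD//; [|exact: inL2_mul|exact: inL2_mul].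
by apply: eq_Rintegral => x _; rewrite mulrDl.
Qed.

Lemma dotZl a u h : L2 u -> L2 h -> dot (fun x => a * u x) h = a * dot u h.
Proof.
move=> uL hL; rewrite -RintegralZl//; last exact: inL2_mul.
by apply: eq_Rintegral => x _; rewrite mulrA.
Qed.

Lemma dotNl u h : L2 u -> L2 h -> dot (fun x => - u x) h = - dot u h.
Proof.
move=> uL hL; rewrite -mulN1r -dotZl//; apply: eq_Rintegral => x _.
by rewrite mulN1r.
Qed.

Lemma dotBl u v h : L2 u -> L2 v -> L2 h -> dot (fun x => u x - v x) h = dot u h - dot v h.
Proof.
move=> uL vL hL; rewrite (dotDl uL (inL2N vL) hL).
by rewrite dotNl.
Qed.

Lemma dotDr u v h : L2 u -> L2 v -> L2 h -> dot h (fun x => u x + v x) = dot h u + dot h v.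
Proof. by move=> *; rewrite dotC dotDl// !(dotC h). Qed.

Lemma dotBr u v h : L2 u -> L2 v -> L2 h -> dot h (fun x => u x - v x) = dot h u - dot h v.
Proof. by move=> *; rewrite dotC dotBl// !(dotC h). Qed.

Lemma dotZr a u h : L2 u -> L2 h -> dot h (fun x => a * u x) = a * dot h u.
Proof. by move=> *; rewrite dotC dotZl// dotC. Qed.

Lemma dot_ge0 u v : (\forall x \ae mu, 0 <= u x * v x) -> 0 <= dot u v.
Proof.
move=> uv; apply: fine_ge0.
have -> : (\int[mu]_x (u x * v x)%:E = \int[mu]_x `|u x * v x|%:E)%E.
  by apply: ae_eq_integral_raw; apply: filterS uv => x uvx; rewrite ger0_norm.
by apply: integral_ge0 => x _; rewrite lee_fin.
Qed.

Lemma dotuu_ge0 u : 0 <= dot u u.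
Proof. by apply: Rintegral_ge0 => x _; rewrite -expr2 sqr_ge0. Qed.

Lemma normL2E u : L2 u -> nrm u = Num.sqrt (dot u u).
Proof.
move=> uL; rewrite /normL2 unlock.
under eq_integral do rewrite /= powR_mulrn// -normrX ger0_norm ?sqr_ge0//.
have := dotuu_ge0 u; have := integrable_fin_num measurableT (inL2_mul uL uL).
rewrite /dotL2 /Rintegral /=; under eq_integral do rewrite -expr2.
case: (integral _ _ _) => // r _ /= r0.
by rewrite powR12_sqrt.
Qed.

Lemma normL2_ge0 u : 0 <= nrm u.
Proof. by apply: fine_ge0; exact: Lnorm_ge0. Qed.

Lemma normL2_sqr u : L2 u -> nrm u ^+ 2 = dot u u.
Proof. by move=> uL; rewrite normL2E// sqr_sqrtr// dotuu_ge0. Qed.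

Lemma eq_normL2 u v : (\forall x \ae mu, u x = v x) -> nrm u = nrm v.
Proof.
move=> uv; congr fine; rewrite unlock; congr (_ `^ _)%E.
by apply: ae_eq_integral_raw; apply: filterS uv => x /= ->.
Qed.

Lemma dotL2_le u v : L2 u -> L2 v -> `|dot u v| <= nrm u * nrm v.
Proof.
move=> uL vL.
rewrite (le_trans (le_normr_Rintegral _ (inL2_mul uL vL)))//.
have fin w : L2 w -> (nrm w)%:E = Lnorm mu 2%:E (EFin \o w).
  rewrite /normL2 => wL; rewrite fineK// ge0_fin_numE ?Lnorm_ge0//.
  by move: wL; rewrite /inL2 inE => /andP[_]; rewrite inE.
rewrite -lee_fin EFinM (fin u uL) (fin v vL) /Rintegral fineK; last first.
  by apply: integrable_fin_num => //; exact: integrable_norm (inL2_mul uL vL).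
have := @hoelder _ _ _ mu u v 2 2 (inL2_measurable uL) (inL2_measurable vL).
rewrite Lnorm1; apply => //.
by rewrite [RHS]splitr !div1r.
Qed.

Lemma normL2D u v : L2 u -> L2 v -> nrm (fun x => u x + v x) <= nrm u + nrm v.
Proof.
move=> uL vL; have uvL := inL2D uL vL.
rewrite -ler_sqr ?nnegrE ?addr_ge0 ?normL2_ge0//.
rewrite normL2_sqr// dotDl// !dotDr// sqrrD !normL2_sqr// (dotC v u).
have := dotL2_le uL vL; rewrite ler_norml => /andP[_]; lra.
Qed.

Lemma normL2Z a u : L2 u -> nrm (fun x => a * u x) = `|a| * nrm u.
Proof.
move=> uL; have auL := inL2Z a uL.
rewrite (normL2E auL) (normL2E uL) (dotZl a uL auL) (dotZr a uL uL) mulrA -expr2.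
by rewrite sqrtrM ?sqr_ge0// sqrtr_sqr.
Qed.

Lemma normL2N u : L2 u -> nrm (fun x => - u x) = nrm u.
Proof.
move=> uL; rewrite -[RHS]mul1r -normrN1 -normL2Z//.
by apply: eq_normL2; apply: nearW => x; rewrite mulN1r.
Qed.

Lemma normL2B u v : L2 u -> L2 v -> nrm (fun x => u x - v x) <= nrm u + nrm v.
Proof. by move=> uL vL; rewrite -(normL2N vL); exact: normL2D (inL2N vL). Qed.

Lemma normL2_eq0 u : L2 u -> nrm u = 0 -> \forall x \ae mu, u x = 0.
Proof.
move=> uL; rewrite normL2E// => /eqP; rewrite sqrtr_eq0 => u0.
have ui := inL2_mul uL uL.
have d0 : (\int[mu]_x (u x * u x)%:E = 0)%E.
  rewrite -[LHS]fineK; last exact: integrable_fin_num ui.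
  by congr EFin; apply/eqP; rewrite eq_le u0; exact: dotuu_ge0.
have : (\int[mu]_x `|(u x * u x)%:E| = 0)%E.
  rewrite -[RHS]d0; apply: eq_integral => x _ /=.
  by rewrite ger0_norm// -expr2 sqr_ge0.
move/(ae_eq_integral_abs _ measurableT) => /(_ _)/=; case; first by case/integrableP: ui.
move=> A [mA A0 hA]; exists A; split => // x /= ux; apply: hA => /= /(_ I) [].
by move/eqP; rewrite mulf_eq0 orbb => /eqP.
Qed.

End L2.

(** * Strongly measurable functions of time *)

Section vector_valued.
Context (R : realType) (N : nat) (O : smooth_domain R N) (T : R).
Local Notation mu := (dom_measure O).
Local Notation L2 := (inL2 O).
Local Notation dot := (dotL2 O).
Local Notation nrm := (normL2 O).
Local Notation H := (spH O).
Local Notation tm := (time_measure T).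
Implicit Types (u v s : R -> 'rV[R]_N -> R) (h g : 'rV[R]_N -> R) (a : R).

Lemma inL2_0 : L2 (fun=> 0).
Proof. exact: (Lfun_addr_closed mu (lee1n 2)).1. Qed.

Lemma inL2_sum (I : Type) (r : seq I) (F : I -> 'rV[R]_N -> R) :
  (forall i, L2 (F i)) -> L2 (fun x => \sum_(i <- r) F i x).
Proof.
move=> FL; elim: r => [|i r IH].
  by under eq_fun do rewrite big_nil; exact: inL2_0.
by under eq_fun do rewrite big_cons; exact: inL2D.
Qed.

Lemma dot0l h : dot (fun=> 0) h = 0.
Proof. by rewrite /dotL2; under eq_Rintegral do rewrite mul0r; rewrite Rintegral_cst// mul0r. Qed.

Lemma dot_suml (I : Type) (r : seq I) (F : I -> 'rV[R]_N -> R) h : L2 h ->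
  (forall i, L2 (F i)) -> dot (fun x => \sum_(i <- r) F i x) h = \sum_(i <- r) dot (F i) h.
Proof.
move=> hL FL; elim: r => [|i r IH].
  by rewrite big_nil; under eq_fun do rewrite big_nil; exact: dot0l.
rewrite big_cons -IH -dotDl//; last exact: inL2_sum.
by congr dotL2; apply/funext => x; rewrite big_cons.
Qed.

Lemma simple_inL2 s t : simple_in H s -> L2 (s t).
Proof.
move=> [m [A [g [Ag sE]]]].
have -> : s t = (fun x => \sum_(k < m) \1_(A k) t * g k x) by apply/funext => x.
by apply: inL2_sum => k; apply: inL2Z; have [_] := Ag k.
Qed.

(** The second argument is left general so that applying the lemma twice covers
two simple functions. *)
Lemma simple_dot_measurable s (h : R -> 'rV[R]_N -> R) : simple_in H s ->
  (forall t, L2 (h t)) -> (forall g, L2 g -> measurable_fun setT (fun t => dot g (h t))) ->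
  measurable_fun setT (fun t => dot (s t) (h t)).
Proof.
move=> [m [A [g [Ag sE]]]] hL mh.
have -> : (fun t => dot (s t) (h t)) =
    (fun t => \sum_(k < m) \1_(A k) t * dot (g k) (h t)).
  apply/funext => t; transitivity (dot (fun x => \sum_(k < m) \1_(A k) t * g k x) (h t)).
    by congr dotL2; apply/funext => x.
  rewrite dot_suml// => [|k]; last by apply: inL2Z; have [_] := Ag k.
  by apply: eq_bigr => k _; rewrite dotZl//; have [_] := Ag k.
apply: measurable_sum => k; apply: measurable_funM.
  by apply: measurable_indic; have [] := Ag k.
by apply: mh; have [_] := Ag k.
Qed.

Lemma simple_inD s1 s2 : simple_in H s1 -> simple_in H s2 ->
  simple_in H (fun t x => s1 t x + s2 t x).
Proof.
move=> [m1 [A1 [g1 [Ag1 sE1]]]] [m2 [A2 [g2 [Ag2 sE2]]]].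
exists (m1 + m2)%N, (fun k => match fintype.split k with inl i => A1 i | inr i => A2 i end),
  (fun k => match fintype.split k with inl i => g1 i | inr i => g2 i end); split.
  by move=> k; case: (fintype.split k).
move=> t x; rewrite sE1 sE2 big_split_ord/=; congr (_ + _); apply: eq_bigr => i _.
  by rewrite -[lshift _ _]/(unsplit (inl i)) unsplitK.
by rewrite -[rshift _ _]/(unsplit (inr i)) unsplitK.
Qed.

Lemma simple_inZ a s : simple_in H s -> simple_in H (fun t x => a * s t x).
Proof.
move=> [m [A [g [Ag sE]]]]; exists m, A, (fun k x => a * g k x); split.
  by move=> k; have [mA gL] := Ag k; split => //; exact: inL2Z.
by move=> t x; rewrite sE big_distrr; apply: eq_bigr => k _; rewrite mulrCA.
Qed.

Lemma simple_in_cst h : L2 h -> simple_in H (fun=> h).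
Proof.
move=> hL; exists 1%N, (fun=> setT), (fun=> h); split => // t x.
by rewrite big_ord1 indicT mul1r.
Qed.

Lemma simple_in_restrict s (B : set (measurableTypeR R)) : measurable B ->
  simple_in H s -> simple_in H (fun t x => \1_B t * s t x).
Proof.
move=> mB [m [A [g [Ag sE]]]]; exists m, (fun k => B `&` A k), g; split.
  by move=> k; have [mA gL] := Ag k; split => //; exact: measurableI.
move=> t x; rewrite sE big_distrr; apply: eq_bigr => k _.
by rewrite /= indicI /= mulrA.
Qed.

(** Strong measurability with convergence at every time. Inner products of such
functions are Borel functions of time, whereas for [strongly_measurable] ones
this only holds up to a null set, the Lebesgue measure being defined on Borel
sets. *)
Definition regular u := exists2 s : nat -> R -> 'rV[R]_N -> R,
  (forall n, simple_in H (s n)) &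
  forall t, L2 (u t) /\ nrm (fun x => u t x - s n t x) @[n --> \oo] --> (0 : R).

Lemma regular_inL2 u t : regular u -> L2 (u t).
Proof. by case=> s _ /(_ t)[]. Qed.

(** Multiply the function and its simple approximations by the indicator of a
Borel set of full measure on which they converge. *)
Lemma strongly_measurable_regular u : strongly_measurable T H u ->
  exists2 u', regular u' & \forall t \ae tm, u t = u' t.
Proof.
move=> [uL [s ss scvg]].
have [B [mB B0 uB]] : \forall t \ae tm, L2 (u t) /\
    nrm (fun x => u t x - s n t x) @[n --> \oo] --> (0 : R).
  by apply: (filterS2 _ _ uL scvg) => t; split.
have mBC : measurable (~` B) by exact: measurableC.
exists (fun t x => \1_(~` B) t * u t x).
  exists (fun n t x => \1_(~` B) t * s n t x) => [n|t].
    exact: simple_in_restrict.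
  rewrite indicE; have [tB|tB] := boolP (t \in ~` B) => /=; last first.
    split; first by under eq_fun do rewrite mul0r; exact: inL2_0.
    apply: cvg_near_cst; apply: nearW => n.
    rewrite normL2E; last by under eq_fun do rewrite !mul0r subrr; exact: inL2_0.
    by under eq_fun do rewrite !mul0r subrr; rewrite dot0l sqrtr0.
  have [uLt cvgt] : L2 (u t) /\ nrm (fun x => u t x - s n t x) @[n --> \oo] --> (0 : R).
    by move: tB; rewrite inE; apply: contra_notP => /uB.
  split; first by under eq_fun do rewrite mul1r.
  by under eq_fun do under eq_fun do rewrite !mul1r.
exists B; split => // t /=; apply: contra_notP => tB.
by apply/funext => x; rewrite indicE mem_set// mul1r.
Qed.

Lemma regular_strongly_measurable u u' : regular u' ->
  (\forall t \ae tm, u t = u' t) -> strongly_measurable T H u.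
Proof.
move=> [s ss scvg] uu'; split.
  by apply: filterS uu' => t ->; have [] := scvg t.
by exists s => //; apply: filterS uu' => t ->; have [] := scvg t.
Qed.

Lemma regularD u v : regular u -> regular v -> regular (fun t x => u t x + v t x).
Proof.
move=> [s ss uc] [r rr vc]; exists (fun n t x => s n t x + r n t x).
  by move=> n; exact: simple_inD.
move=> t; have [uL uct] := uc t; have [vL vct] := vc t; split; first exact: inL2D.
have cD : nrm (fun x => u t x - s n t x) + nrm (fun x => v t x - r n t x) @[n --> \oo] --> (0 : R).
  by rewrite -[X in _ --> X]addr0; exact: cvgD.
apply: (squeeze_cvgr _ (cvg_cst 0) cD); apply: nearW => n.
rewrite normL2_ge0/=.
have sL := simple_inL2 t (ss n); have rL := simple_inL2 t (rr n).
apply: le_trans (normL2D (inL2B uL sL) (inL2B vL rL)).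
rewrite le_eqVlt; apply/orP; left; apply/eqP.
by apply: eq_normL2; apply: nearW => x; rewrite opprD addrACA.
Qed.

Lemma regularZ a u : regular u -> regular (fun t x => a * u t x).
Proof.
move=> [s ss uc]; exists (fun n t x => a * s n t x); first by move=> n; exact: simple_inZ.
move=> t; have [uL uct] := uc t; split; first exact: inL2Z.
rewrite -[X in _ --> X](mulr0 `|a|).
rewrite [X in X @ _](_ : _ = fun n => `|a| * nrm (fun x => u t x - s n t x)); last first.
  apply/funext => n; rewrite -normL2Z; last exact: inL2B uL (simple_inL2 t (ss n)).
  by apply: eq_normL2; apply: nearW => x; rewrite mulrBr.
exact: cvgMr.
Qed.

Lemma regular_cst h : L2 h -> regular (fun=> h).
Proof.
move=> hL; exists (fun _ _ => h) => [n|t]; first exact: simple_in_cst.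
split => //; apply: cvg_near_cst; apply: nearW => n.
rewrite normL2E; last by under eq_fun do rewrite subrr; exact: inL2_0.
by under eq_fun do rewrite subrr; rewrite dot0l sqrtr0.
Qed.

Lemma regularB u v : regular u -> regular v -> regular (fun t x => u t x - v t x).
Proof.
move=> uR vR; have := regularD uR (regularZ (-1) vR); congr regular.
by apply/funext => t; apply/funext => x; rewrite mulN1r.
Qed.

Let dot_limit u v (s r : nat -> 'rV[R]_N -> R) t : L2 (u t) -> L2 (v t) ->
  (forall n, L2 (s n)) -> (forall n, L2 (r n)) ->
  nrm (fun x => u t x - s n x) @[n --> \oo] --> (0 : R) ->
  nrm (fun x => v t x - r n x) @[n --> \oo] --> (0 : R) ->
  dot (s n) (r n) @[n --> \oo] --> dot (u t) (v t).
Proof.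
move=> uL vL sL rL us vr.
apply/subr_cvg0/norm_cvg0P.
have bnd : nrm (fun x => u t x - s n x) * nrm (v t) +
    (nrm (u t) * nrm (fun x => v t x - r n x) +
     nrm (fun x => u t x - s n x) * nrm (fun x => v t x - r n x))
    @[n --> \oo] --> (0 : R).
  rewrite -[X in _ --> X](_ : 0 * nrm (v t) + (nrm (u t) * 0 + 0 * 0) = 0); last by ring.
  apply: cvgD; first exact: cvgMl.
  by apply: cvgD; [exact: cvgMr|exact: cvgM].
apply: (squeeze_cvgr _ (cvg_cst 0) bnd); apply: nearW => n; rewrite normr_ge0/= distrC.
have dL := inL2B uL (sL n); have eL := inL2B vL (rL n).
have -> : dot (u t) (v t) - dot (s n) (r n) = dot (fun x => u t x - s n x) (v t) +
    (dot (u t) (fun x => v t x - r n x) -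
     dot (fun x => u t x - s n x) (fun x => v t x - r n x)).
  by rewrite !dotBl// !dotBr//; ring.
apply: le_trans (ler_normD _ _) _; apply: lerD; first exact: dotL2_le dL vL.
apply: le_trans (ler_normB _ _) _.
by apply: lerD; [exact: dotL2_le uL eL|exact: dotL2_le dL eL].
Qed.

Lemma regular_dot_measurable u v : regular u -> regular v ->
  measurable_fun setT (fun t => dot (u t) (v t)).
Proof.
move=> [s ss uc] [r rr vc].
apply: (@measurable_fun_cvg _ _ _ _ (fun n t => dot (s n t) (r n t))).
  move=> n; apply: simple_dot_measurable => // [t|g gL]; first exact: simple_inL2.
  under eq_fun do rewrite dotC.
  by apply: simple_dot_measurable => // h hL; exact: measurable_cst.
move=> t _; have [uL ut] := uc t; have [vL vt] := vc t.
apply: (@dot_limit u v (fun n => s n t) (fun n => r n t) t) => // n; exact: simple_inL2.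
Qed.

Lemma regular_norm_measurable u : regular u ->
  measurable_fun setT (fun t => nrm (u t)).
Proof.
move=> uR; have -> : (fun t => nrm (u t)) = Num.sqrt \o (fun t => dot (u t) (u t)).
  by apply/funext => t; rewrite /= normL2E//; exact: regular_inL2.
apply: measurableT_comp; last exact: regular_dot_measurable.
exact: (continuous_measurable_fun (@sqrt_continuous R)).
Qed.

End vector_valued.

(** * Bochner spaces and continuous representatives *)

Section bochner.
Context (R : realType) (N : nat) (O : smooth_domain R N) (T : R).
Local Notation mu := (dom_measure O).
Local Notation L2 := (inL2 O).
Local Notation dot := (dotL2 O).
Local Notation nrm := (normL2 O).
Local Notation H := (spH O).
Local Notation tm := (time_measure T).
Implicit Types (u v s : R -> 'rV[R]_N -> R) (h g : 'rV[R]_N -> R) (a : R).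

Lemma time_ae_itv : \forall t \ae tm, 0 < t < T.
Proof.
exists (~` (`]0, T[%classic : set (measurableTypeR R))); split.
- exact: measurableC.
- exact: time_measure_itvC.
- by move=> t /=; rewrite in_itv.
Qed.

Lemma time_ae_le_integrable (f g : R -> R) : measurable_fun setT f ->
  tm.-integrable setT (EFin \o g) -> (\forall t \ae tm, `|f t| <= g t) ->
  tm.-integrable setT (EFin \o f).
Proof. move=> mf gi fg. exact: (@ae_le_integrable _ (measurableTypeR R) R tm f g mf gi fg). Qed.

Lemma inLp1_regular u : inLp T 1%:E H u -> exists u',
  [/\ regular O u', tm.-integrable setT (fun t => (nrm (u' t))%:E) &
      \forall t \ae tm, u t = u' t].
Proof.
move=> [/strongly_measurable_regular[u' ru uu'] uoo]; exists u'; split => //.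
apply/integrableP; split; first by apply/measurable_EFinP; exact: (regular_norm_measurable ru).
move: uoo; rewrite Lnorm1; apply: le_lt_trans.
rewrite le_eqVlt; apply/orP; left; apply/eqP; apply: ae_eq_integral_raw.
by apply: filterS uu' => t ->.
Qed.

Lemma inLp2_regular u : inLp T 2%:E H u -> exists u',
  [/\ regular O u', tm.-integrable setT (fun t => (nrm (u' t))%:E) &
      \forall t \ae tm, u t = u' t].
Proof.
move=> [/strongly_measurable_regular[u' ru uu'] uoo]; exists u'; split => //.
have mn := regular_norm_measurable ru.
have sqi : tm.-integrable setT (EFin \o (fun t => nrm (u' t) ^+ 2)).
  apply: Lfun2_integrable_sqr; rewrite inE; apply/andP; split; rewrite inE//=.
  rewrite /finite_norm; move: uoo; rewrite unlock => uoo; apply: le_lt_trans uoo.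
  rewrite le_eqVlt; apply/orP; left; apply/eqP; congr (_ `^ _)%E.
  by apply: ae_eq_integral_raw; apply: filterS uu' => t /= ->.
have c1 : tm.-integrable setT (EFin \o (fun t => 1 : R)).
  by apply: (@bounded_time_integrable _ _ _ 1) => // x; rewrite normr1.
apply: (@time_ae_le_integrable _ (fun t => nrm (u' t) ^+ 2 + 1)) => //.
  by have := integrableD measurableT sqi c1.
apply: nearW => t; rewrite ger0_norm ?normL2_ge0//.
(* on a finite interval, square integrability of the norm gives integrability *)
have := sqr_ge0 (nrm (u' t) - 1); have := normL2_ge0 O (u' t); nra.
Qed.

(** [dt u] is a chosen derivative, so it has the defining properties as soon as
some derivative exists. *)
Lemma dt_spec u : has_dt O T u ->
  inLp T 1%:E H (dt O T u) /\ is_time_derivative O T u (dt O T u).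
Proof. move=> [v vL uv]; apply: (@xgetPex _ _ [set v | inLp T 1%:E H v /\ is_time_derivative O T u v]).
by exists v. Qed.

Lemma regular_dot_integrable v h : regular O v ->
  tm.-integrable setT (fun t => (nrm (v t))%:E) -> L2 h ->
  tm.-integrable setT (EFin \o (fun t => dot (v t) h)).
Proof.
move=> rv iv hL.
apply: (@time_ae_le_integrable _ (fun t => nrm (v t) * nrm h)).
- exact: (regular_dot_measurable rv (regular_cst hL)).
- by have := integrableZr measurableT (nrm h) iv.
- by apply: nearW => t; apply: dotL2_le => //; exact: regular_inL2.
Qed.

Lemma time_test_bounded psi : time_test_function T psi ->
  [/\ measurable_fun setT psi, measurable_fun setT (derive1 psi) &
     exists2 M, forall x, `|psi x| <= M & forall x, `|derive1 psi x| <= M].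
Proof.
move=> [dpsi [a [b [a0 bT psi0]]]].
have d0 x : derivable psi x 1 by have := dpsi 0%N x; rewrite derive1n0.
have d1 x : derivable (derive1 psi) x 1 by have := dpsi 1%N x; rewrite derive1n1.
have c0 : continuous psi.
  by move=> x; apply: differentiable_continuous; exact/derivable1_diffP.
have c1 : continuous (derive1 psi).
  by move=> x; apply: differentiable_continuous; exact/derivable1_diffP.
have psi'0 x : ~ (a <= x <= b) -> derive1 psi x = 0.
  move=> /negP; rewrite negb_and -!ltNge => xab.
  rewrite derive1E (@near_eq_derive _ _ _ _ (fun=> 0)) ?derive_cst//.
  case/orP: xab => [xa|bx]; near=> y; apply: psi0; apply/negP;
    rewrite negb_and -!ltNge; apply/orP; [left|right]; near: y.
    exact: lt_nbhsl.
  exact: lt_nbhsr.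
have bnd (f : R -> R) : continuous f -> (forall x, ~ (a <= x <= b) -> f x = 0) ->
    exists M, forall x, `|f x| <= M.
  move=> cf f0; have [ab|ba] := leP a b; last first.
    exists 0 => x; rewrite f0 ?normr0// => /andP[ax xb].
    by move: ba; rewrite ltNge (le_trans ax xb).
  have [|c _ cM] := @EVT_max R (fun x => `|f x|) a b ab.
    by apply: continuous_subspaceT => x; apply: cvg_norm; exact: cf.
  exists `|f c| => x; have [xab|xab] := boolP (a <= x <= b).
    by apply: cM; rewrite in_itv.
  by rewrite f0 ?normr0//; exact/negP.
have [M0 hM0] := bnd _ c0 psi0; have [M1 hM1] := bnd _ c1 psi'0.
split; [exact: continuous_measurable_fun|exact: continuous_measurable_fun|].
exists (Num.max M0 M1) => x; first by rewrite le_max hM0.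
by rewrite le_max hM1 orbT.
Unshelve. all: by end_near. Qed.

(** This makes [dt] meaningful for [w_t + l phi], whose derivative is the one
entering the first equation. The integrals of a sum are split after passing to
regular versions, which are integrable. *)
Lemma has_dt_lin u1 u2 v1 v2 a :
  inLp T 2%:E H u1 -> inLp T 2%:E H u2 -> inLp T 2%:E H v1 -> inLp T 2%:E H v2 ->
  is_time_derivative O T u1 v1 -> is_time_derivative O T u2 v2 ->
  has_dt O T (fun t x => u1 t x + a * u2 t x).
Proof.
move=> /inLp2_regular[u1' [ru1 iu1 eu1]] /inLp2_regular[u2' [ru2 iu2 eu2]].
move=> /inLp2_regular[v1' [rv1 iv1 ev1]] /inLp2_regular[v2' [rv2 iv2 ev2]] d1 d2.
exists (fun t x => v1 t x + a * v2 t x); first split.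
- have rv := regularD rv1 (regularZ a rv2).
  apply: (regular_strongly_measurable rv).
  by apply: filterS2 ev1 ev2 => t -> ->.
- rewrite Lnorm1.
  have i12 : tm.-integrable setT (fun t => (nrm (v1' t) + `|a| * nrm (v2' t))%:E).
    by have := integrableD measurableT iv1 (integrableZl measurableT `|a| iv2).
  have /integrableP[_] := i12; apply: le_lt_trans.
  apply: ge0_ae_le_integral_raw => //; apply: (filterS2 _ _ ev1 ev2) => t e1 e2.
  rewrite /= lee_fin ger0_norm ?normL2_ge0// ger0_norm ?addr_ge0 ?mulr_ge0 ?normL2_ge0//.
  have l1 := regular_inL2 t rv1; have l2 := regular_inL2 t rv2.
  rewrite e1 e2 -normL2Z//; exact: normL2D l1 (inL2Z a l2).
move=> psi h tpsi hL; have [m0 m1 [M M0 M1]] := time_test_bounded tpsi.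
have split (p : R -> R) w1 w2 w1' w2' : measurable_fun setT p -> (forall x, `|p x| <= M) ->
    regular O w1' -> regular O w2' ->
    tm.-integrable setT (fun t => (nrm (w1' t))%:E) ->
    tm.-integrable setT (fun t => (nrm (w2' t))%:E) ->
    (\forall t \ae tm, w1 t = w1' t) -> (\forall t \ae tm, w2 t = w2' t) ->
    \int[tm]_t (p t * dot (fun x => w1 t x + a * w2 t x) h) =
    \int[tm]_t (p t * dot (w1 t) h) + a * \int[tm]_t (p t * dot (w2 t) h).
  move=> mp pM r1 r2 i1 i2 e1 e2.
  have j1 := time_integrableM mp pM (regular_dot_integrable r1 i1 hL).
  have j2 := time_integrableM mp pM (regular_dot_integrable r2 i2 hL).
  rewrite (@ae_eq_Rintegral_raw _ _ _ tm (fun t => p t * dot (w1 t) h)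
    (fun t => p t * dot (w1' t) h)); last by apply: filterS e1 => t ->.
  rewrite (@ae_eq_Rintegral_raw _ _ _ tm (fun t => p t * dot (w2 t) h)
    (fun t => p t * dot (w2' t) h)); last by apply: filterS e2 => t ->.
  rewrite -RintegralZl// -RintegralD//; last first.
    by have := integrableZl measurableT a j2.
  apply: ae_eq_Rintegral_raw; apply: (filterS2 _ _ e1 e2) => t -> ->.
  have l1 := regular_inL2 t r1; have l2 := regular_inL2 t r2.
  by rewrite (dotDl l1 (inL2Z a l2) hL) (dotZl a l2 hL); ring.
rewrite (split _ _ _ _ _ m1 M1 ru1 ru2 iu1 iu2 eu1 eu2).
rewrite (split _ _ _ _ _ m0 M0 rv1 rv2 iv1 iv2 ev1 ev2).
by rewrite (d1 _ _ tpsi hL) (d2 _ _ tpsi hL); ring.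
Qed.

(** Continuity on the closed interval in the norm of H, in a form free of
filters. *)
Definition cont_on u :=
  (forall t, 0 <= t <= T -> L2 (u t)) /\
  forall t, 0 <= t <= T -> forall e : R, 0 < e -> exists2 delta : R, 0 < delta &
    forall r, 0 <= r <= T -> `|r - t| < delta -> nrm (fun x => u r x - u t x) <= e.

Lemma initial_value_cont_on u h : initial_value O T u h -> exists uc,
  [/\ cont_on uc, \forall t \ae tm, \forall x \ae mu, u t x = uc t x &
      \forall x \ae mu, uc 0 x = h x].
Proof.
move=> [uc [ucL ucc uuc uc0]]; exists uc; split => //; split => // t t0T e e0.
have /cvgrPdist_le/(_ e e0) := ucc t t0T.
rewrite near_withinE => /nbhs_ballP[delta /= delta0 hd]; exists delta => // r r0T rt.
have := hd r; rewrite /ball/= distrC => /(_ rt); rewrite in_itv /= => /(_ r0T).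
by rewrite sub0r normrN ger0_norm// normL2_ge0.
Qed.

Lemma cont_on_lin u v a : cont_on u -> cont_on v ->
  cont_on (fun t x => u t x + a * v t x).
Proof.
move=> [uL uc] [vL vc]; split.
  by move=> t tT; apply: inL2D; [exact: uL|apply: inL2Z; exact: vL].
move=> t tT e e0.
have a1 : 0 < `|a| + 1 by rewrite ltr_wpDl.
have e2 : 0 < e / 2 by rewrite divr_gt0.
have e3 : 0 < e / 2 / (`|a| + 1) by rewrite divr_gt0.
have [d1 d10 h1] := uc t tT _ e2; have [d2 d20 h2] := vc t tT _ e3.
exists (Num.min d1 d2); first by rewrite lt_min d10.
move=> r rT; rewrite lt_min => /andP[rd1 rd2].
have -> : (fun x => u r x + a * v r x - (u t x + a * v t x)) =
  (fun x => (u r x - u t x) + a * (v r x - v t x)) by apply/funext => x; ring.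
have l1 := inL2B (uL r rT) (uL t tT); have l2 := inL2B (vL r rT) (vL t tT).
apply: le_trans (normL2D l1 (inL2Z a l2)) _; rewrite normL2Z// (splitr e).
apply: lerD; first exact: h1.
have := h2 r rT rd2; rewrite ler_pdivlMr// => h3; apply: le_trans h3.
by rewrite mulrC ler_wpM2l ?normL2_ge0// lerDl.
Qed.

Lemma cont_on_cst h : L2 h -> cont_on (fun=> h).
Proof.
move=> hL; split => // t _ e e0; exists 1 => // r _ _.
rewrite normL2E; last by under eq_fun do rewrite subrr; exact: inL2_0.
by under eq_fun do rewrite subrr; rewrite dot0l sqrtr0 ltW.
Qed.

End bochner.

(** * The energy identity *)

(** Real induction: the supremum [c] of the [x] such that [P a x] is reached by
applying the local hypothesis at [c], and cannot lie below [b] for the same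
reason. *)
Lemma interval_induction (R : realType) (P : R -> R -> Prop) (a b : R) : a <= b ->
  (forall r s t, a <= r -> r <= s -> s <= t -> t <= b -> P r s -> P s t -> P r t) ->
  (forall x, a <= x <= b -> exists2 delta : R, 0 < delta &
    forall s t, a <= s -> s <= x -> x <= t -> t <= b ->
      x - delta < s -> t < x + delta -> P s t) ->
  P a b.
Proof.
move=> ab Ptrans Ploc.
pose S := [set x | a <= x <= b /\ P a x].
have Sa : S a.
  split; first by rewrite lexx.
  have [|d d0] := Ploc a; first by rewrite lexx.
  by apply; rewrite ?ltrBlDr ?ltrDl.
have Sub : has_sup S by split; [exists a|exists b => x [/andP[]]].
pose c := sup S.
have Sle x : S x -> x <= c by exact: (sup_upper_bound Sub).
have ac : a <= c by exact: Sle.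
have cb : c <= b by apply: ge_sup; [exists a|move=> x [/andP[]]].
have [|d d0 hd] := Ploc c; first by rewrite ac.
have [y Sy cy] := sup_adherent d0 Sub.
have yc : y <= c by exact: Sle.
have [/andP[ay yb] Pay] := Sy.
have Pac : P a c.
  apply: (Ptrans a y c) => //; apply: hd => //; by rewrite ltrDl.
have [cltb|] := ltP c b; last by move=> bc; have -> : b = c by apply/eqP; rewrite eq_le bc.
exfalso; pose t := Num.min b (c + d / 2).
have d2 : 0 < d / 2 by rewrite divr_gt0.
have ct : c < t by rewrite lt_min cltb ltrDl.
have tb : t <= b by rewrite ge_min lexx.
have St : S t.
  split; first by rewrite tb andbT (le_trans ac)// ltW.
  apply: (Ptrans a c t) => //; first exact: ltW.
  apply: hd => //; [exact: ltW|by rewrite ltrBlDr ltrDl|].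
  by rewrite (le_lt_trans (_ : t <= c + d / 2))// ?ge_min ?lexx ?orbT// ltrD2l ltr_pdivrMr// ltr_pMr// ltr1n.
have := Sle _ St; rewrite leNgt => /negP; apply; exact: ct.
Qed.

Section time_integrals.
Context (R : realType) (T : R).
Local Notation tm := (time_measure T).
Implicit Types (f g : R -> R).

Lemma time_integrableS f s t : tm.-integrable setT (EFin \o f) ->
  tm.-integrable `]s, t] (EFin \o f).
Proof. by move=> fi; exact: (integrableS measurableT _ _ fi). Qed.

Lemma time_integrableZl (a : R) f : tm.-integrable setT (EFin \o f) ->
  tm.-integrable setT (EFin \o (fun x => a * f x)).
Proof. by move=> fi; have := integrableZl measurableT a fi. Qed.

Lemma time_integrableD f g : tm.-integrable setT (EFin \o f) ->
  tm.-integrable setT (EFin \o g) -> tm.-integrable setT (EFin \o (fun x => f x + g x)).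
Proof. by move=> fi gi; have := integrableD measurableT fi gi. Qed.

Lemma time_integrableB f g : tm.-integrable setT (EFin \o f) ->
  tm.-integrable setT (EFin \o g) -> tm.-integrable setT (EFin \o (fun x => f x - g x)).
Proof. by move=> fi gi; have := integrableB measurableT fi gi. Qed.

Lemma time_integrable_cst (c : R) : tm.-integrable setT (EFin \o (fun=> c)).
Proof. exact: (@bounded_time_integrable _ _ _ `|c|). Qed.

Lemma time_Rintegral_cat f r s t : tm.-integrable setT (EFin \o f) ->
  r <= s -> s <= t ->
  \int[tm]_(x in `]r, t]) f x = \int[tm]_(x in `]r, s]) f x + \int[tm]_(x in `]s, t]) f x.
Proof.
move=> fi rs st.
have -> : `]r, t]%classic = `]r, s] `|` `]s, t].
  by apply: itv_bndbnd_setU; rewrite bnd_simp.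
rewrite Rintegral_setU//.
- by apply: (integrableS measurableT _ _ fi) => //; exact: measurableU.
- apply/disj_setPS => y [/=]; rewrite !in_itv/= => /andP[_ ys] /andP[].
  by rewrite ltNge ys.
Qed.

(** The difference, restricted to the interval, agrees almost everywhere with
its absolute value, whose integral is nonnegative. *)
Lemma time_ae_le_Rintegral f g s t : tm.-integrable setT (EFin \o f) ->
  tm.-integrable setT (EFin \o g) ->
  (\forall x \ae tm, s < x <= t -> f x <= g x) ->
  \int[tm]_(x in `]s, t]) f x <= \int[tm]_(x in `]s, t]) g x.
Proof.
move=> fi gi fg; rewrite -subr_ge0 -RintegralB//; [|exact: time_integrableS gi|exact: time_integrableS fi].
rewrite Rintegral_mkcond.
rewrite (@ae_eq_Rintegral_raw _ _ _ tm _
  (fun x => `|((fun x => g x - f x) \_ `]s, t]) x|)).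
  by apply: Rintegral_ge0.
apply: filterS fg => x fgx; rewrite ger0_norm// /patch; case: ifPn => //.
by rewrite inE/= in_itv/= => /fgx; rewrite subr_ge0.
Qed.

Lemma eps_delta_within g :
  (forall x : R, 0 <= x <= T -> forall eta : R, 0 < eta -> exists2 delta : R, 0 < delta &
     forall y : R, 0 <= y <= T -> `|y - x| < delta -> `|g y - g x| <= eta) ->
  {within `[0, T], continuous g}.
Proof.
move=> gc; apply/subspace_continuousP => x /=; rewrite in_itv/= => xT.
apply/cvgrPdist_le => e e0; have [d d0 hd] := gc x xT e e0.
rewrite near_withinE; apply/nbhs_ballP; exists d => //= y.
rewrite /ball/= => xy; rewrite in_itv/= => yT; rewrite distrC; apply: hd => //.
by rewrite distrC.
Qed.

End time_integrals.

Section chain_rule.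
Context (R : realType) (N : nat) (O : smooth_domain R N) (T : R).
Hypothesis T0 : 0 < T.
Local Notation mu := (dom_measure O).
Local Notation L2 := (inL2 O).
Local Notation dot := (dotL2 O).
Local Notation nrm := (normL2 O).
Local Notation H := (spH O).
Local Notation tm := (time_measure T).
Implicit Types (u v : R -> 'rV[R]_N -> R) (h g : 'rV[R]_N -> R) (a : R).

Lemma normL2_dist g h : L2 g -> L2 h ->
  `|nrm g - nrm h| <= nrm (fun x => g x - h x).
Proof.
move=> gL hL; have ghL := inL2B gL hL.
rewrite ler_norml; apply/andP; split.
  rewrite lerNl opprB lerBlDr.
  have := normL2B gL ghL; rewrite addrC; apply: le_trans.
  rewrite le_eqVlt; apply/orP; left; apply/eqP; congr normL2.
  by apply/funext => x; rewrite opprB addrC subrK.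
rewrite lerBlDr; have := normL2D ghL hL; apply: le_trans.
rewrite le_eqVlt; apply/orP; left; apply/eqP; congr normL2.
by apply/funext => x; rewrite subrK.
Qed.

Lemma cont_on_bounded u : cont_on O T u ->
  exists M, forall t, 0 <= t <= T -> nrm (u t) <= M.
Proof.
move=> [uL uc].
have [|c _ cM] := @EVT_max R (fun t => nrm (u t)) 0 T (ltW T0).
  apply: eps_delta_within => t tT e e0; have [d d0 hd] := uc t tT e e0.
  exists d => // r rT rt; apply: le_trans (hd r rT rt).
  by apply: normL2_dist; exact: uL.
by exists (nrm (u c)) => t tT; apply: cM; rewrite in_itv.
Qed.

(** [uc] is a primitive of [v] in the weak sense, tested against fixed elements
of H. *)
Definition primitive_of (uc v : R -> 'rV[R]_N -> R) := forall h (s t : R), L2 h -> 0 <= s -> s <= t -> t <= T ->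
  dot (uc t) h - dot (uc s) h = \int[tm]_(r in `]s, t]) dot (v r) h.

(** For fixed [h], the scalar function [dot (uc t) h] is continuous and has a
distributional derivative, so [weak_primitive] applies; [g] is its extension by
0, in order to have a bounded Borel function on the line. *)
Lemma time_derivative_primitive u uc v v' : cont_on O T uc ->
  (\forall t \ae tm, \forall x \ae mu, u t x = uc t x) ->
  is_time_derivative O T u v -> regular O v' ->
  tm.-integrable setT (fun t => (nrm (v' t))%:E) ->
  (\forall t \ae tm, v t = v' t) -> primitive_of uc v'.
Proof.
move=> uc_cont uuc duv rv iv vv' h s t hL s0 st tT.
have [ucL ucc] := uc_cont.
pose g := (fun r => dot (uc r) h) \_ `[0, T].
have gE r : 0 <= r <= T -> g r = dot (uc r) h by move=> rT; rewrite /g patchE mem_set//= in_itv.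
have dc (x : R) : 0 <= x <= T -> forall eta : R, 0 < eta -> exists2 delta : R, 0 < delta &
     forall y : R, 0 <= y <= T -> `|y - x| < delta -> `|dot (uc y) h - dot (uc x) h| <= eta.
  move=> xT eta eta0; have n0 : 0 < nrm h + 1 by rewrite ltr_wpDl ?normL2_ge0.
  have [|d d0 hd] := ucc x xT (eta / (nrm h + 1)); first by rewrite divr_gt0.
  exists d => // y yT yx; rewrite -(dotBl (ucL y yT) (ucL x xT) hL).
  apply: le_trans (dotL2_le (inL2B (ucL y yT) (ucL x xT)) hL) _.
  have := hd y yT yx; rewrite ler_pdivlMr//; apply: le_trans.
  by rewrite ler_wpM2l ?normL2_ge0// lerDl.
have gc (x : R) : 0 <= x <= T -> forall eta : R, 0 < eta -> exists2 delta : R, 0 < delta &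
     forall y : R, 0 <= y <= T -> `|y - x| < delta -> `|g y - g x| <= eta.
  move=> xT eta eta0; have [d d0 hd] := dc x xT eta eta0.
  by exists d => // y yT; rewrite !gE//; exact: hd.
have mg : measurable_fun setT g.
  have m0T : measurable (`[0, T]%classic : set R) by exact: measurable_itv.
  apply/(measurable_restrictT _ m0T).
  apply: subspace_continuous_measurable_fun => //.
  exact: (@eps_delta_within R T (fun r => dot (uc r) h) dc).
have [M uM] := cont_on_bounded uc_cont.
have gM r : `|g r| <= M * nrm h.
  have M0 : 0 <= M by apply: le_trans (uM 0 _); rewrite ?normL2_ge0// lexx ltW.
  rewrite /g patchE; case: ifPn => [|_]; last by rewrite normr0 mulr_ge0 ?normL2_ge0.
  rewrite inE/= in_itv/= => rT; apply: le_trans (dotL2_le (ucL r rT) hL) _.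
  by rewrite ler_wpM2r ?normL2_ge0// uM.
have := @weak_primitive R T T0 g (fun r => dot (v' r) h) _ mg gM gc
  (regular_dot_integrable rv iv hL).
rewrite -(gE t) ?tT ?(le_trans s0 st)// -(gE s) ?s0 ?(le_trans st tT)//; apply => //.
move=> psi tpsi.
rewrite (@ae_eq_Rintegral_raw _ _ _ tm _ (fun r => derive1 psi r * dot (u r) h)).
  rewrite (duv psi h tpsi hL); congr (- _).
  by apply: ae_eq_Rintegral_raw; apply: filterS vv' => r ->.
apply: (filterS2 _ _ uuc (time_ae_itv T)) => r ur rT.
rewrite gE; last by case/andP: rT => ? ?; rewrite !ltW.
by congr (_ * _); apply: eq_dot; [apply: filterS ur => x ->|exact: nearW].
Qed.

Section energy.
Variables u uc v : R -> 'rV[R]_N -> R.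
Hypotheses (uc_cont : cont_on O T uc) (ru : regular O u) (rv : regular O v)
  (iv : tm.-integrable setT (fun t => (nrm (v t))%:E))
  (uuc : \forall t \ae tm, \forall x \ae mu, u t x = uc t x)
  (prim : primitive_of uc v).

Lemma regular_dot_cont_integrable : tm.-integrable setT (EFin \o (fun r => dot (v r) (u r))).
Proof.
have [M uM] := cont_on_bounded uc_cont.
apply: (@time_ae_le_integrable _ _ _ (fun r => nrm (v r) * M)).
- exact: regular_dot_measurable.
- by have := integrableZr measurableT M iv.
- apply: (filterS2 _ _ uuc (time_ae_itv T)) => r ur /andP[r0 rT].
  apply: le_trans (dotL2_le (regular_inL2 r rv) (regular_inL2 r ru)) _.
  by rewrite ler_wpM2l ?normL2_ge0// (eq_normL2 ur) uM// !ltW.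
Qed.

(** On a short interval, the left-hand side is the inner product of [uc t - uc
s] and [uc t + uc s], hence the integral of [dot (v r) (uc t + uc s)].
Continuity of [uc] makes this as close to twice the integral of [dot (v r) (u
r)] as desired, relative to the integral of the norm of [v], and these errors
add up over adjacent intervals. *)
Lemma energy_identity (s t : R) : 0 <= s -> s <= t -> t <= T ->
  nrm (uc t) ^+ 2 - nrm (uc s) ^+ 2 = 2 * \int[tm]_(r in `]s, t]) dot (v r) (u r).
Proof.
move=> s0 st tT; have [ucL ucc] := uc_cont.
have ivu := regular_dot_cont_integrable.
pose E s t := nrm (uc t) ^+ 2 - nrm (uc s) ^+ 2 - 2 * \int[tm]_(r in `]s, t]) dot (v r) (u r).
pose V s t := \int[tm]_(r in `]s, t]) nrm (v r).
(* [E] is additive over adjacent intervals, so a bound relative to the additive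
[V] can be proved locally *)
suff bnd eta : 0 < eta -> `|E s t| <= eta * V s t.
  have V0 : 0 <= V s t by apply: Rintegral_ge0 => *; exact: normL2_ge0.
  have E0 : `|E s t| <= 0.
    apply/ler_addgt0Pl => e e0; rewrite addr0.
    apply: le_trans (bnd (e / (V s t + 1)) _) _; first by rewrite divr_gt0// ltr_wpDl.
    rewrite mulrAC ler_pdivrMr ?ltr_wpDl// ler_wpM2l ?ltW//.
    by rewrite ltrDl.
  by apply/eqP; rewrite -subr_eq0 -normr_le0.
move=> eta0.
apply: (@interval_induction R (fun s t => `|E s t| <= eta * V s t) s t st).
- move=> r1 r2 r3 h1 h2 h3 h4 e1 e2.
  have -> : E r1 r3 = E r1 r2 + E r2 r3.
    by rewrite /E (@time_Rintegral_cat _ _ _ r1 r2 r3)//; ring.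
  have -> : V r1 r3 = V r1 r2 + V r2 r3 by apply: time_Rintegral_cat.
  by rewrite mulrDr (le_trans (ler_normD _ _))// lerD.
move=> x /andP[sx xt].
have xT : 0 <= x <= T by rewrite (le_trans s0 sx) (le_trans xt tT).
have [|d d0 hd] := ucc x xT (eta / 4); first by rewrite divr_gt0.
exists d => // p q sp px xq qt dp qd.
have p0 : 0 <= p by exact: le_trans sp.
have qT : q <= T by exact: le_trans tT.
have pq : p <= q by exact: le_trans xq.
have pT : 0 <= p <= T by rewrite p0 (le_trans pq qT).
have q0T : 0 <= q <= T by rewrite qT (le_trans p0 pq).
have upL := ucL p pT; have uqL := ucL q q0T; have sumL := inL2D uqL upL.
have Eq : E p q = \int[tm]_(r in `]p, q])
    (dot (v r) (fun x => uc q x + uc p x) - 2 * dot (v r) (u r)).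
  have i1 := regular_dot_integrable rv iv sumL.
  rewrite RintegralB//; [|exact: time_integrableS i1|
    exact: (time_integrableS p q (time_integrableZl 2 ivu))].
  rewrite RintegralZl//; last exact: time_integrableS ivu.
  rewrite -(prim sumL p0 pq qT) /E !normL2_sqr// !dotDr// (dotC O (uc q) (uc p)); ring.
have near r : p < r <= q -> nrm (fun x => uc q x + uc p x - 2 * uc r x) <= eta.
  move=> /andP[pr rq].
  have rT : 0 <= r <= T by rewrite (le_trans p0 (ltW pr)) (le_trans rq qT).
  have dist y : 0 <= y <= T -> p <= y -> y <= q -> nrm (fun z => uc y z - uc x z) <= eta / 4.
    by move=> yT py yq; apply: hd => //; rewrite ltr_norml; lra.
  have D y : 0 <= y <= T -> L2 (fun z => uc y z - uc x z) by move=> yT; exact: inL2B (ucL y yT) (ucL x xT).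
  have -> : (fun x => uc q x + uc p x - 2 * uc r x) =
    (fun z => ((uc q z - uc x z) + (uc p z - uc x z)) - ((uc r z - uc x z) + (uc r z - uc x z))).
    by apply/funext => z; ring.
  apply: le_trans (normL2B (inL2D (D q q0T) (D p pT)) (inL2D (D r rT) (D r rT))) _.
  have := normL2D (D q q0T) (D p pT); have := normL2D (D r rT) (D r rT).
  have := dist q q0T pq (lexx _); have := dist p pT (lexx _) pq; have := dist r rT (ltW pr) rq.
  lra.
rewrite Eq.
have i1 := regular_dot_integrable rv iv sumL.
have i3 := time_integrableB i1 (time_integrableZl 2 ivu).
have i4 := time_integrableZl eta iv.
apply: le_trans (le_normr_Rintegral _ _) _ => //; first exact: time_integrableS i3.
rewrite /V -RintegralZl//; last exact: time_integrableS iv.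
apply: time_ae_le_Rintegral => //; first exact: integrable_norm i3.
apply: filterS uuc => r ur pr; have vL := regular_inL2 r rv.
have uL := regular_inL2 r ru.
rewrite -dotZr// -dotBr//; last exact: inL2Z.
apply: le_trans (dotL2_le vL (inL2B sumL (inL2Z 2 uL))) _.
rewrite mulrC ler_wpM2r ?normL2_ge0//.
apply: le_trans (near r pr); rewrite le_eqVlt; apply/orP; left; apply/eqP.
by apply: eq_normL2; apply: filterS ur => z ->.
Qed.

End energy.

End chain_rule.

(** * The source term as a function of time *)

(** Stated for all functions, measurable or not: both sides ignore the
complement of [D]. *)
Lemma integral_mrestr d (X : measurableType d) (R : realType)
    (m : {measure set X -> \bar R}) (D : set X) (mD : measurable D) (h : X -> \bar R) :
  (\int[mrestr m mD]_x h x = \int[m]_(x in D) h x)%E.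
Proof.
rewrite (@ae_eq_integral_raw _ _ _ _ _ (h \_ D)); last first.
  exists (~` D); split; [exact: measurableC|exact: (etrans (congr1 m (setICl D)) (measure0 m))|].
  by move=> x /=; apply: contra_not => Dx; rewrite patchE mem_set.
rewrite -integral_mkcond; apply: eq_measure_integral => A mA AD.
exact: (congr1 m (setIidl AD)).
Qed.

Section source.
Context (R : realType) (N : nat) (O : smooth_domain R N) (T : R).
Local Notation mu := (dom_measure O).
Local Notation tm := (time_measure T).
Variable f : measurableTypeR R * 'rV[R]_N -> R.
Hypothesis fL : f \in Lfun (cylinder_measure O T) 2%:E.

(** Tonelli's theorem for the square of [f] on the cylinder. *)
Lemma slice_source : exists2 F : R -> R, tm.-integrable setT (EFin \o F) &
  \forall t \ae tm, inL2 O (fun x => f (t, x)) /\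
    normL2 O (fun x => f (t, x)) ^+ 2 = F t.
Proof.
have mO := open_measurable_rV (dom_open O).
have mD : measurable (`]0, T[%classic `*` dom O : set (measurableTypeR R * 'rV[R]_N)).
  by apply: measurableX => //; exact: measurable_itv.
have mf : measurable_fun setT f by move: fL; rewrite inE => /andP[/[!inE]].
pose h z := (f z ^+ 2)%:E.
have mh : measurable_fun setT h.
  by apply/measurable_EFinP; exact: measurable_funX.
pose hD : measurableTypeR R * 'rV[R]_N -> \bar R := h \_ (`]0, T[%classic `*` dom O).
have mhD : measurable_fun setT hD by apply/(measurable_restrictT _ mD); exact: measurable_funTS.
have hD0 z : (0 <= hD z)%E by rewrite /hD patchE; case: ifPn => // _; rewrite lee_fin sqr_ge0.
have hoo : (\int[lebesgue_measure \x lebesgue_rV R N]_z hD z < +oo)%E.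
  have /integrableP[_] := Lfun2_integrable_sqr fL.
  rewrite integral_mrestr integral_mkcond; apply: le_lt_trans.
  rewrite le_eqVlt; apply/orP; left; apply/eqP; apply: eq_integral => z _.
  by rewrite /hD !patchE; case: ifPn => // _; rewrite /= ger0_norm ?sqr_ge0.
pose G (t : measurableTypeR R) := (\int[lebesgue_rV R N]_x hD (t, x))%E.
have mG : measurable_fun setT G by exact: (@measurable_fun_fubini_tonelli_F _ _ (measurableTypeR R) _ R (lebesgue_rV R N) hD mhD hD0).
have G0 t : (0 <= G t)%E by exact: integral_ge0.
have GE t : 0 < t < T -> G t = (\int[mu]_x h (t, x))%E.
  move=> tT; rewrite /G integral_mrestr [RHS]integral_mkcond; apply: eq_integral => x _.
  rewrite /hD !patchE; congr (if _ then _ else _); apply/idP/idP; rewrite !inE/=.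
    by case.
  by move=> Ox; split => //=; rewrite in_itv.
have iG : tm.-integrable setT G.
  apply/integrableP; split; first exact: mG.
  move: hoo; rewrite (fubini_tonelli1 hD mhD hD0); apply: le_lt_trans.
  rewrite integral_mrestr integral_mkcond; apply: ge0_ae_le_integral_raw => [x|//|].
    by rewrite patchE; case: ifPn.
  by apply: nearW => x; rewrite patchE gee0_abs//; case: ifPn.
exists (fine \o G).
  have /integrableP[_ Goo] := iG; apply/integrableP; split.
    apply/measurable_EFinP; exact: (measurableT_comp (fine_measurable measurableT) mG).
  apply: le_lt_trans Goo; apply: ge0_ae_le_integral_raw => //; apply: nearW => t.
  by rewrite /=; case: (G t) => [r| |] //=; rewrite ?normr0 ?leey.
have Gfin := integrable_ae measurableT iG.
apply: (filterS2 _ _ Gfin (time_ae_itv T)) => t /(_ I) Gt tT.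
have mft : measurable_fun setT (fun x => f (t, x)) by exact: measurable_fun_pair2.
have fL2 : inL2 O (fun x => f (t, x)).
  apply/inL2P; split; first exact: mft.
  move: Gt; rewrite GE// ge0_fin_numE//; apply: integral_ge0 => x _.
  by rewrite lee_fin sqr_ge0.
split=> //; rewrite normL2_sqr// /dotL2 /Rintegral /= GE//.
Qed.
End source.

(** * Green's formula and the Dirichlet form *)

Lemma le_young (R : realFieldType) (a b x c : R) : 0 < c ->
  0 <= c ^+ 2 * a - 2 * c * x + b -> x <= c / 2 * a + (2 * c)^-1 * b.
Proof.
move=> c0 h; rewrite -(ler_pM2l (_ : 0 < 2 * c)) ?mulr_gt0//.
have -> : 2 * c * (c / 2 * a + (2 * c)^-1 * b) = c ^+ 2 * a + b.
  by field; rewrite gt_eqF.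
lra.
Qed.

Section gradient.
Context (R : realType) (N : nat) (O : smooth_domain R N).
Local Notation mu := (dom_measure O).
Local Notation L2 := (inL2 O).
Local Notation dot := (dotL2 O).
Local Notation nrm := (normL2 O).
Local Notation W := (inW O).
Local Notation H1 := (inH1 O).
Local Notation lap := (laplacian O).
Implicit Types (u v z h p q : 'rV[R]_N -> R) (c : R).

Lemma dot_young p q c : L2 p -> L2 q -> 0 < c ->
  dot p q <= c / 2 * dot p p + (2 * c)^-1 * dot q q.
Proof.
move=> pL qL c0; have cpL := inL2Z c pL.
have := dotuu_ge0 O (fun x => c * p x - q x).
rewrite (dotBl cpL qL (inL2B cpL qL)) (dotBr cpL qL cpL) (dotBr cpL qL qL).
rewrite (dotZl c pL cpL) (dotZr c pL pL) (dotZl c pL qL) (dotZr c pL qL) (dotC O q p).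
move: (dot p p) (dot q q) (dot p q) => a b x h.
by apply: le_young => //; lra.
Qed.

Definition dirichlet u v : R := \sum_(i < N) dot (wpartial O i u) (wpartial O i v).

Lemma dot_lin_ge0 p q (c1 c2 : R) : L2 p -> L2 q ->
  0 <= c1 ^+ 2 * dot p p + 2 * c1 * c2 * dot p q + c2 ^+ 2 * dot q q.
Proof.
move=> pL qL; have c1L := inL2Z c1 pL; have c2L := inL2Z c2 qL.
have := dotuu_ge0 O (fun x => c1 * p x + c2 * q x).
rewrite (dotDl c1L c2L (inL2D c1L c2L)) (dotDr c1L c2L c1L) (dotDr c1L c2L c2L).
rewrite (dotZl c1 pL c1L) (dotZl c1 pL c2L) (dotZl c2 qL c1L) (dotZl c2 qL c2L).
rewrite (dotZr c1 pL pL) (dotZr c2 qL pL) (dotZr c1 pL qL) (dotZr c2 qL qL).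
rewrite (dotC O q p).
move: (dot p p) (dot q q) (dot p q) => a b x; lra.
Qed.

Lemma dot_diff_young p q r c : L2 p -> L2 q -> L2 r -> 0 < c ->
  dot p r - dot q r <=
  c / 2 * (dot p p - 2 * dot p q + dot q q) + (2 * c)^-1 * dot r r.
Proof.
move=> pL qL rL c0.
rewrite -(dotBl pL qL rL); apply: le_trans (dot_young (inL2B pL qL) rL c0) _.
rewrite lerD2r (dotBl pL qL (inL2B pL qL)) (dotBr pL qL pL) (dotBr pL qL qL).
rewrite (dotC O q p); move: (dot p p) (dot q q) (dot p q) => a b x; lra.
Qed.

Lemma sum_dot_diff_young (I : finType) (p q r : I -> 'rV[R]_N -> R) c :
  (forall i, L2 (p i)) -> (forall i, L2 (q i)) -> (forall i, L2 (r i)) -> 0 < c ->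
  \sum_i dot (p i) (r i) - \sum_i dot (q i) (r i) <=
  c / 2 * (\sum_i dot (p i) (p i) - 2 * \sum_i dot (p i) (q i) + \sum_i dot (q i) (q i)) +
  (2 * c)^-1 * \sum_i dot (r i) (r i).
Proof.
move=> pL qL rL c0.
rewrite -sumrB big_distrr /= -sumrB -big_split /= !big_distrr -big_split /=.
by apply: ler_sum => i _; exact: dot_diff_young.
Qed.

Lemma wpartial_inL2 i u : H1 u -> L2 (wpartial O i u).
Proof.
move=> [_ /(_ i)[g gL ug]].
by have [] := @xgetPex _ (fun=> 0) [set g | L2 g /\ is_weak_partial O i u g] (ex_intro _ g (conj gL ug)).
Qed.

Lemma inW_H1 u : W u -> H1 u. Proof. by move=> [[]]. Qed.

Lemma inH1_L2 u : H1 u -> L2 u. Proof. by case. Qed.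

Lemma laplacian_inL2 u : W u -> L2 (lap u).
Proof.
by move=> [[_ d2] _]; apply: inL2_sum => i; exact/wpartial_inL2.
Qed.

(** This is the weak form of the homogeneous Neumann condition. *)
Lemma green u z : W u -> H1 z -> dot (lap u) z = - dirichlet u z.
Proof. by move=> [_ nd] /nd /eqP; rewrite addr_eq0 => /eqP. Qed.

Lemma dirichletC u v : dirichlet u v = dirichlet v u.
Proof. by apply: eq_bigr => i _; rewrite dotC. Qed.

Lemma dirichlet_ge0 u : 0 <= dirichlet u u.
Proof. by apply: sumr_ge0 => i _; exact: dotuu_ge0. Qed.

(** The Dirichlet energy of [c1 u + c2 v], expanded: [wpartial] is a chosen
representative, so the square is completed on the combination of the gradients
of [u] and [v] and not on the gradient of the combination. *)
Lemma dirichlet_lin_ge0 u v (c1 c2 : R) : H1 u -> H1 v ->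
  0 <= c1 ^+ 2 * dirichlet u u + 2 * c1 * c2 * dirichlet u v + c2 ^+ 2 * dirichlet v v.
Proof.
move=> uH vH; rewrite /dirichlet !big_distrr -!big_split/=; apply: sumr_ge0 => i _.
exact: dot_lin_ge0 (wpartial_inL2 i uH) (wpartial_inL2 i vH).
Qed.

Lemma dirichlet_diff_young u v z c : H1 u -> H1 v -> H1 z -> 0 < c ->
  dirichlet u z - dirichlet v z <=
  c / 2 * (dirichlet u u - 2 * dirichlet u v + dirichlet v v) +
  (2 * c)^-1 * dirichlet z z.
Proof.
move=> uH vH zH c0.
by apply: sum_dot_diff_young => // i; exact: wpartial_inL2.
Qed.

Lemma normH1E u : H1 u -> normH1 O u = Num.sqrt (nrm u ^+ 2 + dirichlet u u).
Proof.
move=> uH; congr (Num.sqrt (_ + _)); apply: eq_bigr => i _.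
exact/normL2_sqr/wpartial_inL2.
Qed.

Lemma normH1_ge u (K : R) : H1 u -> normH1 O u <= K ->
  nrm u <= K /\ dirichlet u u <= K ^+ 2.
Proof.
move=> uH; rewrite normH1E// => uK; have d0 := dirichlet_ge0 u.
have K0 : 0 <= K by apply: le_trans uK; exact: sqrtr_ge0.
have s0 : 0 <= nrm u ^+ 2 + dirichlet u u by rewrite addr_ge0 ?sqr_ge0.
have := uK; rewrite -ler_sqr ?nnegrE ?sqrtr_ge0// sqr_sqrtr// => h; split.
  by rewrite -ler_sqr ?nnegrE ?normL2_ge0//; lra.
by have := sqr_ge0 (nrm u); lra.
Qed.

End gradient.

(** An essential supremum that is finite bounds the norm almost everywhere,
whether or not the norm is measurable in time. *)
Lemma inLpy_bound (R : realType) (N : nat) (O : smooth_domain R N) (T : R)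
    (u : R -> 'rV[R]_N -> R) : 0 < T -> inLp T +oo%E (spV O) u ->
  (\forall t \ae time_measure T, inH1 O (u t)) /\
  exists K : R, \forall t \ae time_measure T, normH1 O (u t) <= K.
Proof.
move=> T0 [[uV _]]; rewrite unlock.
have -> : (0 < time_measure T setT)%E.
  by rewrite time_measureE setTI lebesgue_measure_itv /= lte_fin T0 sube0 lte_fin.
set s := ess_sup _ _ => soo; split => //.
have sge := ess_sup_ge (time_measure T) (abse \o (fun t => (normH1 O (u t))%:E)).
exists (fine s); apply: filterS sge => t; rewrite -/s.
case: s soo => [r _|//|_]; last by rewrite leeNy_eq.
by rewrite /= lee_fin => h; rewrite (le_trans (ler_norm _)).
Qed.

(** * Two comparison principles *)

(** Let [m] be the supremum over [D] of [Q t * expR (- lambda t)]. Feeding [m]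
into the hypothesis gives [m <= A0 + c m / lambda <= A0 + m / 2]. Only values of
[Q] on a set of times are involved, so [Q] can be defined almost everywhere and
be far from continuous. *)
Lemma gronwall_sup (R : realType) (Q : R -> R) (D : R -> Prop) (A0 c lambda Kb : R) :
  (forall t, D t -> 0 <= t) -> 0 <= A0 -> 0 <= c -> 0 < lambda -> 2 * c <= lambda ->
  (forall t, D t -> Q t <= Kb) ->
  (forall m, 0 <= m -> (forall r, D r -> Q r <= m * expR (lambda * r)) ->
    forall t, D t -> Q t <= A0 + c * m * (expR (lambda * t) / lambda)) ->
  forall t, D t -> Q t <= 2 * A0 * expR (lambda * t).
Proof.
move=> D0 A00 c0 l0 cl QK step t Dt.
pose S := [set q | q = 0 \/ exists2 r, D r & q = Q r * expR (- (lambda * r))].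
have S0 : S 0 by left.
have Sub : has_sup S.
  split; first by exists 0.
  exists `|Kb| => q [->|[r Dr ->]]; first exact: normr_ge0.
  have e1 : expR (- (lambda * r)) <= 1.
    by rewrite -expR0 ler_expR oppr_le0 mulr_ge0 ?(ltW l0) ?D0.
  have e0 := expR_ge0 (- (lambda * r)).
  apply: (@le_trans _ _ (`|Kb| * expR (- (lambda * r)))).
    by rewrite ler_wpM2r// (le_trans (QK r Dr))// ler_norm.
  by rewrite ler_piMr.
pose m := sup S.
have Sle q : S q -> q <= m by exact: (sup_upper_bound Sub).
have m0 : 0 <= m by exact: Sle.
have Qm r : D r -> Q r <= m * expR (lambda * r).
  move=> Dr; rewrite -ler_pdivrMr ?expR_gt0// -expRN; apply: Sle; right; by exists r.
suff mA : m <= 2 * A0 by apply: le_trans (Qm t Dt) _; rewrite ler_wpM2r// expR_ge0.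
suff : m <= A0 + m / 2 by lra.
apply: ge_sup; first by exists 0.
move=> q [->|[r Dr ->]]; first by rewrite addr_ge0// divr_ge0.
have Qr := step m m0 Qm r Dr.
rewrite expRN ler_pdivrMr ?expR_gt0//; apply: le_trans Qr _.
have E1 : 1 <= expR (lambda * r) by rewrite -expR0 ler_expR mulr_ge0 ?(ltW l0) ?D0.
rewrite mulrDl; apply: lerD; first by rewrite ler_peMr.
have cl2 : c / lambda <= 1 / 2 by rewrite ler_pdivrMr//; lra.
have -> : c * m * (expR (lambda * r) / lambda) = c / lambda * (m * expR (lambda * r)) by ring.
have -> : m / 2 * expR (lambda * r) = 1 / 2 * (m * expR (lambda * r)) by ring.
by rewrite ler_wpM2r// mulr_ge0// expR_ge0.
Qed.

(** The hypothesis is an integrated form of [y' <= - delta]: while [y] is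
positive, [s] and [t] close to each other have [y s <= 2 y t], so that dividing
the difference of squares by [y s + y t] gives a decrease of at least [delta / 2
* (t - s)]. If [y (T / 2)] were positive, adding up would contradict the
smallness of [y 0]. *)
Lemma extinction (R : realType) (T delta : R) (y : R -> R) : 0 < T -> 0 < delta ->
  (forall t, 0 <= t <= T -> 0 <= y t) ->
  (forall x : R, 0 <= x <= T -> forall eta : R, 0 < eta -> exists2 d : R, 0 < d &
     forall z : R, 0 <= z <= T -> `|z - x| < d -> `|y z - y x| <= eta) ->
  (forall s t, 0 <= s -> s <= t -> t <= T -> y t ^+ 2 - y s ^+ 2 <= - (2 * delta * (t - s) * y t)) ->
  4 * y 0 < delta * T ->
  forall t, T / 2 <= t -> t <= T -> y t = 0.
Proof.
move=> T0 d0 y0 yc ydec small.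
have T2 : 0 < T / 2 by rewrite divr_gt0.
have T2T : T / 2 <= T by lra.
have noninc s t : 0 <= s -> s <= t -> t <= T -> y t <= y s.
  move=> s0 st tT; have yt : 0 <= y t by apply: y0; rewrite tT (le_trans s0).
  have ys : 0 <= y s by apply: y0; rewrite s0 (le_trans st).
  rewrite -ler_sqr ?nnegrE// -subr_le0; apply: le_trans (ydec s t s0 st tT) _.
  by rewrite oppr_le0 !mulr_ge0 ?subr_ge0// ltW.
suff yT2 : y (T / 2) = 0.
  move=> t ht tT; apply/eqP; rewrite eq_le y0 ?andbT ?tT ?(le_trans (ltW T2))//.
  by rewrite -yT2 noninc// ltW.
apply/eqP; apply: contraTT small => yT2; rewrite -leNgt.
have c0 : 0 < y (T / 2) by rewrite lt_neqAle eq_sym yT2 y0// T2T ltW.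
have : y (T / 2) + delta / 2 * (T / 2 - 0) <= y 0.
  apply: (@interval_induction R (fun s t => y t + delta / 2 * (t - s) <= y s) 0 (T / 2)) => [|r s t *|x /andP[x0 xT]].
  - exact: ltW.
  - lra.
  have [||d dd hd] := yc x _ (y (T / 2) / 2); [lra|lra|].
  exists d => // s t s0 sx xt tT ds dt.
  have := hd s; have := hd t.
  rewrite !ltr_norml !ler_norml => /(_ _ _)/andP h1 /(_ _ _)/andP h2.
  have [||h1a h1b] := h1; [lra|lra|].
  have [||h2a h2b] := h2; [lra|lra|].
  have yt : y (T / 2) <= y t by apply: noninc => //; lra.
  have := ydec s t s0 (le_trans sx xt) (le_trans tT T2T).
  have yst : y t <= y s by apply: noninc => //; lra.
  have ts : s <= t by exact: le_trans sx xt.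
  move=> h.
  have yt0 : 0 < y t by exact: lt_le_trans yt.
  have h3 : 2 * delta * (t - s) * y t <= (y s - y t) * (3 * y t).
    apply: (@le_trans _ _ ((y s - y t) * (y s + y t))); first by lra.
    by rewrite ler_wpM2l ?subr_ge0//; lra.
  have h4 : 2 * delta * (t - s) <= (y s - y t) * 3.
    by rewrite -(ler_pM2r yt0); lra.
  have : 0 <= delta * (t - s) by rewrite mulr_ge0 ?subr_ge0// ltW.
  lra.
lra.
Qed.

Lemma time_integral_expR (R : realType) (T lambda : R) : 0 < lambda ->
  exists e : R -> R, [/\ (time_measure T).-integrable setT (EFin \o e),
    forall r, 0 < r < T -> e r = expR (lambda * r) &
    forall t, 0 <= t -> t < T ->
      \int[time_measure T]_(r in `]0, t]) e r <= expR (lambda * t) / lambda].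
Proof.
move=> l0; pose e : R -> R := (fun r => expR (lambda * r)) \_ `]0, T[.
have me0 : continuous (fun r : R => expR (lambda * r)).
  move=> r; apply: (@continuous_comp _ _ _ (fun r => lambda * r) expR).
    by apply: cvgMr; exact: cvg_id.
  exact: continuous_expR.
have eE r : 0 < r < T -> e r = expR (lambda * r).
  by move=> rT; rewrite /e patchE mem_set//= in_itv.
have me : measurable_fun setT e.
  have m0T : measurable (`]0, T[%classic : set R) by exact: measurable_itv.
  apply/(measurable_restrictT _ m0T).
  apply: (@measurable_funS _ _ _ _ setT) => //.
  exact: continuous_measurable_fun.
exists e; split => //.
  apply: (@bounded_time_integrable _ _ _ (expR (lambda * T))) => // r.
  rewrite /e patchE; case: ifPn => [|_]; last by rewrite normr0 expR_ge0.
  rewrite inE/= in_itv/= => /andP[r0 rT].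
  by rewrite ger0_norm ?expR_ge0// ler_expR ler_wpM2l// ltW.
move=> t; rewrite le_eqVlt => /predU1P[<- _|t0 tT].
  by rewrite set_itvoc0 Rintegral_set0 divr_ge0 ?expR_ge0// ltW.
have tsub : `]0, t]%classic `<=` (`]0, T[%classic : set R).
  by move=> r /=; rewrite !in_itv/= => /andP[-> /le_lt_trans ->].
have -> : \int[time_measure T]_(r in `]0, t]) e r =
    \int[lebesgue_measure]_(r in `[0, t]) expR (lambda * r).
  rewrite /Rintegral integral_time_measure// -integral_itv_obnd_cbnd; last first.
    apply/measurable_EFinP; apply: (@measurable_funS _ _ _ _ setT) => //.
    exact: continuous_measurable_fun.
  congr fine; apply: eq_integral => r; rewrite inE/= in_itv/= => /andP[r0 rt].
  by rewrite eE// r0 (le_lt_trans rt).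
have dF (r : R) : is_derive r 1 (fun r => lambda^-1 * expR (lambda * r)) (expR (lambda * r)).
  have h := is_deriveM (is_derive_cst lambda r (1:R)) (is_derive_id r (1:R)).
  have h2 := is_derive1_comp (is_derive_expR (lambda * r)) h.
  have := is_deriveM (is_derive_cst lambda^-1 r (1:R)) h2.
  congr is_derive; rewrite /GRing.scale /= !(mulr0, addr0, mulr1).
  by field; rewrite gt_eqF.
have cF : continuous (fun r => lambda^-1 * expR (lambda * r)).
  move=> r; apply: differentiable_continuous; apply/derivable1_diffP.
  exact: (@ex_derive _ _ _ _ _ _ _ (dF r)).
rewrite /Rintegral (@continuous_FTC2 _ _ (fun r => lambda^-1 * expR (lambda * r)))//.
- rewrite /= mulrC lerBlDr lerDl mulr_ge0 ?expR_ge0// invr_ge0 ltW//.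
- exact: continuous_subspaceT.
- split; [by move=> x _; exact: (@ex_derive _ _ _ _ _ _ _ (dF x))| |].
  + exact/cvg_at_right_filter/cF.
  + exact/cvg_at_left_filter/cF.
- by move=> x _; rewrite derive1E; exact: (@derive_val _ _ _ _ _ _ _ (dF x)).
Qed.

(** * The two equations tested at a fixed time *)

(** The numbers stand for the quantities of the two tested equations at a fixed
time: [a] and [b] are the inner products of the time derivatives of [theta] and
[phi] with [theta] and [chi]; [P], [G] and [X] are the Dirichlet energies of
[w_t], [w] and [phi]; [y], [x], [z], [s] are the norms of [theta], [chi], [w_t]
and [phi_star]; [lx] is the inner product of the laplacian of [phi] with [chi].
The weight [M] is the one for which [M * X / 2] absorbs the term in [X] left
over by the first equation. *)
Lemma energy_young (R : realFieldType) (kappa l gamma L C1 K1 s rho P X G F Xs x y z a b lx : R) :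
  0 < kappa -> 0 < l -> 0 < gamma -> 0 <= L -> 0 <= K1 -> 0 <= s -> 0 <= rho ->
  0 <= x -> 0 <= y -> 0 <= z ->
  let M := 2 * kappa * l ^+ 2 + 1 in
  a <= - (kappa / 2 * P) + (kappa * l ^+ 2 + 2^-1) * X + C1 * G + F / 2 + y ^+ 2 / 2 ->
  b <= lx + (K1 + L * x + gamma * z - rho) * x ->
  lx <= - (X / 2) + Xs / 2 ->
  z <= y + l * x + l * s ->
  a + M * b <= - (kappa / 2 * P) + C1 * G +
    M * (Xs / 2 + K1 ^+ 2 / 2 + (gamma * l * s) ^+ 2 / 2) +
    (2^-1 + M * gamma / 2 + 1 + L + gamma / 2 + gamma * l) * (y ^+ 2 + M * x ^+ 2) + F / 2.
Proof.
move=> k0 l0 g0 L0 K0 s0 r0 x0 y0 z0 M ha hb hl hz.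
have M1 : 1 <= M by rewrite /M lerDr mulr_ge0 ?sqr_ge0// mulr_ge0// ltW.
have M0 : 0 <= M by lra.
have zx : gamma * z * x <= gamma * (y + l * x + l * s) * x.
  by rewrite ler_wpM2r// ler_wpM2l// ltW.
have rx : 0 <= rho * x by rewrite mulr_ge0.
have e1 : 2 * (K1 * x) <= K1 ^+ 2 + x ^+ 2 by have := sqr_ge0 (K1 - x); lra.
have e2 : 2 * (gamma * (y * x)) <= gamma * (y ^+ 2 + x ^+ 2).
  by have := mulr_ge0 (ltW g0) (sqr_ge0 (y - x)); lra.
have e3 : 2 * (gamma * l * s * x) <= (gamma * l * s) ^+ 2 + x ^+ 2.
  by have := sqr_ge0 (gamma * l * s - x); lra.
have hb2 : b <= - (X / 2) + (Xs / 2 + K1 ^+ 2 / 2 + (gamma * l * s) ^+ 2 / 2) +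
   (1 + L + gamma / 2 + gamma * l) * x ^+ 2 + gamma / 2 * y ^+ 2 by lra.
have := ler_wpM2l M0 hb2.
have q1 : 0 <= (1 + L + gamma / 2 + gamma * l) * y ^+ 2.
  by rewrite mulr_ge0 ?sqr_ge0// !addr_ge0 ?mulr_ge0// ltW.
have q2 : 0 <= (2^-1 + M * gamma / 2) * (M * x ^+ 2).
  by rewrite mulr_ge0 ?addr_ge0 ?mulr_ge0 ?sqr_ge0// ?ltW// invr_ge0.
have MX : M * (X / 2) = (kappa * l ^+ 2 + 2^-1) * X by rewrite /M; field.
lra.
Qed.

Section estimates.
Context (R : realType) (N : nat) (O : smooth_domain R N).
Local Notation mu := (dom_measure O).
Local Notation L2 := (inL2 O).
Local Notation dot := (dotL2 O).
Local Notation nrm := (normL2 O).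
Local Notation W := (inW O).
Local Notation H1 := (inH1 O).
Local Notation lap := (laplacian O).
Local Notation dir := (dirichlet O).
Implicit Types (u v z h p q : 'rV[R]_N -> R) (c : R).

Lemma inW_L2 u : W u -> L2 u. Proof. by move=> /inW_H1/inH1_L2. Qed.

Lemma subdiff_monotone (bh : R -> \bar R) (r s r' s' : R) :
  (forall r, (0 <= bh r)%E) -> subdiff bh r s -> subdiff bh r' s' ->
  0 <= (s - s') * (r - r').
Proof.
move=> b0 [bfin hb] [bfin' hb'].
have := hb r'; have := hb' r; have := b0 r; have := b0 r'.
case: (bh r) bfin => [x| |]//; case: (bh r') bfin' => [y| |]//= _ _ _ _.
rewrite -!EFinD !lee_fin; lra.
Qed.

(** Both cases of [Sign] give the same inner product; when [v] is null this
follows from the Cauchy-Schwarz inequality. *)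
Lemma sign_dot v s : L2 v -> Sign O v s -> dot s v = nrm v.
Proof.
move=> vL [sL _]; have [v0 _|v0 /(_ isT) sv] := eqVneq (nrm v) 0.
  have := dotL2_le sL vL; rewrite v0 mulr0 normr_le0 => /eqP ->//.
rewrite (eq_dot (u' := fun x => (nrm v)^-1 * v x) (v' := v)); last exact: nearW.
  by rewrite dotZl// -normL2_sqr// expr2 mulrA mulVf// mul1r.
by apply: filterS sv => x ->; rewrite mulrC.
Qed.

Lemma lipschitz_L2 (g : R -> R) (L : R) p q : measurable_fun setT g -> 0 <= L ->
  (forall r s, `|g r - g s| <= L * `|r - s|) -> L2 p -> L2 q ->
  L2 (fun x => g (p x) - g (q x)) /\
  nrm (fun x => g (p x) - g (q x)) <= L * nrm (fun x => p x - q x).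
Proof.
move=> mg L0 gL pL qL; have pqL := inL2B pL qL; have LpqL := inL2Z L pqL.
have md : measurable_fun setT (fun x => g (p x) - g (q x)).
  by apply: measurable_funB; apply: (measurableT_comp mg); [exact: inL2_measurable pL|exact: inL2_measurable qL].
have sq x : (g (p x) - g (q x)) ^+ 2 <= (L * (p x - q x)) ^+ 2.
  have : `|g (p x) - g (q x)| <= `|L * (p x - q x)| by rewrite normrM (ger0_norm L0).
  by rewrite -ler_sqr ?nnegrE// !real_normK ?num_real.
have dL : L2 (fun x => g (p x) - g (q x)).
  apply/inL2P; split => //; have [_] := (inL2P O _).1 LpqL; apply: le_lt_trans.
  by apply: ge0_ae_le_integral_raw => [x|x|]; rewrite ?lee_fin ?sqr_ge0//; apply: nearW => x; rewrite lee_fin.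
split => //; rewrite -(ger0_norm L0) -normL2Z//.
rewrite -ler_sqr ?nnegrE ?normL2_ge0// !normL2_sqr//.
apply: le_Rintegral => //; [exact: inL2_mul|exact: inL2_mul|].
by move=> x _; rewrite -!expr2.
Qed.

(** The functions [lp] and [lps] stand for the laplacians of [p] and [ps], and
[a - 2 c + d] for the Dirichlet energy of their difference. Keeping the
laplacians abstract makes the lemma a statement on inner products alone. *)
Lemma dissipation (lp lps p ps : 'rV[R]_N -> R) (a c d : R) :
  L2 lp -> L2 lps -> L2 p -> L2 ps ->
  dot lp p = - a -> dot lp ps = - c -> dot lps p = - c -> dot lps ps = - d ->
  0 <= 1 ^+ 2 * a + 2 * 1 * (-1) * c + (-1) ^+ 2 * d ->
  dot lp (fun x => p x - ps x) <= - (a / 2) + d / 2 /\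
  dot lp (fun x => p x - ps x) <= nrm lps * nrm (fun x => p x - ps x).
Proof.
move=> lpL lpsL pL psL h1 h2 h3 h4 h; have chiL := inL2B pL psL.
have := dotL2_le lpsL chiL; rewrite ler_norml => /andP[_].
rewrite (dotBr pL psL lpL) (dotBr pL psL lpsL) h1 h2 h3 h4.
by move: (nrm lps) (nrm (fun x => p x - ps x)) => n1 n2 h5; split; lra.
Qed.

(** The quadratic form hypotheses are Young's inequalities in the form of
completed squares: the first two, multiplied by [kappa], cost a quarter of the
dissipation [kappa * zz] each. *)
Lemma heat_balance (kappa tau l : R) (A lz lu z p f : 'rV[R]_N -> R)
    (zz zp uz up uu pp : R) :
  0 < kappa -> 0 < tau -> 0 < l -> L2 A -> L2 lz -> L2 lu -> L2 z -> L2 p -> L2 f ->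
  dot lz z = - zz -> dot lz p = - zp -> dot lu z = - uz -> dot lu p = - up ->
  0 <= 2^-1 ^+ 2 * zz + 2 * 2^-1 * l * zp + l ^+ 2 * pp ->
  0 <= (tau / kappa) ^+ 2 * uu + 2 * (tau / kappa) * 2^-1 * uz + 2^-1 ^+ 2 * zz ->
  0 <= (tau * l) ^+ 2 * uu + 2 * (tau * l) * 1 * up + 1 ^+ 2 * pp ->
  (\forall x \ae mu, A x - kappa * lz x - tau * lu x = f x) ->
  dot A (fun x => z x + l * p x) <= - (kappa / 2 * zz) +
    (kappa * l ^+ 2 + 2^-1) * pp +
    (tau ^+ 2 / kappa + tau ^+ 2 * l ^+ 2 / 2) * uu +
    nrm f ^+ 2 / 2 + nrm (fun x => z x + l * p x) ^+ 2 / 2.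
Proof.
move=> k0 t0 l0 AL lzL luL zL pL fL e1 e2 e3 e4 h1 h2 h3 eqA.
have lpL := inL2Z l pL.
have thL := inL2D zL lpL; set th := fun x => z x + l * p x.
have klzL := inL2Z kappa lzL; have tluL := inL2Z tau luL; have kt := inL2D klzL tluL.
have -> : dot A th = - kappa * (zz + l * zp) - tau * (uz + l * up) + dot f th.
  transitivity (dot (fun x => kappa * lz x + tau * lu x + f x) th).
    by apply: eq_dot; [apply: filterS eqA => x <-; ring|exact: nearW].
  rewrite (dotDl kt fL thL) (dotDl klzL tluL thL) (dotZl kappa lzL thL) (dotZl tau luL thL).
  rewrite (dotDr zL lpL lzL) (dotDr zL lpL luL) (dotZr l pL lzL) (dotZr l pL luL).
  rewrite e1 e2 e3 e4; move: (dot f th) => *; ring.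
have f1 : dot f th <= nrm f ^+ 2 / 2 + nrm th ^+ 2 / 2.
  have := dotL2_le fL thL; rewrite ler_norml => /andP[_].
  have := sqr_ge0 (nrm f - nrm th); move: (nrm f) (nrm th) (dot f th) => *; lra.
have h1' := mulr_ge0 (ltW k0) h1; have h2' := mulr_ge0 (ltW k0) h2.
have q2 : kappa * ((tau / kappa) ^+ 2 * uu + 2 * (tau / kappa) * 2^-1 * uz + 2^-1 ^+ 2 * zz) =
  tau ^+ 2 / kappa * uu + tau * uz + kappa / 4 * zz by field; rewrite gt_eqF.
have q1 : kappa * (2^-1 ^+ 2 * zz + 2 * 2^-1 * l * zp + l ^+ 2 * pp) =
  kappa / 4 * zz + kappa * l * zp + kappa * l ^+ 2 * pp by field.
rewrite q2 in h2'; rewrite q1 in h1'.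
move: (nrm f ^+ 2) (nrm th ^+ 2) (dot f th) f1 => *; lra.
Qed.

Section phase.
Variables (pi : R -> R) (L rho gamma : R) (p ps z B xi b s : 'rV[R]_N -> R).
Hypotheses (mpi : measurable_fun setT pi) (L0 : 0 <= L) (g0 : 0 <= gamma)
  (piL : forall r s, `|pi r - pi s| <= L * `|r - s|).
Hypotheses (pW : W p) (psW : W ps) (zL : L2 z) (BL : L2 B) (xL : L2 xi) (bL : L2 b).
Hypothesis eqB : \forall x \ae mu,
  B x - lap p x + xi x + pi (p x) + rho * s x = gamma * z x.
Hypothesis mono : \forall x \ae mu, 0 <= (xi x - b x) * (p x - ps x).
Hypothesis sgn : Sign O (fun x => p x - ps x) s.

Let chi := fun x => p x - ps x.
Let chiL : L2 chi. Proof. by apply: inL2B; exact: inW_L2. Qed.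
Let sL : L2 s. Proof. by case: sgn. Qed.
Let pL : L2 p := inW_L2 pW.
Let psL : L2 ps := inW_L2 psW.
Let lpL : L2 (lap p) := laplacian_inL2 pW.

Let piL2 : L2 (fun x => pi (ps x)).
Proof.
have h : L2 (fun x => gamma * z x - rho * s x - xi x + lap p x - B x).
  exact: inL2B (inL2D (inL2B (inL2B (inL2Z gamma zL) (inL2Z rho sL)) xL) lpL) BL.
have pipL : L2 (fun x => pi (p x)).
  apply: (ae_inL2 h); first exact: (measurableT_comp mpi (inL2_measurable pL)).
  by apply: filterS eqB => x <-; ring.
have [dL _] := lipschitz_L2 mpi L0 piL psL pL.
have := inL2D pipL dL; congr (inL2 _ _).
by apply/funext => x; rewrite addrC subrK.
Qed.

(** The function [pi (ps x)] is square integrable because the equation itself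
expresses [pi (p x)] through square integrable functions, and the two differ by
at most [L] times [chi]. *)
Lemma phase_test : dot B chi <= dot (lap p) chi +
  (nrm b + nrm (fun x => pi (ps x)) + L * nrm chi + gamma * nrm z - rho) * nrm chi.
Proof.
have [dL dn] := lipschitz_L2 mpi L0 piL pL psL.
set d := fun x => pi (p x) - pi (ps x).
set q := fun x => pi (ps x).
have gzL := inL2Z gamma zL; have rsL := inL2Z rho sL.
have dqL := inL2D dL piL2.
have f1 := inL2B lpL xL; have f2 := inL2B f1 dqL; have f3 := inL2B f2 rsL.
have -> : dot B chi = dot (lap p) chi - dot xi chi - (dot d chi + dot q chi) -
    rho * dot s chi + gamma * dot z chi.
  rewrite -(dotZl gamma zL chiL) -(dotZl rho sL chiL) -(dotDl dL piL2 chiL).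
  rewrite -(dotBl lpL xL chiL) -(dotBl f1 dqL chiL) -(dotBl f2 rsL chiL).
  rewrite -(dotDl f3 gzL chiL); apply: eq_dot; last exact: nearW.
  apply: filterS eqB => x h.
  have -> : B x = lap p x - xi x - pi (p x) - rho * s x + gamma * z x by rewrite -h; ring.
  by rewrite /d; ring.
rewrite (sign_dot chiL sgn).
have n1 : dot b chi <= dot xi chi.
  rewrite -subr_ge0 -(dotBl xL bL chiL); exact: dot_ge0.
have := dotL2_le bL chiL; have := dotL2_le dL chiL; have := dotL2_le piL2 chiL.
have := dotL2_le zL chiL; rewrite !ler_norml => /andP[_ n2] /andP[n3 _] /andP[n4 _] /andP[n5 _].
have n6 : nrm d * nrm chi <= L * nrm chi * nrm chi by rewrite ler_wpM2r ?normL2_ge0.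
have n7 := ler_wpM2l g0 n2.
move: n1 n3 n4 n5 n6 n7; rewrite -/d -/q.
move: (dot (lap p) chi) (dot xi chi) (dot d chi) (dot q chi) (dot z chi) (dot b chi).
move: (nrm b) (nrm q) (nrm d) (nrm z) (nrm chi) => *; lra.
Qed.

(** The first bound keeps the dissipation and serves the a priori estimate; the
second one drops it and serves the final extinction argument. *)
Lemma laplacian_dissipates : dot (lap p) chi <= - (dir p p / 2) + dir ps ps / 2 /\
  dot (lap p) chi <= nrm (lap ps) * nrm chi.
Proof.
have pH := inW_H1 pW; have psH := inW_H1 psW.
apply: (dissipation lpL (laplacian_inL2 psW) pL psL (green pW pH) (green pW psH) _
  (green psW psH) (dirichlet_lin_ge0 1 (-1) pH psH)).
by rewrite -dirichletC; exact: green psW pH.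
Qed.

End phase.

Lemma heat_test (kappa tau l : R) (A u z p f : 'rV[R]_N -> R) :
  0 < kappa -> 0 < tau -> 0 < l -> L2 A -> W u -> W z -> W p -> L2 f ->
  (\forall x \ae mu, A x - kappa * lap z x - tau * lap u x = f x) ->
  dot A (fun x => z x + l * p x) <= - (kappa / 2 * dir z z) +
    (kappa * l ^+ 2 + 2^-1) * dir p p +
    (tau ^+ 2 / kappa + tau ^+ 2 * l ^+ 2 / 2) * dir u u +
    nrm f ^+ 2 / 2 + nrm (fun x => z x + l * p x) ^+ 2 / 2.
Proof.
move=> k0 t0 l0 AL uW zW pW fL eqA.
have zH := inW_H1 zW; have pH := inW_H1 pW; have uH := inW_H1 uW.
exact: (heat_balance k0 t0 l0 AL (laplacian_inL2 zW) (laplacian_inL2 uW)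
  (inW_L2 zW) (inW_L2 pW) fL (green zW zH) (green zW pH) (green uW zH) (green uW pH)
  (dirichlet_lin_ge0 2^-1 l zH pH) (dirichlet_lin_ge0 (tau / kappa) 2^-1 uH zH)
  (dirichlet_lin_ge0 (tau * l) 1 uH pH) eqA).
Qed.

End estimates.

(** * The a priori bound *)

Lemma lower_from_young (R : realFieldType) (p q P Mj X k : R) : 0 <= k ->
  p - q <= X + k * P -> P <= Mj -> - (X + k * Mj) <= - p - - q.
Proof. by move=> k0 h1 h2; have := ler_wpM2l k0 h2; lra. Qed.

Section a_priori.
Context (R : realType) (N : nat) (O : smooth_domain R N) (T : R).
Hypothesis T0 : 0 < T.
Local Notation mu := (dom_measure O).
Local Notation L2 := (inL2 O).
Local Notation dot := (dotL2 O).
Local Notation nrm := (normL2 O).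
Local Notation W := (inW O).
Local Notation lap := (laplacian O).
Local Notation dir := (dirichlet O).
Local Notation tm := (time_measure T).
Implicit Types (u v : R -> 'rV[R]_N -> R) (h g : 'rV[R]_N -> R) (a : R).

Lemma time_Rintegral_cst (c s t : R) : 0 <= s -> s <= t -> t <= T ->
  \int[tm]_(r in `]s, t]) c = c * (t - s).
Proof.
move=> s0 st tT; rewrite Rintegral_cst//; congr (_ * _).
by have := @time_measure_itv R T false false s t s0 st tT => /= ->.
Qed.

Lemma time_Rintegral_le_norm (f : R -> R) s t : tm.-integrable setT (EFin \o f) ->
  \int[tm]_(r in `]s, t]) f r <= \int[tm]_r `|f r|.
Proof.
move=> fi; have nfi : tm.-integrable setT (EFin \o (fun r => `|f r|)) := integrable_norm fi.
have i1 : tm.-integrable setT (EFin \o (fun r => \1_(`]s, t]%classic : set R) r * f r)).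
  apply: (@time_integrableM R T _ f 1) => // x.
  by rewrite indicE; case: (_ \in _); rewrite ?normr1 ?normr0.
have -> : \int[tm]_(r in `]s, t]) f r = \int[tm]_r (\1_(`]s, t]%classic : set R) r * f r).
  rewrite Rintegral_mkcond; apply: eq_Rintegral => r _.
  by rewrite patchE indicE; case: ifPn => _ /=; rewrite ?mul1r ?mul0r.
apply: le_Rintegral => // r _; rewrite indicE; case: (_ \in _) => /=.
  by rewrite mul1r ler_norm.
by rewrite mul0r.
Qed.

(** With [lt] and [l0] the laplacians of [w t] and of [w 0], pair [w t - w 0],
written as the integral of [z'], with [lt - l0]. One side is minus the Dirichlet
energy [Dd] of the increment. Young's inequality with weight [T^-1] bounds the
integrand by a part whose integral is at most half of [Dd], plus a multiple of
the majorant. *)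
Lemma history_duality (w0 wt lt l0 : 'rV[R]_N -> R) (a c d : R) wc z' (Maj : R -> R) (t : R) :
  L2 w0 -> L2 wt -> L2 lt -> L2 l0 -> 0 <= t -> t <= T ->
  dot lt wt = - a -> dot lt w0 = - c -> dot l0 wt = - c -> dot l0 w0 = - d ->
  0 <= 1 ^+ 2 * a + 2 * 1 * (-1) * c + (-1) ^+ 2 * d ->
  0 <= 1 ^+ 2 * a + 2 * 1 * (-2) * c + (-2) ^+ 2 * d ->
  (\forall x \ae mu, wt x = wc t x) -> (\forall x \ae mu, wc 0 x = w0 x) ->
  regular O z' -> tm.-integrable setT (fun r => (nrm (z' r))%:E) ->
  primitive_of O T wc z' ->
  tm.-integrable setT (EFin \o Maj) ->
  (\forall r \ae tm, - (T^-1 / 2 * (a - 2 * c + d) + (2 * T^-1)^-1 * Maj r) <=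
    dot lt (z' r) - dot l0 (z' r)) ->
  a <= 2 * d + 2 * T * \int[tm]_(r in `]0, t]) Maj r.
Proof.
move=> w0L wtL ltL l0L t0 tT e1 e2 e3 e4 q1 q2 wtE w0E rz iz prim iM zMaj.
have hL := inL2B ltL l0L; set h := fun x => lt x - l0 x.
pose Dd := a - 2 * c + d.
have lhs : dot (wc t) h - dot (wc 0) h = - Dd.
  have -> : dot (wc t) h - dot (wc 0) h = dot wt h - dot w0 h.
    by congr (_ - _); apply: eq_dot; [apply: filterS wtE => x ->|exact: nearW|exact: w0E|exact: nearW].
  rewrite (dotBr ltL l0L wtL) (dotBr ltL l0L w0L) !(dotC _ wt) !(dotC _ w0) e1 e2 e3 e4.
  by rewrite /Dd; ring.
have i1 := regular_dot_integrable rz iz hL.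
have k2 : (2 * T^-1)^-1 = T / 2 by rewrite invfM invrK mulrC.
have i2 := time_integrableD (time_integrable_cst T (T^-1 / 2 * Dd)) (time_integrableZl (T / 2) iM).
have key : - Dd >= - (\int[tm]_(r in `]0, t]) (T^-1 / 2 * Dd + T / 2 * Maj r)).
  rewrite -lhs (prim h 0 t hL (lexx 0) t0 tT) lerNl.
  have i3 := time_integrableZl (-1) i1.
  rewrite -mulN1r -RintegralZl//; last exact: time_integrableS i1.
  apply: time_ae_le_Rintegral => //; apply: filterS zMaj => r; rewrite k2 => zM _.
  have zL := regular_inL2 r rz.
  rewrite mulN1r (dotBr ltL l0L zL) !(dotC _ (z' r)) lerNl; exact: zM.
have := key; rewrite lerN2 RintegralD//; last 2 first.
- exact: (time_integrableS 0 t (time_integrable_cst T _)).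
- exact: (time_integrableS 0 t (time_integrableZl (T / 2) iM)).
rewrite time_Rintegral_cst// RintegralZl//; last exact: time_integrableS iM.
set I := \int[tm]_(r in _) _; rewrite subr0 => hD.
have Dd0 : 0 <= Dd by rewrite /Dd; lra.
have tD : T^-1 / 2 * Dd * t <= Dd / 2.
  have -> : Dd / 2 = T^-1 / 2 * Dd * T by field; rewrite gt_eqF.
  by rewrite ler_wpM2l// mulr_ge0// mulr_ge0// invr_ge0 ltW.
have DI : Dd <= T * I by lra.
by move: DI; rewrite /Dd; lra.
Qed.

(** The gradient of [wt] is reached from that of its time derivative through
duality with the laplacian, so that an integrable majorant of the possibly
non-measurable function [dir (z' r) (z' r)] suffices. *)
Lemma dirichlet_history (w0 wt : 'rV[R]_N -> R) wc z' (Maj : R -> R) (t : R) :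
  W w0 -> W wt -> 0 <= t -> t <= T ->
  (\forall x \ae mu, wt x = wc t x) -> (\forall x \ae mu, wc 0 x = w0 x) ->
  regular O z' -> tm.-integrable setT (fun r => (nrm (z' r))%:E) ->
  primitive_of O T wc z' ->
  tm.-integrable setT (EFin \o Maj) ->
  (\forall r \ae tm, W (z' r) /\ dir (z' r) (z' r) <= Maj r) ->
  dir wt wt <= 2 * dir w0 w0 + 2 * T * \int[tm]_(r in `]0, t]) Maj r.
Proof.
move=> w0W wtW t0 tT wtE w0E rz iz prim iM zMaj.
have w0H := inW_H1 w0W; have wtH := inW_H1 wtW.
(* the weight for which the quadratic part integrates to at most half of the
energy of the increment *)
have T1 : 0 < T^-1 by rewrite invr_gt0.
have e3 : dot (lap w0) wt = - dir wt w0.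
  by rewrite -dirichletC; exact: green w0W wtH.
apply: (history_duality (inW_L2 w0W) (inW_L2 wtW) (laplacian_inL2 wtW) (laplacian_inL2 w0W)
  t0 tT (green wtW wtH) (green wtW w0H) e3 (green w0W w0H)
  (dirichlet_lin_ge0 1 (-1) wtH w0H) (dirichlet_lin_ge0 1 (-2) wtH w0H)
  wtE w0E rz iz prim iM).
apply: filterS zMaj => r [zW zM]; have zH := inW_H1 zW.
have k0 : 0 <= (2 * T^-1)^-1 by rewrite invr_ge0 mulr_ge0// ltW.
rewrite [leRHS](congr2 (fun a b => a - b) (green wtW zH) (green w0W zH)).
exact: lower_from_young k0 (dirichlet_diff_young wtH w0H zH T1) zM.
Qed.

Section bound.
Variables (D : R -> Prop) (A B th chi thc chc : R -> 'rV[R]_N -> R) (F G P : R -> R).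
Variables (G0 kappa C1 C2 C3 M Kb : R).
Hypotheses (k0 : 0 < kappa) (C10 : 0 <= C1) (C20 : 0 <= C2) (C30 : 0 <= C3) (M1 : 1 <= M).
Hypotheses (Dae : \forall t \ae tm, D t) (Dt : forall t, D t -> 0 < t < T).
Hypotheses (rA : regular O A) (iA : tm.-integrable setT (fun r => (nrm (A r))%:E))
  (rB : regular O B) (iB : tm.-integrable setT (fun r => (nrm (B r))%:E))
  (rth : regular O th) (rchi : regular O chi)
  (thcC : cont_on O T thc) (chcC : cont_on O T chc)
  (Dth : forall t, D t -> \forall x \ae mu, th t x = thc t x)
  (Dchi : forall t, D t -> \forall x \ae mu, chi t x = chc t x)
  (pth : primitive_of O T thc A) (pchi : primitive_of O T chc B)
  (iF : tm.-integrable setT (EFin \o F))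
  (G00 : 0 <= G0) (Gge0 : forall t, D t -> 0 <= G t) (DK : forall t, D t -> G t <= Kb)
  (hist : forall Maj, tm.-integrable setT (EFin \o Maj) -> (forall s, D s -> P s <= Maj s) ->
     forall t, D t -> G t <= 2 * G0 + 2 * T * \int[tm]_(r in `]0, t]) Maj r).
Hypothesis est : forall t, D t -> dot (A t) (th t) + M * dot (B t) (chi t) <=
  - (kappa / 2 * P t) + C1 * G t + C2 +
  C3 * (nrm (th t) ^+ 2 + M * nrm (chi t) ^+ 2) + F t / 2.

(** [alpha] is the factor that balances the two contributions when the history
bound is applied to the majorant of [P] given by [est]: the term [alpha * (E t -
E 0)] then moves to the left-hand side. *)
Let E t := nrm (thc t) ^+ 2 + M * nrm (chc t) ^+ 2.
Let alpha := 2 * T / kappa.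
Let C4 := C1 + C3 / alpha.
Let lambda := 2 * (2 * alpha * C4) + 1.
Let A0 := 2 * G0 + alpha * E 0 + 2 * alpha * (C2 * T + 2^-1 * \int[tm]_r `|F r|).

Let alpha0 : 0 < alpha. Proof. by rewrite /alpha divr_gt0// mulr_gt0. Qed.
Let M0 : 0 <= M. Proof. exact: le_trans ler01 M1. Qed.
Let E0 t : 0 <= E t.
Proof. by apply: addr_ge0; [exact: sqr_ge0|apply: mulr_ge0; [exact: M0|exact: sqr_ge0]]. Qed.
Let C40 : 0 <= C4.
Proof. by apply: addr_ge0 => //; apply: divr_ge0 => //; exact: ltW. Qed.

(** Suppose [G + alpha * E <= m * expR (lambda * _)] on [D]. Then [est] bounds
[P] by an integrable function built from [m * expR (lambda * _)], from [F], and
from minus half the derivative of [E]; [hist] and the energy identities turn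
this into a bound of [G + alpha * E] of the form required by [gronwall_sup]. The
constants depend on the functions of time only through [F], [G0] and the initial
values of [thc] and [chc]. *)
Lemma a_priori_bound t : D t ->
  G t + alpha * E t <= 2 * A0 * expR (lambda * T).
Proof.
move=> Dtt.
have [Kth hKth] := cont_on_bounded T0 thcC; have [Kch hKch] := cont_on_bounded T0 chcC.
have c0 : 0 <= 2 * alpha * C4 by rewrite mulr_ge0// mulr_ge0// ltW.
have l0 : 0 < lambda by rewrite /lambda ltr_wpDl// mulr_ge0.
have I0 : 0 <= \int[tm]_r `|F r| by apply: Rintegral_ge0.
have A00 : 0 <= A0.
  apply: addr_ge0; first by apply: addr_ge0; apply: mulr_ge0 => //; exact: ltW.
  apply: mulr_ge0; first by apply: mulr_ge0 => //; exact: ltW.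
  by apply: addr_ge0; apply: mulr_ge0; rewrite ?invr_ge0 ?(ltW T0).
have Dt' r : D r -> 0 <= r <= T by move=> /Dt /andP[? ?]; rewrite !ltW.
suff : G t + alpha * E t <= 2 * A0 * expR (lambda * t).
  move=> h; apply: le_trans h _; rewrite ler_wpM2l ?mulr_ge0// ler_expR ler_wpM2l ?(ltW l0)//.
  by case/andP: (Dt' t Dtt).
apply: (@gronwall_sup R (fun t => G t + alpha * E t) D A0 (2 * alpha * C4) lambda
  (Kb + alpha * (Kth ^+ 2 + M * Kch ^+ 2))) => //.
- by move=> r /Dt' /andP[].
- by rewrite /lambda; lra.
- move=> r Dr; apply: lerD; first exact: DK.
  rewrite ler_wpM2l ?(ltW alpha0)// /E.
  have h1 := hKth r (Dt' r Dr); have h2 := hKch r (Dt' r Dr).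
  apply: lerD; last rewrite ler_wpM2l//.
    by rewrite ler_sqr ?nnegrE ?normL2_ge0// (le_trans (normL2_ge0 O (thc r))).
  by rewrite ler_sqr ?nnegrE ?normL2_ge0// (le_trans (normL2_ge0 O (chc r))).
move=> m m0 Qm r Dr.
have [e [ie eE eI]] := time_integral_expR T l0.
have /andP[r0 rT] := Dt Dr.
have uth : \forall t \ae tm, \forall x \ae mu, th t x = thc t x by apply: filterS Dae.
have uch : \forall t \ae tm, \forall x \ae mu, chi t x = chc t x by apply: filterS Dae.
have iAt := regular_dot_cont_integrable T0 thcC rth rA iA uth.
have iBc := regular_dot_cont_integrable T0 chcC rchi rB iB uch.
have eth := energy_identity T0 thcC rth rA iA uth pth (lexx 0) (ltW r0) (ltW rT).
have ech := energy_identity T0 chcC rchi rB iB uch pchi (lexx 0) (ltW r0) (ltW rT).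
pose en s := dot (A s) (th s) + M * dot (B s) (chi s).
pose Maj s := 2 / kappa * ((C4 * m * e s + (C2 + 2^-1 * F s)) - en s).
have ien := time_integrableD iAt (time_integrableZl M iBc).
have i1 := time_integrableZl (C4 * m) ie.
have i2 := time_integrableD (time_integrable_cst T C2) (time_integrableZl 2^-1 iF).
have i12 := time_integrableD i1 i2.
have i3 := time_integrableB i12 ien.
have iMaj : tm.-integrable setT (EFin \o Maj) := time_integrableZl (2 / kappa) i3.
have zMaj s : D s -> P s <= Maj s.
  move=> Ds.
  have := est Ds; have := Qm s Ds; rewrite -eE; last exact: Dt.
  rewrite (eq_normL2 (Dth Ds)) (eq_normL2 (Dchi Ds)) -/(E s) => Qs es.
  have CQ : C1 * G s + C3 * E s <= C4 * m * e s.
    rewrite -mulrA; apply: (@le_trans _ _ (C4 * (G s + alpha * E s))); last by rewrite ler_wpM2l.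
    have -> : C4 * (G s + alpha * E s) =
      C1 * G s + C3 * E s + (C1 * (alpha * E s) + C3 / alpha * G s).
      rewrite /C4; field; exact: lt0r_neq0.
    rewrite lerDl; apply: addr_ge0; apply: mulr_ge0; [by []| | |exact: Gge0].
      by apply: mulr_ge0; [exact: ltW|].
    by apply: divr_ge0; [|exact: ltW].
  have kP : kappa / 2 * P s <= (C4 * m * e s + (C2 + 2^-1 * F s)) - en s.
    by rewrite /en; lra.
  rewrite /Maj mulrC -ler_pdivrMr ?divr_gt0//.
  by have -> : P s / (2 / kappa) = kappa / 2 * P s;
    [rewrite invf_div mulrC|].
apply: le_trans (lerD (hist iMaj zMaj Dr) (lexx _)) _.
have -> : \int[tm]_(s in `]0, r]) Maj s = 2 / kappa *
   (C4 * m * \int[tm]_(s in `]0, r]) e s + (C2 * r + 2^-1 * \int[tm]_(s in `]0, r]) F s) -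
    (E r - E 0) / 2).
  rewrite RintegralZl//; last exact: time_integrableS i3.
  congr (_ * _); rewrite RintegralB//; last 2 first.
  - exact: time_integrableS i12.
  - exact: time_integrableS ien.
  rewrite RintegralD//; last 2 first.
  - exact: time_integrableS i1.
  - exact: time_integrableS i2.
  rewrite RintegralZl//; last exact: time_integrableS ie.
  rewrite RintegralD//; last 2 first.
  - exact: (time_integrableS 0 r (time_integrable_cst T C2)).
  - exact: (time_integrableS 0 r (time_integrableZl 2^-1 iF)).
  rewrite (time_Rintegral_cst C2 (lexx 0) (ltW r0) (ltW rT)) RintegralZl//; last exact: time_integrableS iF.
  rewrite RintegralD//; last 2 first.
  - exact: time_integrableS iAt.
  - exact: (time_integrableS 0 r (time_integrableZl M iBc)).
  rewrite RintegralZl//; last exact: time_integrableS iBc.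
  rewrite subr0; congr (_ - _).
  have -> : E r - E 0 = (nrm (thc r) ^+ 2 - nrm (thc 0) ^+ 2) + M * (nrm (chc r) ^+ 2 - nrm (chc 0) ^+ 2).
    by rewrite /E; ring.
  by rewrite eth ech; field.
have IF := time_Rintegral_le_norm 0 r iF.
have Ie := eI r (ltW r0) rT.
have h1 : C4 * m * \int[tm]_(s in `]0, r]) e s <= C4 * m * (expR (lambda * r) / lambda).
  by rewrite ler_wpM2l// mulr_ge0.
have h2 : C2 * r <= C2 * T by rewrite ler_wpM2l// ltW.
move: h1 h2 IF; set X1 := \int[tm]_(s in _) e s; set X2 := \int[tm]_(s in _) F s.
set Y := expR _ / _; move=> h1 h2 IF.
have -> : 2 * T * (2 / kappa * (C4 * m * X1 + (C2 * r + 2^-1 * X2) - (E r - E 0) / 2)) =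
  2 * alpha * (C4 * m * X1 + (C2 * r + 2^-1 * X2)) - alpha * (E r - E 0).
  by rewrite /alpha; field; rewrite gt_eqF.
have : 2 * alpha * (C4 * m * X1 + (C2 * r + 2^-1 * X2)) <=
  2 * alpha * (C4 * m * Y + (C2 * T + 2^-1 * \int[tm]_r `|F r|)).
  apply: ler_wpM2l; first by apply: mulr_ge0 => //; exact: ltW.
  apply: lerD => //; apply: lerD => //; apply: ler_wpM2l => //.
have -> : A0 + 2 * alpha * C4 * m * Y = 2 * G0 + alpha * E 0 +
    2 * alpha * (C4 * m * Y + (C2 * T + 2^-1 * \int[tm]_r `|F r|)).
  by rewrite /A0; ring.
move: (2 * alpha * _) (2 * alpha * _) => Z1 Z2 hZ; rewrite mulrBr; lra.
Qed.

End bound.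

End a_priori.

Section one_time.
Context (R : realType) (N : nat) (O : smooth_domain R N).
Local Notation mu := (dom_measure O).
Local Notation L2 := (inL2 O).
Local Notation dot := (dotL2 O).
Local Notation nrm := (normL2 O).
Local Notation W := (inW O).
Local Notation lap := (laplacian O).
Local Notation dir := (dirichlet O).

(** The function [z] is recovered from [theta = z + l p] and [chi = p - q]. *)
Lemma normL2_lin3 (z p q : 'rV[R]_N -> R) (l : R) : 0 <= l -> L2 z -> L2 p -> L2 q ->
  nrm z <= nrm (fun x => z x + l * p x) + l * nrm (fun x => p x - q x) + l * nrm q.
Proof.
move=> l0 zL pL qL; have thL := inL2D zL (inL2Z l pL).
have chL := inL2Z l (inL2B pL qL); have lqL := inL2Z l qL.
have h1 := normL2B (inL2B thL chL) lqL; have h2 := normL2B thL chL.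
rewrite (normL2Z l qL) (ger0_norm l0) in h1.
rewrite (normL2Z l (inL2B pL qL)) (ger0_norm l0) in h2.
apply: (@le_trans _ _ (nrm (fun x => z x + l * p x - l * (p x - q x) - l * q x))).
  by rewrite le_eqVlt; apply/orP; left; apply/eqP; congr normL2; apply/funext => x; ring.
by apply: le_trans h1 _; rewrite lerD2r.
Qed.

Lemma one_time_energy (bh : R -> \bar R) (pi : R -> R) (L kappa tau l gamma rho : R)
    (A B u z p ps xi b s f : 'rV[R]_N -> R) :
  (forall r, (0 <= bh r)%E) ->
  measurable_fun setT pi -> 0 <= L -> (forall r s, `|pi r - pi s| <= L * `|r - s|) ->
  0 < kappa -> 0 < tau -> 0 < l -> 0 < gamma -> 0 <= rho ->
  L2 A -> L2 B -> W u -> W z -> W p -> W ps -> L2 xi -> L2 b -> L2 f ->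
  (\forall x \ae mu, A x - kappa * lap z x - tau * lap u x = f x) ->
  (\forall x \ae mu, B x - lap p x + xi x + pi (p x) + rho * s x = gamma * z x) ->
  Sign O (fun x => p x - ps x) s ->
  (\forall x \ae mu, subdiff bh (p x) (xi x)) ->
  (\forall x \ae mu, min_subdiff bh (ps x) (b x)) ->
  let M := 2 * kappa * l ^+ 2 + 1 in
  let K1 := nrm b + nrm (fun x => pi (ps x)) in
  let th := fun x => z x + l * p x in
  let chi := fun x => p x - ps x in
  dot A th + M * dot B chi <= - (kappa / 2 * dir z z) +
    (tau ^+ 2 / kappa + tau ^+ 2 * l ^+ 2 / 2) * dir u u +
    M * (dir ps ps / 2 + K1 ^+ 2 / 2 + (gamma * l * nrm ps) ^+ 2 / 2) +
    (2^-1 + M * gamma / 2 + 1 + L + gamma / 2 + gamma * l) *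
      (nrm th ^+ 2 + M * nrm chi ^+ 2) + nrm f ^+ 2 / 2 /\
  dot B chi <= (nrm (lap ps) + (K1 + L * nrm chi + gamma * nrm z - rho)) * nrm chi.
Proof.
move=> bh0 mpi L0 piL k0 t0 l0 g0 r0 AL BL uW zW pW psW xL bL fL eA eB sg sx sb M K1 th chi.
have mono : \forall x \ae mu, 0 <= (xi x - b x) * (p x - ps x).
  by apply: filterS2 sx sb => x hx [hb _]; exact: subdiff_monotone hx hb.
have ht := heat_test k0 t0 l0 AL uW zW pW fL eA.
have ph := phase_test mpi L0 (ltW g0) piL pW psW (inW_L2 zW) BL xL bL eB mono sg.
have [d1 d2] := laplacian_dissipates pW psW.
have K0 : 0 <= K1 by rewrite addr_ge0 ?normL2_ge0.
split.
  exact: (energy_young k0 l0 g0 L0 K0 (normL2_ge0 O ps) r0 (normL2_ge0 O chi)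
    (normL2_ge0 O th) (normL2_ge0 O z) ht ph d1
    (normL2_lin3 (ltW l0) (inW_L2 zW) (inW_L2 pW) (inW_L2 psW))).
apply: le_trans ph _; rewrite [leRHS]mulrDl; exact: (lerD d2 (lexx _)).
Qed.

End one_time.

Section final_bounds.
Context (R : realType) (N : nat) (O : smooth_domain R N) (T : R).
Hypothesis T0 : 0 < T.
Local Notation mu := (dom_measure O).
Local Notation dot := (dotL2 O).
Local Notation nrm := (normL2 O).
Local Notation tm := (time_measure T).

(** A first use of the energy identity shows that the norm is nonincreasing;
hence on an interval it is at least its final value, and a second use gives the
hypothesis of [extinction]. *)
Lemma extinction_L2 (chi chc B : R -> 'rV[R]_N -> R) (delta : R) :
  cont_on O T chc -> regular O chi -> regular O B ->
  tm.-integrable setT (fun r => (nrm (B r))%:E) ->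
  (\forall t \ae tm, \forall x \ae mu, chi t x = chc t x) ->
  primitive_of O T chc B -> 0 < delta ->
  (\forall t \ae tm, dot (B t) (chi t) <= - delta * nrm (chi t)) ->
  4 * nrm (chc 0) < delta * T ->
  forall t, T / 2 <= t -> t <= T -> nrm (chc t) = 0.
Proof.
move=> [cL cc] rchi rB iB uuc prim d0 dec small.
have ii := regular_dot_cont_integrable T0 (conj cL cc) rchi rB iB uuc.
have en := energy_identity T0 (conj cL cc) rchi rB iB uuc prim.
have noninc s t : 0 <= s -> s <= t -> t <= T -> nrm (chc t) <= nrm (chc s).
  move=> s0 st tT; rewrite -ler_sqr ?nnegrE ?normL2_ge0// -subr_le0 en// pmulr_rle0//.
  have := @time_Rintegral_cst R T 0 s t s0 st tT; rewrite mul0r => <-.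
  apply: time_ae_le_Rintegral => //; first exact: time_integrable_cst.
  apply: filterS dec => r h _; apply: le_trans h _.
  by rewrite mulNr oppr_le0 mulr_ge0 ?normL2_ge0// ltW.
apply: (@extinction R T delta (fun t => nrm (chc t))) => // [t _|x xT eta eta0|s t s0 st tT].
- exact: normL2_ge0.
- have [d dd hd] := cc x xT eta eta0; exists d => // z zT zx.
  by apply: le_trans (hd z zT zx); apply: normL2_dist; exact: cL.
- rewrite en//.
  have := @time_Rintegral_cst R T (- delta * nrm (chc t)) s t s0 st tT => cE.
  have -> : - (2 * delta * (t - s) * nrm (chc t)) = 2 * (- delta * nrm (chc t) * (t - s)) by ring.
  rewrite ler_pM2l// -cE.
  apply: time_ae_le_Rintegral => //; first exact: time_integrable_cst.
  apply: (filterS2 _ _ dec uuc) => r h e /andP[sr rt]; apply: le_trans h _.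
  rewrite (eq_normL2 e) !mulNr lerN2 ler_wpM2l ?(ltW d0)//.
  by apply: noninc => //; exact: le_trans (ltW sr).
Qed.

End final_bounds.

(** * The extinction theorem *)

(** Squares are compared with first powers through [2 x <= 1 + x ^+ 2], which
explains the shift by 1 in [BB]. *)
Lemma reaction_le_gap (R : realFieldType) (L l gamma M BB x y z s n K1 rho : R) :
  0 <= L -> 0 <= l -> 0 <= gamma -> 1 <= M -> y ^+ 2 + M * x ^+ 2 <= BB - 1 ->
  z <= y + l * x + l * s ->
  n + (K1 + L * x + gamma * z - rho) <=
  - (rho - (n + (K1 + L * BB + gamma * (BB + l * BB + l * s)))).
Proof.
move=> L0 l0 g0 M1 E1 zB.
have Mx : x ^+ 2 <= M * x ^+ 2 by rewrite ler_peMl// sqr_ge0.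
have sx := sqr_ge0 (x - 1); have sy := sqr_ge0 (y - 1).
have sx' := sqr_ge0 x; have sy' := sqr_ge0 y.
have xB : x <= BB by lra.
have yB : y <= BB by lra.
have Lx := ler_wpM2l L0 xB; have lx := ler_wpM2l l0 xB.
have gz : gamma * z <= gamma * (BB + l * BB + l * s) by rewrite ler_wpM2l//; lra.
lra.
Qed.

Lemma time_aeI (R : realType) (T : R) (P Q : R -> Prop) :
  (\forall t \ae time_measure T, P t) -> (\forall t \ae time_measure T, Q t) ->
  \forall t \ae time_measure T, P t /\ Q t.
Proof. exact: filterI. Qed.

Unset Implicit Arguments. Set Strict Implicit. Set Printing Implicit Defensive.

Theorem theorem2p10 (R : realType) (N : nat) (hN : (0 < N)%N)
  (O : smooth_domain R N) (T : R) (hT : 0 < T)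
  (bh : R -> \bar R)
  (bh_ge0 : forall r, (0 <= bh r)%E)
  (bh_convex : convex_ereal bh)
  (bh_proper : proper_ereal bh)
  (bh_lsc : lower_semicontinuous bh)
  (bh0 : bh 0 = 0%E)
  (pih : R -> R)
  (pih_derivable : forall r, derivable pih r 1)
  (pih_C1 : continuous (derive1 pih))
  (pih_lipschitz : exists L : R,
    forall r s, `|derive1 pih r - derive1 pih s| <= L * `|r - s|)
  (kappa tau gamma l : R)
  (hkappa : 0 < kappa) (htau : 0 < tau) (hgamma : 0 < gamma) (hl : 0 < l)
  (f : measurableTypeR R * 'rV[R]_N -> R)
  (hf : f \in Lfun (cylinder_measure O T) 2%:E)
  (theta0 w0 phi0 phistar : 'rV[R]_N -> R)
  (htheta0 : inH1 O theta0) (hw0 : inW O w0) (hphi0 : inH1 O phi0)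
  (hbphi0 : (dom_measure O).-integrable [set: 'rV[R]_N] (bh \o phi0))
  (hphistar : inW O phistar)
  (hbphistar : exists2 b : 'rV[R]_N -> R, inL2 O b &
    \forall x \ae dom_measure O, min_subdiff bh (phistar x) (b x)) :
  exists2 rhostar : R, 0 < rhostar &
    forall rho : R, rhostar < rho ->
    forall w phi xi sigma : R -> 'rV[R]_N -> R,
    solutionB O T bh pih kappa tau gamma l rho f theta0 w0 phi0 phistar
      w phi xi sigma ->
    exists2 Tstar : R, 0 <= Tstar < T &
      \forall t \ae time_measure T, Tstar < t ->
        \forall x \ae dom_measure O, phi t x = phistar x.
Proof.
have [L0 lipL0] := pih_lipschitz.
set L := `|L0|; have LL : 0 <= L by exact: normr_ge0.
have lip r s : `|derive1 pih r - derive1 pih s| <= L * `|r - s|.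
  by apply: le_trans (lipL0 r s) _; rewrite ler_wpM2r// ler_norm.
have mpi := continuous_measurable_fun pih_C1.
have [b bL sb] := hbphistar.
have [F iF fF] := slice_source hf.
have psL := inW_L2 hphistar.
pose M := 2 * kappa * l ^+ 2 + 1.
pose C1 := tau ^+ 2 / kappa + tau ^+ 2 * l ^+ 2 / 2.
pose K1 := normL2 O b + normL2 O (fun x => derive1 pih (phistar x)).
pose C2 := M * (dirichlet O phistar phistar / 2 + K1 ^+ 2 / 2 +
  (gamma * l * normL2 O phistar) ^+ 2 / 2).
pose C3 := 2^-1 + M * gamma / 2 + 1 + L + gamma / 2 + gamma * l.
pose alpha := 2 * T / kappa.
pose x0 := normL2 O (fun x => phi0 x - phistar x).
pose E0 := normL2 O (fun x => theta0 x + l * phi0 x) ^+ 2 + M * x0 ^+ 2.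
pose A0 := 2 * dirichlet O w0 w0 + alpha * E0 +
  2 * alpha * (C2 * T + 2^-1 * \int[time_measure T]_r `|F r|).
pose lambda := 2 * (2 * alpha * (C1 + C3 / alpha)) + 1.
(* [BB] bounds the norms of [theta] and [chi], and [Mb] the terms opposed to
[rho] *)
pose BB := 2 * A0 * expR (lambda * T) / alpha + 1.
pose Mb := normL2 O (laplacian O phistar) +
  (K1 + L * BB + gamma * (BB + l * BB + l * normL2 O phistar)).
have x00 : 0 <= x0 by exact: normL2_ge0.
have x0T : 0 <= 4 * x0 / T by rewrite divr_ge0 ?mulr_ge0// ltW.
have M1 : 1 <= M by rewrite /M lerDr mulr_ge0 ?sqr_ge0// mulr_ge0// ltW.
have M0 : 0 <= M by exact: le_trans ler01 M1.
have alpha0 : 0 < alpha by rewrite /alpha divr_gt0// mulr_gt0.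
have C10 : 0 <= C1.
  by rewrite /C1 addr_ge0// ?divr_ge0 ?mulr_ge0 ?sqr_ge0// ltW.
have C20 : 0 <= C2.
  apply: mulr_ge0 => //; apply: addr_ge0; last by rewrite divr_ge0 ?sqr_ge0.
  by apply: addr_ge0; rewrite divr_ge0 ?sqr_ge0// dirichlet_ge0.
have C30 : 0 <= C3.
  have g2 := ltW hgamma; have gl := mulr_ge0 g2 (ltW hl); have Mg := mulr_ge0 M0 g2.
  by rewrite /C3; lra.
exists (`|Mb| + 4 * x0 / T + 1); first by rewrite ltr_wpDl// addr_ge0.
move=> rho hrho w phi xi sigma sol.
have rho0 : 0 <= rho by apply: le_trans (ltW hrho); rewrite !addr_ge0.
have [[_ wdt _] [zL2 zdt zzL2]] := w_H2_H sol.
have [pL2 pdt ppL2] := phi_H1_H sol.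
have [_ dw] := dt_spec wdt; have [_ dz] := dt_spec zdt; have [_ dp] := dt_spec pdt.
have thdt := has_dt_lin l zL2 pL2 zzL2 ppL2 dz dp.
have [thA dth] := dt_spec thdt.
have [A [rA iA eA]] := inLp1_regular thA.
have [z' [rz iz ez]] := inLp2_regular zL2.
have [p' [rp ip ep]] := inLp2_regular pL2.
have [B [rB iB eB]] := inLp2_regular ppL2.
have [wc [wcC wE w0E]] := initial_value_cont_on (w_initial sol).
have [zc [zcC zE z0E]] := initial_value_cont_on (wt_initial sol).
have [pc [pcC pE p0E]] := initial_value_cont_on (phi_initial sol).
pose thc := fun t x => zc t x + l * pc t x.
have thcC : cont_on O T thc := cont_on_lin l zcC pcC.
pose chc := fun t x => pc t x - phistar x.
have chcC : cont_on O T chc.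
  have := cont_on_lin (-1) pcC (cont_on_cst T psL); congr cont_on.
  by apply/funext => t; apply/funext => x; rewrite mulN1r.
pose th := fun t x => z' t x + l * p' t x.
have rth : regular O th := regularD rz (regularZ l rp).
pose chi := fun t x => p' t x - phistar x.
have rchi : regular O chi := regularB rp (regular_cst psL).
have pth : primitive_of O T thc A.
  apply: (time_derivative_primitive hT thcC _ dth rA iA eA).
  by apply: filterS2 zE pE => t h1 h2; apply: filterS2 h1 h2 => x; rewrite /thc => -> ->.
have pp := time_derivative_primitive hT pcC pE dp rB iB eB.
have pchi : primitive_of O T chc B.
  move=> h s t hL s0 st tT; rewrite -(pp h s t hL s0 st tT).
  have ptL : inL2 O (pc t) by apply: pcC.1; rewrite tT (le_trans s0 st).
  have psL' : inL2 O (pc s) by apply: pcC.1; rewrite s0 (le_trans st tT).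
  by rewrite (dotBl ptL psL hL) (dotBl psL' psL hL); ring.
have pw := time_derivative_primitive hT wcC wE dw rz iz ez.
have [wLoo _ _] := w_W1oo_V sol.
have [_ [Kw wK]] := inLpy_bound hT wLoo.
pose D t := [/\ 0 < t < T,
  [/\ inW O (w t), inW O (dt O T w t), inW O (phi t) & normH1 O (w t) <= Kw],
  [/\ dt O T w t = z' t, phi t = p' t, dt O T phi t = B t &
     dt O T (fun s y => dt O T w s y + l * phi s y) t = A t],
  [/\ \forall x \ae dom_measure O, w t x = wc t x,
     \forall x \ae dom_measure O, dt O T w t x = zc t x &
     \forall x \ae dom_measure O, phi t x = pc t x] &
  [/\ \forall x \ae dom_measure O,
      dt O T (fun s y => dt O T w s y + l * phi s y) t x
        - kappa * laplacian O (dt O T w t) x - tau * laplacian O (w t) x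
      = f (t, x),
    \forall x \ae dom_measure O,
      dt O T phi t x - laplacian O (phi t) x + xi t x + derive1 pih (phi t x)
        + rho * sigma t x
      = gamma * dt O T w t x,
    Sign O (fun x => phi t x - phistar x) (sigma t),
    inL2 O (xi t) /\ (\forall x \ae dom_measure O, subdiff bh (phi t x) (xi t x)) &
    inL2 O (fun x => f (t, x)) /\ normL2 O (fun x => f (t, x)) ^+ 2 = F t]].
have [[[wW _] _] _ [[zW _] _]] := w_H1_W sol.
have [[pW _] _] := phi_L2_W sol.
have [[xL _] _] := xi_L2_H sol.
have Dae : \forall t \ae time_measure T, D t.
  have q1 := time_ae_itv T; have q2 := w_equation sol; have q3 := phi_equation sol.
  have q4 := sigma_Sign sol; have q5 := xi_beta sol.
  (* all properties needed at a fixed time hold together on a set of times of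
  full measure *)
  have all := time_aeI q1 (time_aeI wW (time_aeI zW (time_aeI pW (time_aeI wK (time_aeI ez (time_aeI ep (time_aeI eB (time_aeI eA (time_aeI wE (time_aeI zE (time_aeI pE (time_aeI q2 (time_aeI q3 (time_aeI q4 (time_aeI xL (time_aeI q5 fF)))))))))))))))).
  apply: filterS all => t [h1 [h2 [h3 [h4 [h5 [h6 [h7 [h8 [h9 [h10 [h11 [h12 [h13 [h14 [h15 [h16 [h17 h18]]]]]]]]]]]]]]]]]; split.
  - exact: h1.
  - by split; [exact: h2|exact: h3|exact: h4|exact: h5].
  - by split; [exact: h6|exact: h7|exact: h8|exact: h9].
  - by split; [exact: h10|exact: h11|exact: h12].
  - by split; [exact: h13|exact: h14|exact: h15|exact: (conj h16 h17)|exact: h18].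
have Dt t : D t -> 0 < t < T by case.
have Dth t : D t -> \forall x \ae dom_measure O, th t x = thc t x.
  move=> [_ _ [e1 e2 _ _] [_ h1 h2] _].
  by rewrite /th -e1 -e2; apply: filterS2 h1 h2 => x; rewrite /thc => -> ->.
have Dchi t : D t -> \forall x \ae dom_measure O, chi t x = chc t x.
  move=> [_ _ [_ e2 _ _] [_ _ h2] _].
  by rewrite /chi -e2; apply: filterS h2 => x; rewrite /chc => ->.
have energy t : D t ->
    dotL2 O (A t) (th t) + M * dotL2 O (B t) (chi t) <=
      - (kappa / 2 * dirichlet O (z' t) (z' t)) + C1 * dirichlet O (w t) (w t) + C2 +
      C3 * (normL2 O (th t) ^+ 2 + M * normL2 O (chi t) ^+ 2) + F t / 2 /\
    dotL2 O (B t) (chi t) <= (normL2 O (laplacian O phistar) +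
      (K1 + L * normL2 O (chi t) + gamma * normL2 O (z' t) - rho)) * normL2 O (chi t).
  move=> [_ [wtW ztW ptW _] [e1 e2 e3 e4] _ [h1 h2 h3 [h4 h5] [h6 h7]]].
  rewrite /th /chi -h7 -e1 -e2 -e3 -e4.
  apply: (one_time_energy bh_ge0 mpi LL lip hkappa htau hl hgamma rho0 _ _ wtW ztW ptW
    hphistar h4 bL h6 h1 h2 h3 h5 sb).
    by rewrite e4; exact: regular_inL2.
  by rewrite e3; exact: regular_inL2.
have bound t : D t ->
    dirichlet O (w t) (w t) +
      alpha * (normL2 O (thc t) ^+ 2 + M * normL2 O (chc t) ^+ 2) <=
    2 * A0 * expR (lambda * T).
  have -> : A0 = 2 * dirichlet O w0 w0 +
      alpha * (normL2 O (thc 0) ^+ 2 + M * normL2 O (chc 0) ^+ 2) +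
      2 * alpha * (C2 * T + 2^-1 * \int[time_measure T]_r `|F r|).
    rewrite /A0 /E0 /x0; congr (_ + alpha * (_ ^+ 2 + M * _ ^+ 2) + _); apply: eq_normL2.
      by apply: filterS2 z0E p0E => x; rewrite /thc => -> ->.
    by apply: filterS p0E => x; rewrite /chc => ->.
  apply: (a_priori_bound hT (P := fun t => dirichlet O (z' t) (z' t))
    (G := fun t => dirichlet O (w t) (w t)) (Kb := Kw ^+ 2)
    hkappa C10 C20 C30 M1 Dae Dt rA iA rB iB rth rchi thcC chcC Dth Dchi pth pchi iF) => //.
  - exact: dirichlet_ge0.
  - by move=> s _; exact: dirichlet_ge0.
  - move=> s [_ [wsW _ _ wsK] _ _ _].
    by have [] := normH1_ge (inW_H1 wsW) wsK.
  - move=> Maj iM PM s Ds.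
    have [/andP[s0 sT] [wsW _ _ _] _ [wsE _ _] _] := Ds.
    apply: (dirichlet_history hT hw0 wsW (ltW s0) (ltW sT) wsE w0E rz iz pw iM).
    apply: filterS Dae => r Dr; split; last exact: PM.
    by have [_ [_ zrW _ _] [<- _ _ _] _ _] := Dr.
  - by move=> s /energy[].
have decay : \forall t \ae time_measure T,
    dotL2 O (B t) (chi t) <= - (rho - Mb) * normL2 O (chi t).
  apply: filterS Dae => t Dt'; have [_ h] := energy t Dt'; apply: le_trans h _.
  rewrite ler_wpM2r ?normL2_ge0//.
  have bnd := bound t Dt'.
  have n1 := eq_normL2 (Dth t Dt'); have n2 := eq_normL2 (Dchi t Dt').
  rewrite -n1 -n2 in bnd.
  have d0 := dirichlet_ge0 O (w t).
  have E1 : normL2 O (th t) ^+ 2 + M * normL2 O (chi t) ^+ 2 <= BB - 1.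
    rewrite /BB addrK ler_pdivlMr// mulrC; apply: le_trans bnd; by rewrite lerDr.
  have n3 : normL2 O (z' t) <= normL2 O (th t) + l * normL2 O (chi t) + l * normL2 O phistar.
    exact: (normL2_lin3 (ltW hl) (regular_inL2 t rz) (regular_inL2 t rp) psL).
  exact: (reaction_le_gap _ _ _ LL (ltW hl) (ltW hgamma) M1 E1 n3).
have delta0 : 4 * x0 / T < rho - Mb.
  rewrite ltrBrDl; apply: le_lt_trans hrho.
  apply: (@le_trans _ _ (`|Mb| + 4 * x0 / T)); last by rewrite lerDl.
  by rewrite lerD2r; exact: ler_norm.
have d0 : 0 < rho - Mb by exact: le_lt_trans x0T delta0.
have small : 4 * normL2 O (chc 0) < (rho - Mb) * T.
  rewrite -ltr_pdivrMr//; apply: le_lt_trans delta0.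
  rewrite ler_pM2r ?invr_gt0// ler_pM2l// le_eqVlt; apply/orP; left; apply/eqP.
  by apply: eq_normL2; apply: filterS p0E => x; rewrite /chc => ->.
have uch : \forall t \ae time_measure T, \forall x \ae dom_measure O, chi t x = chc t x.
  exact: filterS Dae.
have ext := extinction_L2 hT chcC rchi rB iB uch pchi d0 decay small.
exists (T / 2).
  by rewrite divr_ge0 ?(ltW hT)//= ltr_pdivrMr// ltr_pMr// ltr1n.
apply: filterS Dae => t [/andP[t0 tT] _ _ [_ _ h] _] tT2.
have tI : 0 <= t <= T by rewrite !ltW.
have := normL2_eq0 (chcC.1 t tI) (ext t (ltW tT2) (ltW tT)).
by apply: filterS2 h => x ->; rewrite /chc => /eqP; rewrite subr_eq0 => /eqP.
Qed.
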